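(* Let $(\mathbf{T},h)$ be a cyclic commuting $d$-tuple on a Hilbert space $\mathcal{H}$ such that $\mathcal{I}_{\mathbf{T}}=\{f\in F^2: f(\mathbf{T})=0\}$ is graded, i.e., $\mathcal{I}_{\mathbf{T}}$ is the closure in the Fock space $F^2$ of a homogeneous ideal of $\mathbb{C}[z_1,\dots,z_d]$. Let $\{\lambda_k\}$ be the sequence of singular values of the positive compact operator $L_{\mathbf{T},h}$ on $F^2$ (its nonzero eigenvalues, repeated according to multiplicity and listed in non-increasing order). Then $$\limsup_{k\to\infty}\frac{\ln k}{\ln\ln(1/\lambda_k)}\leq\dim_{\mathbb{C}}Z(\mathcal{I}_{\mathbf{T}}),$$ where $Z(\mathcal{I}_{\mathbf{T}})=\{z\in\mathbb{C}^d: f(z)=0\ \text{for all } f\in\mathcal{I}_{\mathbf{T}}\}$.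
   Context: A cyclic commuting $d$-tuple $(\mathbf{T},h)$ on a Hilbert space $\mathcal{H}$ is a tuple $\mathbf{T}=(T_1,\dots,T_d)$ of pairwise commuting bounded linear operators on $\mathcal{H}$ together with a vector $h\in\mathcal{H}$ such that $\{p(\mathbf{T})h: p\in\mathbb{C}[z_1,\dots,z_d]\}$ is dense in $\mathcal{H}$. The Fock space $F^2$ is the Hilbert space of entire functions $f$ on $\mathbb{C}^d$ with $\|f\|_{F^2}^2=\int_{\mathbb{C}^d}|f(z)|^2\,\pi^{-d}e^{-|z|^2}\,dm(z)<\infty$, where $m$ is Lebesgue measure. For entire $f=\sum_\alpha a_\alpha z^\alpha$, write $f(\mathbf{T})=\sum_\alpha a_\alpha\mathbf{T}^\alpha$. Define $\iota:F^2\to\mathcal{H}$ by $\iota f=f(\mathbf{T})h$. The operator $\iota$ is compact, and $L_{\mathbf{T},h}=\iota^*\iota$ is a positive compact operator on $F^2$. *)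

(* Defs.v *)
From HB Require Import structures.
From mathcomp Require Import all_boot all_order all_algebra.
From mathcomp Require Import sesquilinear.
From mathcomp Require Import complex.
From mathcomp Require Import -(notations) mpoly.
From mathcomp Require Import all_classical all_reals all_analysis.

Set Implicit Arguments.
Unset Strict Implicit.
Unset Printing Implicit Defensive.

Import Order.TTheory GRing.Theory Num.Theory.
Import numFieldNormedType.Exports.

Local Open Scope classical_set_scope.
Local Open Scope ring_scope.

(* Packing R[i] as a numClosedFieldType makes available the topology that the
   library puts on every numClosedFieldType. *)
Definition Cx (R : realType) : numClosedFieldType := R[i].

(* The library registers sigma-finiteness of [m1 \x m2] under a canonical
   projection that is shadowed by the one for probabilities; it is proved here
   again so that it can be used. *)
Lemma product_measure_sigma_finite (d1 d2 : measure_display)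
    (T1 : measurableType d1) (T2 : measurableType d2) (R : realType)
    (m1 : {sigma_finite_measure set T1 -> \bar R})
    (m2 : {sigma_finite_measure set T2 -> \bar R}) :
  sigma_finite setT (m1 \x m2)%E.
Proof.
have /sigma_finiteP[F [TF ndF Foo]] := sigma_finiteT m1.
have /sigma_finiteP[G [TG ndG Goo]] := sigma_finiteT m2.
exists (fun n => F n `*` G n).
  rewrite -setXTT TF TG predeqE => -[x y]; split.
    move=> [/= [n _ Fnx] [k _ Gky]]; exists (maxn n k) => //; split.
    - by move: x Fnx; exact/subsetPset/ndF/leq_maxl.
    - by move: y Gky; exact/subsetPset/ndG/leq_maxr.
  by move=> [n _ []/= ? ?]; split; exists n.
move=> k; have [? ?] := Foo k; have [? ?] := Goo k.
split; first exact: measurableX.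
by rewrite product_measure1E// lte_mul_pinfty// ge0_fin_numE.
Qed.

(* Powers of a sigma-finite measure, on the product sigma-algebra of n-tuples. *)
Section product_power.
Context (R : realType) (dT : measure_display) (T : measurableType dT).
Local Open Scope ereal_scope.

Definition tcons (n : nat) (p : T * n.-tuple T) : n.+1.-tuple T :=
  [the n.+1.-tuple T of p.1 :: p.2].

Lemma measurable_tcons (n : nat) :
  measurable_fun [set: T * n.-tuple T] (@tcons n).
Proof. exact: measurable_cons. Qed.

Section step.
Context (m : {sigma_finite_measure set T -> \bar R}) (n : nat).
Context (mu : {sigma_finite_measure set (n.-tuple T) -> \bar R}).

Definition prod_step : set (n.+1.-tuple T) -> \bar R :=
  pushforward (m \x mu) (@tcons n).

Let prod_step0 : prod_step set0 = 0.
Proof. by rewrite /prod_step /pushforward preimage_set0 measure0. Qed.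

Let prod_step_ge0 A : 0 <= prod_step A.
Proof. exact: (measure_ge0 (m \x mu)). Qed.

Let prod_step_sigma_additive : semi_sigma_additive prod_step.
Proof.
exact: (@measure_semi_sigma_additive _ _ _
  (measure_function_pushforward__canonical__measure_function_Measure (m \x mu) (@measurable_tcons n))).
Qed.

HB.instance Definition _ := isMeasure.Build _ _ _ prod_step
  prod_step0 prod_step_ge0 prod_step_sigma_additive.

Let prod_step_sigma_finite : sigma_finite setT prod_step.
Proof.
have [F TF Foo] := product_measure_sigma_finite m mu.
pose u (t : n.+1.-tuple T) := (thead t, [tuple of behead t] : n.-tuple T).
have mu_ : measurable_fun [set: n.+1.-tuple T] u.
  apply: measurable_fun_pair; last exact: measurable_behead.
  exact: measurable_tnth.
exists (fun k => u @^-1` F k).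
  by rewrite -preimage_bigcup -TF preimage_setT.
move=> k; have [mF Fk] := Foo k; split.
  by rewrite -[X in measurable X]setTI; exact: mu_.
rewrite /prod_step /pushforward -comp_preimage (_ : u \o @tcons n = id) //.
apply/funext => -[x t]; rewrite /u /tcons /=; congr pair.
exact: val_inj.
Qed.

HB.instance Definition _ := @Measure_isSigmaFinite.Build _ _ _ prod_step
  prod_step_sigma_finite.

End step.

Fixpoint prod_power (m : {sigma_finite_measure set T -> \bar R}) (n : nat) :
    {sigma_finite_measure set (n.-tuple T) -> \bar R} :=
  match n with
  | 0 => dirac [tuple]
  | n'.+1 => prod_step m (prod_power m n')
  end.

End product_power.

Section lebesgue.
Context (R : realType).

Definition plane_measure : set (measurableTypeR R * measurableTypeR R) -> \bar R :=
  ((@lebesgue_measure R) \x (@lebesgue_measure R))%E.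

HB.instance Definition _ := Measure.on plane_measure.
HB.instance Definition _ := @Measure_isSigmaFinite.Build _ _ _ plane_measure
  (product_measure_sigma_finite _ _).

(* Lebesgue measure on C^d, the latter being coordinatized as (R * R)^d. *)
Definition lebesgue_Cd (d : nat) :=
  prod_power [the {sigma_finite_measure set _ -> \bar R} of plane_measure] d.

Definition Cd_of_reals (d : nat) (t : d.-tuple (measurableTypeR R * measurableTypeR R)) :
    'I_d -> Cx R :=
  fun i => ((tnth t i).1 +i* (tnth t i).2)%C.

End lebesgue.

Section fock.
Context (R : realType) (d : nat).
Local Notation C := (Cx R).
Local Notation Cd := ('I_d -> C).

Definition monomial (m : multinom d) (z : Cd) : C := mmap1 z m.

(* The power series sum_m a_m z^m converges absolutely on all of C^d, and its
   sum is [f]. The sums run over the exponents of total degree less than n. *)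
Definition expands (f : Cd -> C) (a : multinom d -> C) : Prop :=
  forall z : Cd,
    (exists M : C, forall n : nat,
      \sum_(m : bmultinom d n) `|a m * monomial m z| <= M) /\
    (fun n : nat => \sum_(m : bmultinom d n) a m * monomial m z) @ \oo --> f z.

Definition entire (f : Cd -> C) : Prop := exists a, expands f a.

Definition taylor (f : Cd -> C) : multinom d -> C :=
  xget (fun=> 0) [set a | expands f a].

Definition sqmod (w : C) : R := complex.Re w ^+ 2 + complex.Im w ^+ 2.

Definition gauss_density (z : Cd) : R :=
  (pi ^+ d)^-1 * expR (- \sum_(i < d) sqmod (z i)).

Definition fock_sqnorm (f : Cd -> C) : \bar R :=
  (\int[@lebesgue_Cd R d]_t
    (sqmod (f (Cd_of_reals t)) * gauss_density (Cd_of_reals t))%:E)%E.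

Definition fock : set (Cd -> C) :=
  [set f | entire f /\ (fock_sqnorm f < +oo)%E].

(* Integral over C^d of a complex function against the Gaussian density. *)
Definition gauss_integral_C (F : Cd -> C) : C :=
  ((\int[@lebesgue_Cd R d]_t
      (complex.Re (F (Cd_of_reals t)) * gauss_density (Cd_of_reals t)))%R +i*
   (\int[@lebesgue_Cd R d]_t
      (complex.Im (F (Cd_of_reals t)) * gauss_density (Cd_of_reals t)))%R)%C.

Definition fock_dot (f g : Cd -> C) : C :=
  gauss_integral_C (fun z => f z * (g z)^* ).

(* Closure in the Fock space of a set of polynomials. *)
Definition fock_closure (J : set (mpoly d C)) : set (Cd -> C) :=
  [set f | fock f /\ forall e : R, 0 < e ->
    exists2 p, J p & (fock_sqnorm (fun z => f z - meval z p)%R < (e ^+ 2)%:E)%E].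

Definition homogeneous_ideal (J : set (mpoly d C)) : Prop :=
  [/\ J 0,
      forall p q, J p -> J q -> J (p + q),
      forall p q, J q -> J (p * q) &
      forall p n, J p -> J (pihomog mdeg n p)].

Definition graded (I : set (Cd -> C)) : Prop :=
  exists2 J : set (mpoly d C), homogeneous_ideal J & I = fock_closure J.

Definition zero_set (I : set (Cd -> C)) : set Cd :=
  [set z | forall f, I f -> f z = 0].

(* Krull dimension of Z with its Zariski topology: the supremum of the lengths
   of the chains of nonempty irreducible closed subsets; it is -oo for the
   empty set. *)
Definition zariski_closed (Z V : set Cd) : Prop :=
  exists S : set (mpoly d C),
    V = Z `&` [set z | forall p, S p -> meval z p = 0].

Definition irreducible_closed (Z V : set Cd) : Prop :=
  [/\ zariski_closed Z V, V !=set0 &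
    forall A B, zariski_closed Z A -> zariski_closed Z B ->
      V `<=` A `|` B -> V `<=` A \/ V `<=` B].

Definition zariski_dim (Z : set Cd) : \bar R :=
  ereal_sup [set n%:R%:E | n in [set n : nat | exists V : nat -> set Cd,
    (forall i, (i <= n)%N -> irreducible_closed Z (V i)) /\
    (forall i, (i < n)%N -> V i `<` V i.+1)]].

End fock.

Section tuples.
Context (R : realType) (d : nat).
Local Notation C := (Cx R).
Local Notation Cd := ('I_d -> C).
Context (H : completeNormedModType C) (dot : {dot H for Num.conj}).
Context (T : 'I_d -> {linear H -> H}) (h : H).

Definition op_pow (m : multinom d) : H -> H :=
  \big[comp/idfun]_(i < d) iter (m i) (T i).

Definition op_poly (p : mpoly d C) (x : H) : H :=
  \sum_(m <- msupp p) mcoeff m p *: op_pow m x.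

Definition cyclic_commuting_tuple : Prop :=
  [/\ forall i, exists M : C, forall x, `|T i x| <= M * `|x|,
      forall i j x, T i (T j x) = T j (T i x) &
      dense [set op_poly p h | p in setT]].

Definition op_entire (f : Cd -> C) (x : H) : H :=
  limn (fun n : nat => \sum_(m : bmultinom d n) taylor f m *: op_pow m x).

Definition annihilator : set (Cd -> C) :=
  [set f | fock f /\ forall x, op_entire f x = 0].

Definition iota_op (f : Cd -> C) : H := op_entire f h.

Definition iota_adj (x : H) : Cd -> C :=
  xget (fun=> 0) [set g | fock g /\
    forall f, fock f -> dot (iota_op f) x = fock_dot f g].

Definition L_op (f : Cd -> C) : Cd -> C := iota_adj (iota_op f).

End tuples.

Section eigenvalues.
Context (R : realType) (X : Type).
Local Notation C := (Cx R).

Definition has_dim (V : set (X -> C)) (n : nat) : Prop :=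
  exists e : 'I_n -> X -> C,
    (forall c : 'rV[C]_n, V (fun x => \sum_(i < n) c 0 i * e i x)) /\
    (forall f, V f ->
      exists! c : 'rV[C]_n, f = (fun x => \sum_(i < n) c 0 i * e i x)).

Definition eigenspace_on (D : set (X -> C)) (L : (X -> C) -> X -> C) (mu : C) :
    set (X -> C) :=
  [set f | D f /\ L f = (fun x => mu * f x)].

(* [lambda] lists, in non-increasing order and starting from index 0, the
   nonzero eigenvalues (all positive) of the operator [L] on the space [D],
   repeated according to their multiplicities; when there are finitely many of
   them, the list is padded with zeros. *)
Definition eigenvalue_sequence (D : set (X -> C)) (L : (X -> C) -> X -> C)
    (lambda : nat -> R) : Prop :=
  [/\ forall k, 0 <= lambda k,
      forall j k, (j <= k)%N -> lambda k <= lambda j &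
      forall mu : C, mu != 0 -> exists n : nat,
        has_dim (eigenspace_on D L mu) n /\
        ([set k | (lambda k)%:C%C = mu :> C] #= `I_n)%card].

(* limsup of ln k / ln ln (1 / lambda_k) over the indices k of the nonzero
   terms of [lambda]; [lambda k] is the term of index k + 1. The limsup over a
   finite set of indices is -oo. *)
Definition limsup_exponent (lambda : nat -> R) : \bar R :=
  limn_esup (fun k : nat =>
    if lambda k == 0 then -oo%E
    else (ln (k.+1%:R) / ln (ln (lambda k)^-1))%:E).

End eigenvalues.

(* Main.v *)
(* Let [J] be a homogeneous ideal with closure [annihilator T], and suppose that
   modulo [J] the polynomials of degree less than [n] are spanned by [K n^D] of
   them. If [k >= K n^D], some nonzero combination [f] of [k + 1] eigenfunctions
   for eigenvalues at least [lambda_k] has its Taylor polynomial of degree less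
   than [n] in [J], so that [f(T) h] is a tail of its power series. As the Taylor
   coefficients of [f] decay faster than any geometric sequence, uniformly on
   the unit ball of the Fock space,
   [lambda_k |f|^2 <= |f(T) h|^2 <= B 4^(-n) |f|^2],
   whence the limsup is at most [D].

   A [D] for which the zero set of [J] contains a chain of [D + 1] irreducible
   closed subsets is found by noetherian induction on [J]. If the zero set is
   the origin, then [J] contains all monomials of high degree by the projective
   Nullstellensatz, and [D = 0]. Otherwise, add to [J] a linear form that
   vanishes identically on no component of the zero set other than the origin:
   this lowers the growth exponent by at most one, and a chain in the smaller
   zero set is extended by a component of the larger one.

   The bound on the Taylor coefficients is Bessel's inequality on large
   polydiscs, on which distinct monomials are orthogonal because the Gaussian
   measure is invariant under the rotations of each coordinate. *)

Require Import Defs.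
From mathcomp Require Import all_boot all_order all_algebra.
From mathcomp Require Import sesquilinear.
From mathcomp Require Import complex.
From mathcomp Require Import -(notations) mpoly.
From mathcomp Require Import ring lra.
From mathcomp Require Import all_classical all_reals all_analysis.
From mathcomp Require Import measurable_realfun.

Set Implicit Arguments.
Unset Strict Implicit.
Unset Printing Implicit Defensive.

Import Order.TTheory GRing.Theory Num.Theory.
Import numFieldNormedType.Exports.

Local Open Scope classical_set_scope.
Local Open Scope ring_scope.

(** The growth exponent and the chain length come out of one induction, so that they can be compared
    without either being computed: when the linear form is taken away again, the exponent rises by
    at most one and the chain gains one member. The ideals stay homogeneous throughout because
    spanning families are lifted degree by degree, one power of the form at a time.

    Integrating a power series term by term against the Gaussian density needs a dominating
    function. On a polydisc the partial sums are uniformly bounded, and its invariance under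
    rotations keeps the monomials orthogonal. Taking the radius large makes the weight of z^m at
    least a constant times s^(2|m|) for any prescribed s. With s equal to four times a common bound
    of the operators, a factor 4^(-|m|) remains: one half of it sums the series, the other half
    gives the tail 2^(-n), which is squared in the final estimate.

    The eigenvalue list only fixes the dimensions of the eigenspaces, so the eigenfunctions are
    independent inside an eigenspace and orthogonal across different eigenvalues. The lower bound on
    |f(T) h|^2 is arranged to work with such a family. *)

(** * Dickson's lemma *)

(** Jump repeatedly to an index where [u] attains its minimum over the remaining tail; the minima of
    shrinking tails cannot decrease. *)
Lemma nondecreasing_subsequence (u : nat -> nat) :
  exists2 phi : nat -> nat, {homo phi : i j / (i < j)%N} &
    {homo u \o phi : i j / (i <= j)%N}.
Proof.
have minP N : exists n, (N <= n)%N /\ forall m, (N <= m)%N -> (u n <= u m)%N.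
  have ex : exists v, `[< exists2 n, (N <= n)%N & u n = v >].
    by exists (u N); apply/asboolP; exists N.
  case: (ex_minnP ex) => v /asboolP[n Nn <-] vmin.
  by exists n; split=> // m Nm; apply: vmin; apply/asboolP; exists m.
have [g gP] := choice minP.
pose phi := fix phi n := if n is n'.+1 then g (phi n').+1 else g 0%N.
have phiS n : (phi n < phi n.+1)%N by have [] := gP (phi n).+1.
have le_min n m : (phi n <= m)%N -> (u (phi n) <= u m)%N.
  case: n => [|n] /= le_m; first by case: (gP 0%N) => _ ->.
  have [le_g ->] := gP (phi n).+1 => //.
  exact: leq_trans le_g le_m.
have phi_lt : {homo phi : i j / (i < j)%N} by exact: homo_ltn ltn_trans _.
exists phi => // i j; rewrite leq_eqVlt => /orP[/eqP->//|/phi_lt lt_ij].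
exact/le_min/ltnW.
Qed.

(** Extract a subsequence for one coordinate after the other; a further extraction does not spoil
    the coordinates already treated. *)
Lemma dickson (d : nat) (m : nat -> multinom d) :
  exists2 phi : nat -> nat, {homo phi : i j / (i < j)%N} &
    forall (k : 'I_d) i j, (i <= j)%N -> (m (phi i) k <= m (phi j) k)%N.
Proof.
have [phi mono_phi phiP] : exists2 phi : nat -> nat,
    {homo phi : i j / (i < j)%N} &
    forall k, k \in enum 'I_d ->
      forall i j, (i <= j)%N -> (m (phi i) k <= m (phi j) k)%N; last first.
  by exists phi => // k; apply: phiP; rewrite mem_enum.
elim: (enum 'I_d) => [|k s [phi mono_phi phiP]]; first by exists id.
have [psi mono_psi psiP] := nondecreasing_subsequence (fun i => m (phi i) k).
exists (phi \o psi) => [i j ij|l]; first exact/mono_phi/mono_psi.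
rewrite inE => /orP[/eqP->|/phiP le_l] i j ij; first exact: psiP.
by apply: le_l; apply: (homo_leq _ leq_trans (fun n => ltnW (mono_psi _ _ _))).
Qed.

(** * Homogeneous ideals *)

Section ideals.
Context (R : realType) (d : nat).
Local Notation C := (Cx R).
Local Notation S := (mpoly d C).

Definition poly_ideal (J : set S) : Prop :=
  [/\ J 0, forall p q, J p -> J q -> J (p + q) & forall p q, J q -> J (p * q)].

Lemma homogeneous_ideal_ideal (J : set S) : homogeneous_ideal J -> poly_ideal J.
Proof. by case=> J0 JD JM _; split. Qed.

Lemma idealZ (J : set S) c p : poly_ideal J -> J p -> J (c *: p).
Proof. by case=> _ _ JM Jp; rewrite -mul_mpolyC; apply: JM. Qed.

Lemma idealN (J : set S) p : poly_ideal J -> J p -> J (- p).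
Proof. by move=> idJ Jp; rewrite -scaleN1r; apply: idealZ. Qed.

Lemma idealB (J : set S) p q : poly_ideal J -> J p -> J q -> J (p - q).
Proof. by move=> idJ Jp Jq; case: (idJ) => _ JD _; apply: JD => //; exact: idealN. Qed.

Lemma ideal_sum (J : set S) (I : Type) (r : seq I) (P : pred I) (F : I -> S) :
  poly_ideal J -> (forall i, P i -> J (F i)) -> J (\sum_(i <- r | P i) F i).
Proof. by case=> J0 JD _; apply: big_ind. Qed.

Lemma idealMr (J : set S) p q : poly_ideal J -> J p -> J (p * q).
Proof. by case=> _ _ JM Jp; rewrite mulrC; apply: JM. Qed.

Lemma mleadB_lt (p q : S) : mlead p = mlead q ->
  mcoeff (mlead p) p = mcoeff (mlead q) q -> p - q != 0 ->
  (mlead (p - q) < mlead p)%O.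
Proof.
move=> eq_lead eq_coef nz; rewrite lt_neqAle; apply/andP; split.
  apply: contra nz => /eqP eq_m.
  by rewrite -mleadc_eq0 eq_m mcoeffB eq_coef eq_lead subrr.
by rewrite (le_trans (mleadB_le _ _))// -eq_lead joinxx.
Qed.

(** Hilbert's basis theorem. If every step were strict, choose [p n] in [J n.+1] outside [J n] with
    least leading monomial. By Dickson some [mlead (p i)] divides a later [mlead (p j)], and
    subtracting a multiple of [p i] from [p j] gives an element of the same kind with a smaller
    leading monomial. *)
Lemma ideal_chain_stationary (J : nat -> set S) :
  (forall n, poly_ideal (J n)) -> (forall n, J n `<=` J n.+1) ->
  exists n, J n.+1 `<=` J n.
Proof.
move=> idJ JS; apply: contrapT => /forallNP noJ.
have minP n : exists p, [/\ J n.+1 p, ~ J n p &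
    forall q, J n.+1 q -> ~ J n q -> (mlead p <= mlead q)%O].
  have [p0 [Jp0 nJp0]] : exists p, J n.+1 p /\ ~ J n p.
    by have /existsNP[p /not_implyP] := noJ n; exists p.
  (* The monomial order is well founded, so descending from [p0] reaches a minimal element. *)
  move: {-2}(mlead p0) (erefl (mlead p0)) => m.
  elim/(@ltmwf d): m p0 Jp0 nJp0 => m IH p Jp nJp mp.
  have [[q [Jq nJq lt_q]]|min_p] :=
    pselect (exists q, [/\ J n.+1 q, ~ J n q & (mlead q < m)%O]).
    exact: IH (mlead q) lt_q q Jq nJq (erefl _).
  exists p; split=> // q Jq nJq; rewrite -mp leNgt.
  by apply/negP => lt_q; apply: min_p; exists q.
have [p pP] := choice minP.
have [phi mono_phi phiP] := dickson (fun n => mlead (p n)).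
set i := phi 0%N; set j := phi 1%N.
have lt_ij : (i < j)%N by apply: mono_phi.
have le_lead : mpoly.lem (mlead (p i)) (mlead (p j)).
  by apply/mnm_lepP => k; apply: phiP.
have [Ji _ _] := pP i; have [Jj nJj min_j] := pP j.
(* [p i] lies in [J i.+1], and [i < j] is exactly what places [J i.+1] inside [J j]. *)
have Jji : J j (p i).
  by have := homo_leq (@subset_refl _) (@subset_trans _) JS lt_ij; apply.
have p_neq0 k : p k != 0.
  by have [_ nJ _] := pP k; apply/eqP => p0; apply: nJ; rewrite p0; case: (idJ k).
pose c := mcoeff (mlead (p j)) (p j) / mcoeff (mlead (p i)) (p i).
pose t : S := c *: mpolyX C (mnm_sub (mlead (p j)) (mlead (p i))).
have c_neq0 : c != 0 by rewrite mulf_neq0 ?invr_neq0 ?mleadc_eq0 ?p_neq0.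
have X_neq0 (m : multinom d) : mpolyX C m != 0 by rewrite -msize_poly_eq0 msizeX.
have lead_t : mlead t = mnm_sub (mlead (p j)) (mlead (p i)).
  by rewrite /t mleadZ// mleadXm.
have coef_t : mcoeff (mlead t) t = c.
  by rewrite lead_t /t mcoeffZ mcoeffX eqxx mulr1.
have t_neq0 : t != 0 by rewrite -mleadc_eq0 coef_t.
have lead_tp : mlead (t * p i) = mlead (p j).
  by rewrite mleadM// lead_t submK.
have coef_tp : mcoeff (mlead (t * p i)) (t * p i) = mcoeff (mlead (p j)) (p j).
  by rewrite mleadM// mleadcM coef_t /c divfK// mleadc_eq0.
have Jt : J j (t * p i) by case: (idJ j) => _ _; apply.
have Jb : J j.+1 (p j - t * p i) by apply: idealB => //; exact: JS.
have nJb : ~ J j (p j - t * p i).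
  move=> Jb'; apply: nJj; rewrite -(subrK (t * p i) (p j)).
  by case: (idJ j) => _ JD _; apply: JD.
have := min_j _ Jb nJb; rewrite leNgt mleadB_lt//.
by apply/eqP => b0; apply: nJb; rewrite b0; case: (idJ j).
Qed.

(** Otherwise dependent choice builds a strictly increasing sequence of ideals. This is the form in
    which noetherian induction is used for the Nullstellensatz, for irreducible components and for
    the final chain. *)
Lemma ideal_family_maximal (Fam : set (set S)) :
  (forall J, Fam J -> poly_ideal J) -> Fam !=set0 ->
  exists2 J, Fam J & forall J', Fam J' -> J `<=` J' -> J' `<=` J.
Proof.
move=> idF [J0 FJ0]; apply: contrapT => noF.
pose X := {J : set S | Fam J}.
pose rel (J J' : X) := sval J `<=` sval J' /\ ~ sval J' `<=` sval J.
have step (J : X) : {J' : X | rel J J'}.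
  apply: cid; case: J => J FJ; apply: contrapT => noJ; apply: noF.
  exists J => // J' FJ' JJ'; apply: contrapT => nJ'J.
  by apply: noJ; exists (exist _ J' FJ').
have [f [_ fP]] := dependent_choice step (exist _ J0 FJ0).
have [n] : exists n, sval (f n.+1) `<=` sval (f n).
  apply: ideal_chain_stationary => n; first exact/idF/(svalP (f n)).
  by case: (fP n).
by case: (fP n).
Qed.

End ideals.

Lemma nonzero_kernel_vector (F : fieldType) (m n : nat) (A : 'M[F]_(m, n)) :
  (n < m)%N -> exists2 u : 'rV[F]_m, u != 0 & u *m A = 0.
Proof.
move=> lt_nm; have : kermx A != 0.
  rewrite -mxrank_eq0 mxrank_ker subn_eq0 -ltnNge.
  exact: leq_ltn_trans (rank_leq_col A) lt_nm.
by case/rowV0Pn => u /sub_kermxP uA u0; exists u.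
Qed.

(** * Graded components and maximal homogeneous ideals *)

Section homogeneous.
Context (R : realType) (d : nat).
Local Notation C := (Cx R).
Local Notation S := (mpoly d C).
Local Notation pi := (pihomog mdeg).
Local Notation mX m := (mpolyX C m).
Implicit Types (p q r f g : S) (m : multinom d) (J P : set S).

Lemma pihomog_eqP k p : (p \is ishomog1 k mdeg) <-> pi k p = p.
Proof. by rewrite homog_piE; split => /eqP. Qed.

Lemma pihomog_partition K p : (mmeasure mdeg p <= K)%N ->
  p = \sum_(k < K) pi k p.
Proof. exact: pihomog_partitionE. Qed.

Lemma pihomog1 : pi 0 (1 : S) = 1.
Proof. exact/pihomog_eqP/dhomog1. Qed.

Lemma pihomogMhomog i j f g : pi i f = f -> pi j g = g ->
  pi (i + j) (f * g) = f * g.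
Proof. by move=> /pihomog_eqP ? /pihomog_eqP ?; apply/pihomog_eqP/dhomogM. Qed.

Lemma pihomogXhomog i f n : pi i f = f -> pi (n * i) (f ^+ n) = f ^+ n.
Proof.
move=> hf; elim: n => [|n IH]; first by rewrite pihomog1.
by rewrite exprS mulSn; exact: pihomogMhomog.
Qed.

Lemma pihomog_mpolyX m : pi (mdeg m) (mX m) = mX m.
Proof. by rewrite pihomogX eqxx. Qed.

Lemma pihomog_neq k i f : pi i f = f -> i != k -> pi k f = 0.
Proof. by move=> /pihomog_eqP hf ne; apply: pihomog_ne0 hf. Qed.

Lemma pihomogM n k r f : pi k f = f -> pi (n + k) (r * f) = pi n r * f.
Proof.
(* The maximum with [n.+1] guarantees that degree [n] occurs in the partition, even when [r] has
   smaller degree. *)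
move=> hf; pose K := maxn (mmeasure mdeg r) n.+1.
have lt_K : (n < K)%N by rewrite leq_max leqnn orbT.
rewrite {1}(@pihomog_partition K r) ?leq_maxl// mulr_suml linear_sum /=.
have homM i : pi (i + k) (pi i r * f) = pi i r * f.
  by apply: pihomogMhomog => //; rewrite pihomog_id.
rewrite (bigD1 (Ordinal lt_K))//= homM big1 ?addr0// => i ni.
apply: (pihomog_neq (homM i)); rewrite eqn_add2r.
by apply: contra ni => /eqP e; apply/eqP/val_inj.
Qed.

Lemma pihomogM_lt n k r f : pi k f = f -> (n < k)%N -> pi n (r * f) = 0.
Proof.
move=> hf lt_nk; rewrite {1}(@pihomog_partition _ r (leqnn _)) mulr_suml linear_sum /=.
rewrite big1// => i _; apply: (@pihomog_neq _ (i + k)); last first.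
  by rewrite gtn_eqF// (leq_trans lt_nk)// leq_addl.
by apply: pihomogMhomog => //; rewrite pihomog_id.
Qed.

Definition ideal_adjoin J f : set S := [set r | exists q, J (r - q * f)].

Definition ideal_colon J f : set S := [set r | J (r * f)].

(** For an ideal this means containing a power of the irrelevant ideal: the quotient is finite
    dimensional and the zero set is at most the origin. *)
Definition cofinite_ideal J : Prop :=
  exists N, forall m, (N <= mdeg m)%N -> J (mX m).

Lemma ideal_adjoin_sub J f : J `<=` ideal_adjoin J f.
Proof. by move=> p Jp; exists 0; rewrite mul0r subr0. Qed.

Lemma ideal_adjoin_mem J f : homogeneous_ideal J -> ideal_adjoin J f f.
Proof. by case=> J0 _ _ _; exists 1; rewrite mul1r subrr. Qed.

(** The degree [n] component of [p - u * f] is [pi n p - pi (n - k) u * f], or just [pi n p] when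
    [n < k]. *)
Lemma ideal_adjoin_homogeneous J k f :
  homogeneous_ideal J -> pi k f = f -> homogeneous_ideal (ideal_adjoin J f).
Proof.
move=> [J0 JD JM Jh] hf; split.
- by exists 0; rewrite mul0r subr0.
- move=> p q [u Ju] [v Jv]; exists (u + v).
  by rewrite mulrDl opprD addrACA; apply: JD.
- move=> p q [u Ju]; exists (p * u).
  by rewrite -mulrA -mulrBr; apply: JM.
- move=> p n [u Ju]; have [le_kn|lt_nk] := leqP k n.
    exists (pi (n - k) u); rewrite -(pihomogM _ _ hf) subnK// -linearB; exact: Jh.
  by exists 0; have := Jh _ n Ju; rewrite linearB /= (pihomogM_lt _ hf)// mul0r.
Qed.

Lemma ideal_colon_homogeneous J k f :
  homogeneous_ideal J -> pi k f = f -> homogeneous_ideal (ideal_colon J f).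
Proof.
move=> [J0 JD JM Jh] hf; split; rewrite /ideal_colon /=.
- by rewrite mul0r.
- by move=> p q Jp Jq; rewrite mulrDl; apply: JD.
- by move=> p q Jq; rewrite -mulrA; apply: JM.
- by move=> p n Jp; rewrite -(pihomogM _ _ hf); apply: Jh.
Qed.

Lemma multinom_split m N : (N <= mdeg m)%N ->
  exists m1 m2, m = mnm_add m1 m2 /\ mdeg m1 = N.
Proof.
elim: N => [|N IH] le_N; first by exists mnm0, m; rewrite mdeg0 add0m.
have [m1 [m2 [mE m1N]]] := IH (ltnW le_N).
have [k m2k] : exists k, (0 < m2 k)%N.
  apply: contrapT => /forallNP m20; move: le_N; rewrite mE mdegD m1N -addn1 leq_add2l.
  rewrite mdegE big1// => k _; apply/eqP; rewrite -leqn0 leqNgt; exact/negP.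
exists (mnm_add m1 (mnm1 k)), (mnm_sub m2 (mnm1 k)); split; last first.
  by rewrite mdegD mdeg1 m1N addn1.
rewrite -addmA [mnm_add (mnm1 k) _]addmC submK//; apply/mnm_lepP => i.
by rewrite mnm1E; case: eqP => // <-.
Qed.

Section maximal.
Context (P : set S).
Hypothesis homP : homogeneous_ideal P.
Hypothesis ncofP : ~ cofinite_ideal P.
Hypothesis maxP : forall P', homogeneous_ideal P' -> ~ cofinite_ideal P' ->
  P `<=` P' -> P' `<=` P.

Let idP := homogeneous_ideal_ideal homP.

Lemma maximal_adjoin_cofinite k f :
  pi k f = f -> ~ P f -> cofinite_ideal (ideal_adjoin P f).
Proof.
move=> hf nPf; apply: contrapT => ncof; apply: nPf.
apply: (maxP (ideal_adjoin_homogeneous homP hf) ncof).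
  exact: ideal_adjoin_sub.
exact: ideal_adjoin_mem.
Qed.

(** If neither factor were in [P], both [P + (f)] and [P : f] would be larger than [P], hence
    cofinite. A monomial of high degree splits as [m1 + m2] with [mX m1] a multiple of [f] modulo
    [P] and [mX m2 * f] in [P], so [P] itself would be cofinite. *)
Lemma maximal_homogeneous_prime j k f g : pi j f = f -> pi k g = g ->
  P (f * g) -> P f \/ P g.
Proof.
move=> hf hg Pfg; apply: contrapT => /not_orP[nPf nPg].
have [N1 cof1] := maximal_adjoin_cofinite hf nPf.
have [N2 cof2] : cofinite_ideal (ideal_colon P f).
  apply: contrapT => ncof; apply: nPg.
  apply: (maxP (ideal_colon_homogeneous homP hf) ncof).
    by move=> p Pp; apply: idealMr.
  by rewrite /ideal_colon /= mulrC.
apply: ncofP; exists (N1 + N2)%N => m le_m.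
have [m1 [m2 [mE m1N]]] := multinom_split (leq_trans (leq_addr N2 N1) le_m).
have [|q Pq] := cof1 m1; first by rewrite m1N.
have Pm2 : P (mX m2 * f).
  by apply: cof2; move: le_m; rewrite mE mdegD m1N leq_add2l.
rewrite mE mpolyXD.
have -> : mX m1 * mX m2 = (mX m1 - q * f) * mX m2 + q * (mX m2 * f) by ring.
by case: idP => _ PD PM; apply: PD; [exact: idealMr | exact: PM].
Qed.

End maximal.

End homogeneous.

(** * The projective Nullstellensatz *)

Section nullstellensatz.
Context (R : realType) (d : nat).
Local Notation C := (Cx R).
Local Notation S := (mpoly d C).
Local Notation pi := (pihomog mdeg).
Local Notation mX m := (mpolyX C m).
Implicit Types (p q r f g : S) (m : multinom d) (J P : set S) (c : {poly C}).

(** The homogenization of [c] in degree [n], evaluated at the pair of forms [x], [l]. Coefficients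
    of [c] beyond [n] are dropped, hence the bounds on [size c] below. *)
Definition binary_form (x l : S) n c : S :=
  \sum_(k < n.+1) c`_k *: (x ^+ k * l ^+ (n - k)).

Lemma binary_formZ x l n a c :
  binary_form x l n (a *: c) = a *: binary_form x l n c.
Proof.
rewrite /binary_form scaler_sumr; apply: eq_bigr => k _.
by rewrite coefZ scalerA.
Qed.

Lemma binary_formXsubC x l n t c : (size c <= n.+1)%N ->
  binary_form x l n.+1 (('X - t%:P) * c) = (x - t *: l) * binary_form x l n c.
Proof.
move=> szc; rewrite [RHS]mulrBl /binary_form.
have -> : x * \sum_(k < n.+1) c`_k *: (x ^+ k * l ^+ (n - k)) =
    \sum_(k < n.+2) ('X * c)`_k *: (x ^+ k * l ^+ (n.+1 - k)).
  rewrite [RHS]big_ord_recl coefXM eqxx scale0r add0r mulr_sumr.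
  by apply: eq_bigr => k _; rewrite coefXM/= add0n subSS exprS -scalerAr mulrA.
have -> : (t *: l) * \sum_(k < n.+1) c`_k *: (x ^+ k * l ^+ (n - k)) =
    \sum_(k < n.+2) (t%:P * c)`_k *: (x ^+ k * l ^+ (n.+1 - k)).
  rewrite [RHS]big_ord_recr /= coefCM (nth_default _ szc) mulr0 scale0r addr0 mulr_sumr.
  apply: eq_bigr => k _; have le_kn : (k <= n)%N by rewrite -ltnS.
  by rewrite coefCM (subSn le_kn) exprS -scalerAl -scalerAr scalerA; congr (_ *: _); rewrite mulrCA.
by rewrite -sumrB; apply: eq_bigr => k _; rewrite -scalerBl mulrBl coefB.
Qed.

Lemma binary_form_homog x l n c : pi 1 x = x -> pi 1 l = l ->
  pi n (binary_form x l n c) = binary_form x l n c.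
Proof.
move=> hx hl; rewrite /binary_form linear_sum; apply: eq_bigr => k _.
rewrite linearZ /=; congr (_ *: _).
have := pihomogMhomog (pihomogXhomog k hx) (pihomogXhomog (n - k) hl).
by rewrite !muln1 subnKC// -ltnS.
Qed.

Section prime.
Context (P : set S).
Hypothesis homP : homogeneous_ideal P.
Hypothesis primeP : forall j k f g, pi j f = f -> pi k g = g ->
  P (f * g) -> P f \/ P g.
Let idP := homogeneous_ideal_ideal homP.

(** Over the algebraically closed field [c] splits, so the form is a constant times factors
    [x - t *: l] and a power of [l]. Primality puts one factor into [P], and the powers of [l] are
    excluded. *)
Lemma prime_linear_factor x l n c : pi 1 x = x -> pi 1 l = l ->
  (forall k, ~ P (l ^+ k)) -> c != 0 -> (size c <= n.+1)%N ->
  P (binary_form x l n c) -> exists t, P (x - t *: l).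
Proof.
move=> hx hl nPl; have [s ->] := closed_field_poly_normal c.
set a := lead_coef c; have [->|a0 _] := eqVneq a 0; first by rewrite scale0r eqxx.
rewrite size_scale// size_prod_XsubC ltnS binary_formZ => szs.
move=> /(idealZ a^-1 idP); rewrite scalerA mulVf// scale1r.
elim: s n szs => [|t s IH] n szs.
  rewrite big_nil /binary_form (bigD1 ord0)//= coef1 scale1r mul1r subn0.
  rewrite big1 ?addr0; first by move/nPl.
  by move=> k k0; rewrite coef1 (_ : (k == 0 :> nat) = false) ?scale0r//; exact/negbTE.
case: n szs => [//|n] szs; rewrite big_cons binary_formXsubC; last first.
  by rewrite size_prod_XsubC.
have hxl : pi 1 (x - t *: l) = x - t *: l by rewrite linearB linearZ /= hx hl.
move=> /(primeP hxl (binary_form_homog _ _ hx hl))[Pxl|]; first by exists t.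
exact: IH.
Qed.

End prime.

Lemma cofinite_of_variables P : poly_ideal P ->
  (forall i, P (mX (mnm1 i))) -> cofinite_ideal P.
Proof.
move=> idP PX; exists 1%N => m /multinom_split[m1 [m2 [-> /eqP/mdeg1P[i /eqP->]]]].
by rewrite mpolyXD; apply: idealMr.
Qed.

Lemma homog_monomial_sum k p : pi k p = p ->
  p = \sum_(m : bmultinom d k.+1 | mdeg m == k) mcoeff m p *: mX m.
Proof.
move=> hp; rewrite -{1}hp (@pihomogwE _ _ _ _ k.+1)//.
have [->|p0] := eqVneq p 0; first by rewrite msize0.
rewrite -mlead_deg// ltnS.
have /pihomog_eqP/dhomogP -> // := hp; exact: mlead_supp.
Qed.

Lemma homog_in_cofinite J N k p : poly_ideal J ->
  (forall m, (N <= mdeg m)%N -> J (mX m)) -> (N <= k)%N -> pi k p = p -> J p.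
Proof.
move=> idJ cof leNk /homog_monomial_sum ->; apply: ideal_sum => // m /eqP mk.
by apply: idealZ => //; apply: cof; rewrite mk.
Qed.

(* Modulo [P], multiplication by [l] is onto from degree [k] to degree [k.+1] as
   soon as [N <= k.+1]. *)
Lemma cofinite_reduction P l N : homogeneous_ideal P -> pi 1 l = l ->
  (forall m, (N <= mdeg m)%N -> ideal_adjoin P l (mX m)) ->
  forall j u, pi (N + j) u = u ->
  exists2 g, pi N g = g & P (u - g * l ^+ j).
Proof.
move=> homP hl cof; have idP := homogeneous_ideal_ideal homP.
have idPl := homogeneous_ideal_ideal (ideal_adjoin_homogeneous homP hl).
elim=> [|j IH] u hu.
  rewrite addn0 in hu; exists u; first exact: hu.
  by rewrite expr0 mulr1 subrr; case: idP.
have [q Pq] := homog_in_cofinite idPl cof (leq_addr _ _) hu.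
have [g hg Pg] := IH (pi (N + j) q) (pihomog_id _ _ _).
(* Modulo [P], [u] is [q * l]. Keeping only the component of [q] in degree [N + j] makes the
   induction hypothesis applicable to it. *)
exists g => //.
have -> : u - g * l ^+ j.+1 = (u - pi (N + j) q * l) + (pi (N + j) q - g * l ^+ j) * l.
  by rewrite exprSr; ring.
case: (idP) => _ PD _; apply: PD; last exact: idealMr.
have [_ _ _ /(_ _ (N + j.+1)%N Pq)] := homP.
by rewrite linearB /= hu addnS -addn1 pihomogM.
Qed.

Lemma homog_dependent N (r : nat) (g : 'I_r -> S) :
  (forall i, pi N (g i) = g i) -> (#|{: bmultinom d N.+1}| < r)%N ->
  exists2 c : 'rV[C]_r, c != 0 & \sum_i c 0 i *: g i = 0.
Proof.
move=> hg lt_r.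
pose A : 'M[C]_(r, #|{: bmultinom d N.+1}|)  :=
  \matrix_(i, j) mcoeff (enum_val j : bmultinom d N.+1) (g i).
have [c c0 cA] := nonzero_kernel_vector A lt_r; exists c => //.
have hsum : pi N (\sum_i c 0 i *: g i) = \sum_i c 0 i *: g i.
  by rewrite linear_sum; apply: eq_bigr => i _; rewrite linearZ /= hg.
rewrite (homog_monomial_sum hsum) big1// => m _.
have /matrixP/(_ 0 (enum_rank m)) := cA; rewrite !mxE => cm.
rewrite (_ : mcoeff _ _ = 0) ?scale0r// raddf_sum /= -[RHS]cm.
by apply: eq_bigr => i _; rewrite mcoeffZ mxE enum_rankK.
Qed.

(** The forms [x ^+ k * l ^+ (r - k) * l ^+ N], for [k <= r], are congruent to [g k * l ^+ r] with
    [g k] of degree [N]. There are more of them than monomials of degree at most [N], so the [g k]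
    are dependent. The relation is a nonzero binary form in [x] and [l] that lies in [P] after
    multiplication by [l ^+ N], and it has a linear factor in [P]. *)
Lemma prime_linear_relation P (x l : S) : homogeneous_ideal P ->
  (forall j k f g, pi j f = f -> pi k g = g -> P (f * g) -> P f \/ P g) ->
  pi 1 x = x -> pi 1 l = l -> (forall k, ~ P (l ^+ k)) ->
  cofinite_ideal (ideal_adjoin P l) -> exists t, P (x - t *: l).
Proof.
move=> homP primeP hx hl nPl [N cof].
have idP := homogeneous_ideal_ideal homP.
pose r := #|{: bmultinom d N.+1}|.
have hu (k : 'I_r.+1) : pi (N + r) (x ^+ k * l ^+ (r - k) * l ^+ N) =
    x ^+ k * l ^+ (r - k) * l ^+ N.
  have := pihomogMhomog (pihomogMhomog (pihomogXhomog k hx)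
    (pihomogXhomog (r - k) hl)) (pihomogXhomog N hl).
  by rewrite !muln1 subnKC -1?ltnS// addnC.
have /choice[g gP] : forall k : 'I_r.+1, exists g, pi N g = g /\
    P (x ^+ k * l ^+ (r - k) * l ^+ N - g * l ^+ r).
  move=> k; have [g ? ?] := cofinite_reduction homP hl cof (hu k).
  by exists g.
have [c c0 cg] := homog_dependent (fun k => (gP k).1) (ltnSn r).
pose c' : {poly C} := \poly_(k < r.+1) c 0 (inord k).
have Pc : P (binary_form x l r c' * l ^+ N).
  have -> : binary_form x l r c' * l ^+ N =
      \sum_(k < r.+1) c 0 k *: (x ^+ k * l ^+ (r - k) * l ^+ N - g k * l ^+ r).
    transitivity (binary_form x l r c' * l ^+ N - (\sum_i c 0 i *: g i) * l ^+ r).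
      by rewrite cg mul0r subr0.
    rewrite !mulr_suml -sumrB; apply: eq_bigr => k _.
    by rewrite coef_poly ltn_ord inord_val scalerBr -!scalerAl.
  by apply: ideal_sum => // k _; apply: idealZ => //; case: (gP k).
have [|/nPl//] := primeP _ _ _ _ (binary_form_homog r c' hx hl) (pihomogXhomog N hl) Pc.
apply: prime_linear_factor => //; last exact: size_poly.
apply: contra c0 => /eqP c'0; apply/eqP/rowP => k.
by have := congr1 (fun q : {poly C} => q`_k) c'0; rewrite coef_poly ltn_ord inord_val coef0 mxE.
Qed.

(* A homogeneous ideal [P] maximal among those that miss monomials of
   arbitrarily high degree is prime, and its graded pieces have bounded
   dimension; hence any two linear forms are proportional modulo [P], which
   makes [P] the ideal of a point of projective space. *)
Lemma projective_nullstellensatz J : homogeneous_ideal J ->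
  (forall z : 'I_d -> C, (forall p, J p -> meval z p = 0) -> forall i, z i = 0) ->
  cofinite_ideal J.
Proof.
move=> homJ ZJ; apply: contrapT => ncofJ.
pose Fam : set (set S) := [set P | [/\ homogeneous_ideal P, ~ cofinite_ideal P & J `<=` P]].
have idFam P : Fam P -> poly_ideal P by case=> /homogeneous_ideal_ideal.
have [|P [homP ncofP JP] maxP] := ideal_family_maximal idFam; first by exists J; split.
have idP := homogeneous_ideal_ideal homP.
have maxP' P' : homogeneous_ideal P' -> ~ cofinite_ideal P' -> P `<=` P' -> P' `<=` P.
  by move=> homP' ncofP' PP'; apply: maxP => //; split=> //; exact: subset_trans PP'.
have primeP := maximal_homogeneous_prime homP ncofP maxP'.
have [i0 nPl] : exists i, ~ P (mX (mnm1 i)).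
  apply: contrapT => /forallNP PX; apply/ncofP/cofinite_of_variables => // i.
  by apply: contrapT; exact: PX.
have hX (i : 'I_d) : pi 1 (mX (mnm1 i)) = mX (mnm1 i).
  by have := pihomog_mpolyX R (mnm1 i); rewrite mdeg1.
set l := mX (mnm1 i0) in nPl.
have nP1 : ~ P 1.
  move=> P1; apply: ncofP; exists 0%N => m _.
  by rewrite -[mX m]mulr1; case: idP => _ _; apply.
have nPln k : ~ P (l ^+ k).
  elim: k => [|k IH]; first by [].
  by rewrite exprS => /(primeP _ _ _ _ (hX i0) (pihomogXhomog k (hX i0)))[].
have cofl := maximal_adjoin_cofinite homP maxP' (hX i0) nPl.
have /choice[t tP] : forall i, exists t, P (mX (mnm1 i) - t *: l).
  by move=> i; exact: (prime_linear_relation homP primeP (hX i) (hX i0) nPln cofl).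
(* Every variable is congruent to a multiple of [l], so [t] holds the homogeneous coordinates of a
   point and each monomial is congruent to its value there times a power of [l]. *)
have evalP m : P (mX m - mmap1 t m *: l ^+ mdeg m).
  rewrite mdegE -prodrXr /mmap1 -scaler_prod mpolyXE_id.
  apply: (big_ind2 (fun a b => P (a - b))) => [|a b a' b' Pab Pab'|i _].
  - by rewrite subrr; case: idP.
  - have -> : a * a' - b * b' = (a - b) * a' + b * (a' - b') by ring.
    by case: (idP) => _ PD PM; apply: PD; [exact: idealMr | exact: PM].
  - by rewrite -exprZn subrXX; apply: idealMr; first exact: idP.
(* The degree [n] part of [q] is congruent to its value at [t] times [l ^+ n], and no power of [l]
   lies in [P]; so all these values vanish. *)
have PZ q : P q -> meval t q = 0.
  move=> Pq; rewrite (pihomog_partition (leqnn (mmeasure mdeg q))) raddf_sum /=.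
  apply: big1 => -[n ltn] _ /=; have [_ _ _ /(_ _ n Pq) Pn] := homP.
  apply: contrapT => /eqP ev_neq0; apply: (nPln n).
  have {}Pn : P (meval t (pi n q) *: l ^+ n).
    have -> : meval t (pi n q) *: l ^+ n = pi n q - (pi n q - meval t (pi n q) *: l ^+ n).
      by rewrite subKr.
    apply: idealB => //; rewrite (homog_monomial_sum (pihomog_id _ _ _)).
    rewrite raddf_sum /= scaler_suml -sumrB; apply: ideal_sum => // m /eqP mn.
    rewrite mevalZ mevalX -scalerA -scalerBr; apply: idealZ => //.
    by have := evalP m; rewrite mn.
  by have := idealZ (meval t (pi n q))^-1 idP Pn; rewrite scalerA mulVf// scale1r.
(* By hypothesis the zero [t] of [J] must be the origin; then [t i0 = 0] puts [l] itself into
   [P]. *)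
have /ZJ/(_ i0) t0 : forall p, J p -> meval t p = 0 by move=> p /JP/PZ.
apply: nPl.
by have := tP i0; rewrite t0 scale0r subr0.
Qed.

End nullstellensatz.

(** * Growth of the quotient by a homogeneous ideal *)

Section growth.
Context (R : realType) (d : nat).
Local Notation C := (Cx R).
Local Notation S := (mpoly d C).
Local Notation pi := (pihomog mdeg).
Local Notation mX m := (mpolyX C m).
Implicit Types (p q f g : S) (m : multinom d) (J P : set S).

(* [mmeasure mdeg p <= n] means that [p] has degree less than [n]. *)
Definition poly_growth J (D : nat) : Prop :=
  exists K, forall n, exists (I : finType) (b : I -> S),
    [/\ (#|I| <= K * n ^ D)%N, forall i, exists k, pi k (b i) = b i &
      forall p, (mmeasure mdeg p <= n)%N ->
        exists c : I -> C, J (p - \sum_i c i *: b i)].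

Lemma msize_homog k p : pi k p = p -> (mmeasure mdeg p <= k.+1)%N.
Proof.
move=> hp; have [->|p0] := eqVneq p 0; first by rewrite msize0.
rewrite -mlead_deg// ltnS.
have /pihomog_eqP/dhomogP -> // := hp; exact: mlead_supp.
Qed.

(** The monomials of degree less than [N] span the whole quotient, whatever [n] is. *)
Lemma cofinite_growth J : poly_ideal J -> cofinite_ideal J -> poly_growth J 0.
Proof.
move=> idJ [N cof]; exists #|{: bmultinom d N}| => n.
exists (bmultinom d N), (fun m : bmultinom d N => mX m); split => [|m|p _].
- by rewrite expn0 muln1.
- by exists (mdeg m); exact: pihomog_mpolyX.
exists (fun m : bmultinom d N => mcoeff m p); set s := \sum_i _.
rewrite (mpolyE (p - s)) big_seq; apply: ideal_sum => // m mp.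
apply: idealZ => //; apply: cof; rewrite leqNgt; apply/negP => lt_mN.
by move: mp; rewrite mcoeff_msupp mcoeffB /s (mcoeff_mpoly (fun m' => mcoeff m' p))// subrr eqxx.
Qed.

Lemma pihomog_sum k (I : Type) (r : seq I) (P : pred I) (F : I -> S) :
  pi k (\sum_(i <- r | P i) F i) = \sum_(i <- r | P i) pi k (F i).
Proof. exact: linear_sum. Qed.

(** Projecting a combination of homogeneous elements onto one degree only erases coefficients, so
    the spanning family itself stays unchanged. *)
Lemma pihomog_coef e k (a : C) f : pi k f = f ->
  a *: pi e f = (if pi e f == f then a else 0) *: f.
Proof.
move=> hf; case: eqP => [->//|]; have [<-|ne] := eqVneq k e; first by rewrite hf.
by rewrite (pihomog_neq hf ne) scale0r scaler0.
Qed.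

Section step.
Context (J : set S) (l : S) (n : nat) (I : finType) (b : I -> S).
Hypothesis homJ : homogeneous_ideal J.
Hypothesis hl : pi 1 l = l.
Hypothesis hb : forall i, exists k, pi k (b i) = b i.
Hypothesis span_b : forall p, (mmeasure mdeg p <= n)%N ->
  exists c : I -> C, ideal_adjoin J l (p - \sum_i c i *: b i).
Let idJ := homogeneous_ideal_ideal homJ.

(** Modulo [J], [p] is a combination of the [b i] plus [q * l] with [q] one degree lower; recursion
    on [q] supplies the higher powers of [l]. The vanishing of [c j] for [j > e] is carried along so
    that shifting [j] by one stays below [n]. *)
Lemma adjoin_span_homog e p : (e < n)%N -> pi e p = p ->
  exists2 c : nat -> I -> C, forall j i, (e < j)%N -> c j i = 0 &
    J (p - \sum_(j < n) \sum_i c j i *: (l ^+ j * b i)).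
Proof.
elim: e p => [|e IH] p lt_en hp.
  have [c [q Jq]] := span_b (leq_trans (msize_homog hp) lt_en).
  exists (fun j i => if j is 0 then (if pi 0 (b i) == b i then c i else 0) else 0).
    by case.
  have [_ _ _ /(_ _ 0%N Jq)] := homJ.
  rewrite !linearB /= hp (pihomogM_lt _ hl)// subr0 pihomog_sum.
  move=> Jp; set s := \sum_(j < n) _; suff -> : s = \sum_i pi 0 (c i *: b i) by [].
  rewrite /s; case: n lt_en => [//|n' _]; rewrite big_ord_recl /= [X in _ + X]big1 ?addr0; last first.
    by move=> j _; rewrite big1// => i _; rewrite scale0r.
  apply: eq_bigr => i _; rewrite expr0 mul1r linearZ /=.
  by have [k hk] := hb i; rewrite (pihomog_coef _ _ hk).
have [c [q Jq]] := span_b (leq_trans (msize_homog hp) lt_en).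
have [c' c'0 Jc'] := IH (pi e q) (ltnW lt_en) (pihomog_id _ _ _).
exists (fun j i => if j is j'.+1 then c' j' i else
  (if pi e.+1 (b i) == b i then c i else 0)).
  by case => // j i lt_ej; exact: c'0.
have [_ _ _ /(_ _ e.+1 Jq)] := homJ.
rewrite !linearB /= hp -{2}addn1 (pihomogM _ _ hl) pihomog_sum => Jp.
set s2 := \sum_(j < n) _ in Jc'; set s := \sum_(j < n) _.
suff -> : s = (\sum_i pi e.+1 (c i *: b i)) + s2 * l.
  set x := \sum_i _; have -> : p - (x + s2 * l) =
      (p - x - pi e q * l) + (pi e q - s2) * l by ring.
  by case: (idJ) => _ JD _; apply: (JD _ _ Jp); exact: idealMr.
rewrite /s /s2; case: n lt_en => [//|n' lt_en]; rewrite big_ord_recl /=; congr (_ + _).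
  apply: eq_bigr => i _; rewrite expr0 mul1r linearZ /=.
  by have [k hk] := hb i; rewrite (pihomog_coef _ _ hk).
(* The last summand of [s2] would be shifted to the power [n] of [l]; its coefficients vanish
   because [e < n']. *)
rewrite [in RHS]big_ord_recr /= mulrDl [X in _ = _ + X * _]big1; last first.
  by move=> i _; rewrite c'0 ?scale0r.
rewrite mul0r addr0 mulr_suml; apply: eq_bigr => j _; rewrite mulr_suml.
by apply: eq_bigr => i _; rewrite -scalerAl exprSr mulrAC.
Qed.

Lemma adjoin_span p : (mmeasure mdeg p <= n)%N ->
  exists c : 'I_n * I -> C, J (p - \sum_x c x *: (l ^+ x.1 * b x.2)).
Proof.
move=> szp.
have /choice[c cP] : forall e : 'I_n, exists c : nat -> I -> C,
    J (pi e p - \sum_(j < n) \sum_i c j i *: (l ^+ j * b i)).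
  by move=> e; have [c _ ?] := adjoin_span_homog (ltn_ord e) (pihomog_id _ _ p); exists c.
exists (fun x : 'I_n * I => \sum_(e < n) c e x.1 x.2).
rewrite {1}(pihomog_partition szp).
have -> : \sum_(x : 'I_n * I) (\sum_(e < n) c e x.1 x.2) *: (l ^+ x.1 * b x.2) =
    \sum_(e < n) \sum_(j < n) \sum_i c e j i *: (l ^+ j * b i).
  under eq_bigr do rewrite scaler_suml.
  by rewrite exchange_big /=; apply: eq_bigr => e _; rewrite pair_big.
by rewrite -sumrB; exact: ideal_sum.
Qed.

End step.

(** Multiplying the family for [J + (l)] by the [n] powers [l ^+ j] with [j < n] gives a spanning
    family for [J], at the cost of one more factor [n]. *)
Lemma adjoin_growth J l D : homogeneous_ideal J -> pi 1 l = l ->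
  poly_growth (ideal_adjoin J l) D -> poly_growth J D.+1.
Proof.
move=> homJ hl [K KP]; exists K => n; have [I [b [cardI hb span_b]]] := KP n.
exists ('I_n * I)%type, (fun x : 'I_n * I => l ^+ x.1 * b x.2); split.
- by rewrite card_prod card_ord expnS mulnCA leq_mul2l cardI orbT.
- move=> [j i]; have [k hk] := hb i; exists (j * 1 + k)%N.
  exact: pihomogMhomog (pihomogXhomog _ hl) hk.
- by move=> p; exact: (adjoin_span homJ hl hb span_b).
Qed.

End growth.

(** * Chains of irreducible closed sets *)

Section chains.
Context (R : realType) (d : nat).
Local Notation C := (Cx R).
Local Notation S := (mpoly d C).
Local Notation Cd := ('I_d -> C).
Local Notation pi := (pihomog mdeg).
Local Notation mX m := (mpolyX C m).
Implicit Types (p q f g : S) (J P : set S) (Z V W : set Cd).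

Definition vanishing J : set Cd := [set z | forall p, J p -> meval z p = 0].

Definition ideal_of Z : set S := [set p | forall z, Z z -> meval z p = 0].

Lemma ideal_of_ideal Z : poly_ideal (ideal_of Z).
Proof.
split => [z _|p q pZ qZ z Zz|p q qZ z Zz]; first by rewrite meval0.
- by rewrite mevalD pZ// qZ// addr0.
- by rewrite mevalM qZ// mulr0.
Qed.

Lemma ideal_ofS Z V : Z `<=` V -> ideal_of V `<=` ideal_of Z.
Proof. by move=> ZV p pV z /ZV/pV. Qed.

Lemma zariski_closedP Z :
  zariski_closed setT Z <-> forall z, vanishing (ideal_of Z) z -> Z z.
Proof.
split => [[E ->] z zE|ZP]; first by split=> // p Ep; apply: zE => w [_]; exact.
exists (ideal_of Z); rewrite setTI; apply/seteqP; split => [z Zz p|z]; [exact|exact: ZP].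
Qed.

Lemma zariski_closed_vanishing J : zariski_closed setT (vanishing J).
Proof. by exists J; rewrite setTI. Qed.

Lemma zariski_closedI Z V : zariski_closed setT Z -> zariski_closed setT V ->
  zariski_closed setT (Z `&` V).
Proof.
move=> /zariski_closedP cZ /zariski_closedP cV; apply/zariski_closedP => z zZV.
by split; [apply: cZ|apply: cV] => p pZ; apply: zZV => w [? ?]; exact: pZ.
Qed.

Lemma zariski_closedU Z V : zariski_closed setT Z -> zariski_closed setT V ->
  zariski_closed setT (Z `|` V).
Proof.
move=> /zariski_closedP cZ /zariski_closedP cV; apply/zariski_closedP => z zZV.
apply: contrapT => /not_orP[nZ nV].
have [p [pZ pz]] : exists p, ideal_of Z p /\ meval z p != 0.
  apply: contrapT => np; apply/nZ/cZ => p pZ; apply: contrapT => /eqP pz.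
  by apply: np; exists p.
have [q [qV qz]] : exists q, ideal_of V q /\ meval z q != 0.
  apply: contrapT => nq; apply/nV/cV => q qV; apply: contrapT => /eqP qz.
  by apply: nq; exists q.
have /eqP : meval z (p * q) = 0.
  by apply: zZV => w [/pZ|/qV] w0; rewrite mevalM w0 ?mul0r ?mulr0.
by rewrite mevalM mulf_eq0 (negPf pz) (negPf qz).
Qed.

Lemma zariski_closed_singleton (z : Cd) : zariski_closed setT [set z].
Proof.
apply/zariski_closedP => w zw; apply/funext => i; apply/eqP; rewrite -subr_eq0.
have /zw : ideal_of [set z] (mX (mnm1 i) - mpolyC d (z i)).
  by move=> _ ->; rewrite mevalB mevalXU mevalC subrr.
by rewrite mevalB mevalXU mevalC => ->.
Qed.

(** Noetherian induction: a counterexample with maximal ideal is a minimal closed one. Being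
    reducible, it is covered by two proper closed subsets, both of which decompose. *)
Lemma zariski_decomposition Z : zariski_closed setT Z ->
  exists2 s : seq (set Cd), (forall W, W \in s -> irreducible_closed setT W) &
    Z = [set z | exists2 W, W \in s & W z].
Proof.
pose dec Z := exists2 s : seq (set Cd),
  (forall W, W \in s -> irreducible_closed setT W) &
    Z = [set z | exists2 W, W \in s & W z].
move=> cZ; apply: contrapT; rewrite -/(dec Z) => ndecZ.
pose Fam := [set J | exists V, [/\ zariski_closed setT V, ~ dec V & J = ideal_of V]].
have idFam J : Fam J -> poly_ideal J by move=> [V [_ _ ->]]; exact: ideal_of_ideal.
have [|_ [V [cV ndecV ->]] maxV] := ideal_family_maximal idFam.
  by exists (ideal_of Z); exists Z; split.
have decI A : zariski_closed setT A -> ~ V `<=` A -> dec (V `&` A).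
  move=> cA nVA; apply: contrapT => ndecVA; apply: nVA.
  have /maxV : Fam (ideal_of (V `&` A)).
    by exists (V `&` A); split=> //; exact: zariski_closedI.
  move=> /(_ (ideal_ofS (@subIsetl _ _ _))) sub z Vz.
  have /zariski_closedP /(_ z) [] // := zariski_closedI cV cA.
  by move=> p /sub; apply.
apply: ndecV.
(* Irreducible sets are nonempty by definition, so the empty set is the union of no components. *)
have [V0|V0] := pselect (V !=set0); last first.
  exists [::] => //; apply/seteqP; split => z; last by case.
  by move=> Vz; exfalso; apply: V0; exists z.
have [irrV|nirrV] := pselect (irreducible_closed setT V).
  exists [:: V] => [W|]; first by rewrite inE => /eqP ->.
  apply/seteqP; split => [z Vz|z [W]]; first by exists V; rewrite ?mem_head.
  by rewrite inE => /eqP ->.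
have [A [B [cA cB VAB nVA nVB]]] : exists A B, [/\ zariski_closed setT A,
    zariski_closed setT B, V `<=` A `|` B, ~ V `<=` A & ~ V `<=` B].
  apply: contrapT => nAB; apply: nirrV; split=> // A B cA cB VAB.
  by apply: contrapT => /not_orP[nA nB]; apply: nAB; exists A, B.
have [s irrs sE] := decI _ cA nVA; have [t irrt tE] := decI _ cB nVB.
exists (s ++ t) => [W|]; first by rewrite mem_cat => /orP[/irrs|/irrt].
apply/seteqP; split => [z Vz|z [W]].
  have [Az|Bz] := VAB z Vz.
    have : (V `&` A) z by []; rewrite sE => -[W Ws Wz].
    by exists W => //; rewrite mem_cat Ws.
  have : (V `&` B) z by []; rewrite tE => -[W Wt Wz].
  by exists W => //; rewrite mem_cat Wt orbT.
rewrite mem_cat => /orP[Ws|Wt] Wz.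
  have : [set z | exists2 W, W \in s & W z] z by exists W.
  by rewrite -sE => -[].
have : [set z | exists2 W, W \in t & W z] z by exists W.
by rewrite -tE => -[].
Qed.

Lemma irreducible_sub_union V (s : seq (set Cd)) :
  irreducible_closed setT V -> (forall W, W \in s -> zariski_closed setT W) ->
  V `<=` [set z | exists2 W, W \in s & W z] -> exists2 W, W \in s & V `<=` W.
Proof.
move=> irrV; have [_ [z0 Vz0] irr] := irrV.
have cU (t : seq (set Cd)) : (forall W, W \in t -> zariski_closed setT W) ->
    zariski_closed setT [set z | exists2 W, W \in t & W z].
  elim: t => [|W t IH] ct.
    exists [set 1]; apply/seteqP; split => [z [W]//|z [_ /(_ 1 erefl)]].
    by rewrite meval1 => /eqP; rewrite oner_eq0.
  rewrite (_ : mkset _ = W `|` [set z | exists2 W, W \in t & W z]).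
    apply: zariski_closedU; first by apply: ct; rewrite mem_head.
    by apply: IH => W' W't; apply: ct; rewrite inE W't orbT.
  apply/seteqP; split => [z [W']|z [Wz|[W' W't W'z]]].
  - by rewrite inE => /orP[/eqP->|W't] W'z; [left|right; exists W'].
  - by exists W; rewrite ?mem_head.
  - by exists W'; rewrite // inE W't orbT.
elim: s => [|W s IH] cs Vs; first by have [] := Vs _ Vz0.
have cs' W' : W' \in s -> zariski_closed setT W'.
  by move=> W's; apply: cs; rewrite inE W's orbT.
have [||z Vz|VW|Vs'] := irr W [set z | exists2 W, W \in s & W z].
- by apply: cs; rewrite mem_head.
- exact: cU.
- have [W'] := Vs z Vz; rewrite inE => /orP[/eqP->|W's] W'z; first by left.
  by right; exists W'.
- by exists W; rewrite ?mem_head.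
- by have [W' W's VW'] := IH cs' Vs'; exists W' => //; rewrite inE W's orbT.
Qed.

(** Look for the form on the moment curve, with coefficients [t ^+ i]. Its value at each point is a
    nonzero polynomial in [t], and the product of these finitely many polynomials has a non-root. *)
Lemma linear_form_nonvanishing (s : seq (set Cd)) (z : set Cd -> Cd) :
  (forall W, W \in s -> exists i, z W i != 0) ->
  exists l, [/\ pi 1 l = l, meval (fun=> 0) l = 0 &
    forall W, W \in s -> meval (z W) l != 0].
Proof.
move=> nz; pose q W : {poly C} := \sum_(i < d) z W i *: 'X^i.
have /closed_nonrootP[t] : \prod_(W <- s) q W != 0.
  rewrite prodf_seq_neq0; apply/allP => W /nz[i zi] /=.
  apply: contra zi => /eqP q0; have := congr1 (fun p : {poly C} => p`_i) q0.
  rewrite coef0 coef_sum (bigD1 i)//= coefZ coefXn eqxx mulr1 big1 ?addr0 => [->//|j ji].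
  rewrite coefZ coefXn (_ : (i == j :> nat) = false) ?mulr0//.
  by apply: contraNF ji => /eqP e; apply/eqP/val_inj.
rewrite /root horner_prod prodf_seq_neq0 => /allP nr.
have evl w : meval w (\sum_(i < d) t ^+ i *: mX (mnm1 i)) = \sum_(i < d) t ^+ i * w i.
  by rewrite raddf_sum; apply: eq_bigr => i _; rewrite /= mevalZ mevalXU.
exists (\sum_(i < d) t ^+ i *: mX (mnm1 i)); split.
- rewrite pihomog_sum; apply: eq_bigr => i _; rewrite linearZ /=; congr (_ *: _).
  by have := pihomog_mpolyX R (mnm1 i); rewrite mdeg1.
- by rewrite evl big1// => i _; rewrite mulr0.
- move=> W /nr /=; rewrite evl /q horner_sum; congr (_ != 0).
  by apply: eq_bigr => i _; rewrite hornerZ hornerXn mulrC.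
Qed.

Definition along_line (z : Cd) p : {poly C} :=
  mmap polyC (fun i => z i *: 'X) p.

Lemma horner_along_line z p t :
  (along_line z p).[t] = meval (fun i => t * z i) p.
Proof.
rewrite /along_line mevalE /mmap horner_sum; apply: eq_bigr => m _.
rewrite hornerM hornerC /mmap1 horner_prod; congr (_ * _); apply: eq_bigr => i _.
by rewrite horner_exp hornerZ hornerX mulrC.
Qed.

(** A line is irreducible: otherwise each [W] in [s] has an equation that is nonzero along the line,
    and any [t] outside the roots of the product of these polynomials gives a point of the line in
    no [W]. *)
Lemma line_in_component (s : seq (set Cd)) z :
  (forall W, W \in s -> zariski_closed setT W) ->
  (forall t : C, exists2 W, W \in s & W (fun i => t * z i)) ->
  exists2 W, W \in s & forall t : C, W (fun i => t * z i).
Proof.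
move=> cs line; apply: contrapT => nW.
have /choice[f fP] : forall W, exists f, W \in s ->
    ideal_of W f /\ along_line z f != 0.
  move=> W; have [Ws|nWs] := boolP (W \in s); last by exists 0.
  have : ~ forall t : C, W (fun i => t * z i) by move=> Wz; apply: nW; exists W.
  move=> /existsNP[t nWt]; apply: contrapT => nf; apply: nWt.
  apply/(zariski_closedP W).1; first exact: cs.
  move=> p pW; rewrite -horner_along_line; have [->|p0] := eqVneq (along_line z p) 0.
    by rewrite horner0.
  by exfalso; apply: nf; exists p.
have /closed_nonrootP[t] : \prod_(W <- s) along_line z (f W) != 0.
  by rewrite prodf_seq_neq0; apply/allP => W /fP[].
rewrite /root horner_prod prodf_seq_neq0 => /allP nr.
have [W Ws Wt] := line t; have := nr _ Ws; rewrite horner_along_line.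
by have [-> //] := fP W Ws; rewrite eqxx.
Qed.

Lemma meval_scale_homog k p (z : Cd) (t : C) : pi k p = p ->
  meval (fun i => t * z i) p = t ^+ k * meval z p.
Proof.
move=> /homog_monomial_sum ->; rewrite [LHS]raddf_sum [in RHS]raddf_sum mulr_sumr /=.
apply: eq_bigr => m /eqP mk; rewrite !mevalZ !mevalX mulrCA; congr (_ * _).
under eq_bigr do rewrite exprMn.
by rewrite big_split /= prodrXr -mdegE mk.
Qed.

Lemma meval_partition (z : Cd) p :
  meval z p = \sum_(k < mmeasure mdeg p) meval z (pi k p).
Proof. by rewrite {1}(pihomog_partition (leqnn (mmeasure mdeg p))) raddf_sum. Qed.

Lemma homogeneous_vanishing_scale J (z : Cd) (t : C) : homogeneous_ideal J ->
  vanishing J z -> vanishing J (fun i => t * z i).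
Proof.
move=> [_ _ _ Jh] Jz p Jp; rewrite meval_partition big1// => k _.
by rewrite (meval_scale_homog _ _ (pihomog_id _ _ _)) Jz ?mulr0//; exact: Jh.
Qed.

(** The constant term of an element of [J] is in [J] by homogeneity; if it were nonzero, [J] would
    contain 1. *)
Lemma vanishing_origin J : homogeneous_ideal J -> ~ J 1 -> vanishing J (fun=> 0).
Proof.
move=> homJ nJ1 p Jp; apply: contrapT => /eqP p0; apply: nJ1.
have idJ := homogeneous_ideal_ideal homJ.
have [_ _ _ /(_ _ 0%N Jp) Jp0] := homJ.
have {}p0 : meval (fun=> 0) (pi 0 p) != 0.
  apply: contra p0 => /eqP p00; rewrite meval_partition; apply/eqP/big1 => -[[|k] ?] _ //=.
  rewrite (_ : (fun=> 0) = (fun i => 0 * (fun=> 0) i :> C)); last first.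
    by apply/funext => i; rewrite mul0r.
  by rewrite (meval_scale_homog _ _ (pihomog_id _ _ _)) expr0n mul0r.
have pE := msize1_polyC (msize_homog (pihomog_id mdeg 0 p)).
rewrite pE mevalC in p0; rewrite pE in Jp0.
by have := idealZ (mcoeff mnm0 (pi 0 p))^-1 idJ Jp0; rewrite -mul_mpolyC -mpolyCM mulVf.
Qed.

(** Irreducibility is taken in the whole space rather than in [Z], so that one chain can be reused
    for a larger zero set. *)
Definition has_chain Z (n : nat) : Prop :=
  exists V : nat -> set Cd,
    (forall i, (i <= n)%N -> irreducible_closed setT (V i) /\ V i `<=` Z) /\
    (forall i, (i < n)%N -> V i `<` V i.+1).

Lemma has_chain_extend Z Z' n (V : nat -> set Cd) W : Z' `<=` Z ->
  (forall i, (i <= n)%N -> irreducible_closed setT (V i) /\ V i `<=` Z') ->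
  (forall i, (i < n)%N -> V i `<` V i.+1) ->
  irreducible_closed setT W -> W `<=` Z -> V n `<` W -> has_chain Z n.+1.
Proof.
move=> Z'Z irrV ltV irrW WZ ltVW; exists (fun i => if (i <= n)%N then V i else W).
split=> i; first by case: (leqP i n) => [/irrV[? ?] _|//]; split=> //; exact: subset_trans Z'Z.
by rewrite ltnS; case: (ltngtP i n) => // [lt_in _|-> _]; [exact: ltV|exact: ltVW].
Qed.

Lemma growth_and_chain J : homogeneous_ideal J -> ~ J 1 ->
  exists n, poly_growth J n /\ has_chain (vanishing J) n.
Proof.
move=> homJ nJ1; apply: contrapT => nJ.
(* Vanishing at the origin replaces [~ J 1] because it visibly persists when a linear form is
   added. *)
pose Fam := [set J | [/\ homogeneous_ideal J, vanishing J (fun=> 0) &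
  ~ exists n, poly_growth J n /\ has_chain (vanishing J) n]].
have idFam P : Fam P -> poly_ideal P by case=> /homogeneous_ideal_ideal.
have [|{J homJ nJ1 nJ} J [homJ J0 nJ] maxJ] := ideal_family_maximal idFam.
  by exists J; split=> //; exact: vanishing_origin.
have idJ := homogeneous_ideal_ideal homJ.
apply: nJ; have [Z0|] := pselect (forall z, vanishing J z -> forall i, z i = 0).
  exists 0%N; split; first exact/cofinite_growth/projective_nullstellensatz.
  exists (fun=> [set (fun=> 0)]); split => // i _; split; last by move=> _ ->.
  split; [exact: zariski_closed_singleton|by exists (fun=> 0)|].
  by move=> A B _ _ /(_ _ erefl)[A0|B0]; [left|right] => _ ->.
move=> /existsNP[z /not_implyP[Jz /existsNP[i /eqP zi]]].
have [s irrs ZE] := zariski_decomposition (zariski_closed_vanishing J).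
have cs W : W \in s -> zariski_closed setT W by move=> /irrs[].
have [W0 W0s lineW0] : exists2 W, W \in s & forall t : C, W (fun i => t * z i).
  apply: line_in_component => // t.
  by have := homogeneous_vanishing_scale t homJ Jz; rewrite ZE.
pose nzpt W (w : Cd) := W w /\ exists j, w j != 0.
(* A nonzero point of [W] if there is one; the default [z] keeps [pt W] nonzero even when [W] is the
   origin. *)
pose pt W : Cd := xget z (nzpt W).
have ptz W : exists j, pt W j != 0.
  by rewrite /pt; case: xgetP => [w _ [] //|_]; exists i.
have [l [hl l0 lpt]] := @linear_form_nonvanishing s pt (fun W _ => ptz W).
have subZ : vanishing (ideal_adjoin J l) `<=` vanishing J.
  by move=> w Jlw p /(@ideal_adjoin_sub _ _ _ l)/Jlw.
have subl w : vanishing (ideal_adjoin J l) w -> meval w l = 0.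
  by apply; exact: ideal_adjoin_mem.
have sZ W : W \in s -> W `<=` vanishing J by move=> Ws w Ww; rewrite ZE; exists W.
have [n [grl [V [irrV ltV]]]] :
    exists n, poly_growth (ideal_adjoin J l) n /\ has_chain (vanishing (ideal_adjoin J l)) n.
  (* By maximality a counterexample [ideal_adjoin J l] would lie in [J]; but [l] is not in [J],
     since it is nonzero at [pt W0], a zero of [J]. *)
  apply: contrapT => nJl; have /maxJ : Fam (ideal_adjoin J l).
    split=> //; first exact: ideal_adjoin_homogeneous hl.
    move=> p [q /J0]; rewrite mevalB mevalM l0 mulr0 subr0; exact.
  move=> /(_ (@ideal_adjoin_sub _ _ _ _)) /(_ l (ideal_adjoin_mem _ homJ)) Jl.
  have := lpt _ W0s; have : vanishing J (pt W0).
    rewrite /pt; case: xgetP => [w _ [W0w _]|_]; [exact: sZ W0w|exact: Jz].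
  by move=> /(_ _ Jl) ->; rewrite eqxx.
exists n.+1; split; first exact: adjoin_growth hl grl.
have [irrVn Vn_sub] := irrV n (leqnn n).
have [W [Ws VnW]] : exists W, W \in s /\ V n `<` W.
  have [|W Ws VnW] := irreducible_sub_union irrVn cs.
    by move=> w /Vn_sub/subZ; rewrite ZE.
  (* The form [l] vanishes on [V n]. If [W] has a nonzero point, [l] is nonzero at [pt W] in [W], so
     the inclusion is strict. Otherwise [V n] is contained in the origin and [W0], which contains a
     whole line, takes the place of [W]. *)
  have [[w [Ww nzw]]|nnz] := pselect (exists w, nzpt W w).
    exists W; split=> //; split=> // WVn; have := lpt _ Ws.
    suff : W (pt W) by move=> /WVn/Vn_sub/subl ->; rewrite eqxx.
    by have [] : nzpt W (pt W) by exact: (xgetI _ (conj Ww nzw)).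
  exists W0; split=> //; split=> [w /VnW Ww|W0V].
    rewrite (_ : w = (fun i => 0 * z i))//; apply/funext => j; rewrite mul0r.
    by apply/eqP; apply: contra_notT nnz => wj; exists w; split=> //; exists j.
  apply: nnz; exists (fun i => 1 * z i); split; last by exists i; rewrite mul1r.
  exact/VnW/W0V/lineW0.
have [irrW WZ] : irreducible_closed setT W /\ W `<=` vanishing J.
  by split; [exact: irrs|exact: sZ].
exact: has_chain_extend subZ irrV ltV irrW WZ VnW.
Qed.

End chains.

(** * Rotations preserve Lebesgue measure *)

Section measure_preserving.
Context (R : realType).
Local Notation mR := (measurableTypeR R).
Local Notation leb := (@lebesgue_measure R).
Local Notation plane := (mR * mR)%type.

Definition measure_preserving d (T : measurableType d)
    (mu : {measure set T -> \bar R}) (phi : T -> T) : Prop :=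
  measurable_fun setT phi /\
  forall A, measurable A -> mu (phi @^-1` A) = mu A.

Lemma measure_preserving_comp d (T : measurableType d)
    (mu : {measure set T -> \bar R}) (phi psi : T -> T) :
  measure_preserving mu phi -> measure_preserving mu psi ->
  measure_preserving mu (phi \o psi).
Proof.
move=> [mphi phiE] [mpsi psiE]; split; first exact: measurableT_comp.
move=> A mA; rewrite comp_preimage psiE ?phiE//.
by rewrite -[X in measurable X]setTI; exact: mphi.
Qed.

Lemma measure_preserving_id d (T : measurableType d)
    (mu : {measure set T -> \bar R}) : measure_preserving mu id.
Proof. by split. Qed.

(** Lebesgue measure is determined by its values on half-open intervals, whose lengths are
    unchanged. *)
Lemma lebesgue_translation (a : R) (A : set mR) : measurable A ->
  leb ((fun x => x + a)%R @^-1` A) = leb A.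
Proof.
have mt : measurable_fun [set: mR] (fun x : mR => (x + a)%R : mR).
  exact: measurable_funD.
move=> mA; apply/esym; pose mu' := pushforward leb (fun x : mR => (x + a)%R : mR).
have -> : leb ((fun x => x + a)%R @^-1` A) = mu' A by [].
apply: (@lebesgue_measure_unique R (measure_function_pushforward__canonical__measure_function_Measure leb mt)) => // _ [[u v]] _ <-.
rewrite /= /pushforward.
have -> : (fun x => x + a)%R @^-1` `]u, v] = `](u - a)%R, (v - a)%R]%classic.
  by apply/seteqP; split => x /=; rewrite !in_itv/= ltrBlDr lerBrDr.
by rewrite !lebesgue_measure_itv/= !lte_fin ltrD2r -!EFinB opprB addrA subrK.
Qed.

Definition shear1 (a : R) (p : plane) : plane := (p.1 + a * p.2, p.2)%R.
Definition shear2 (a : R) (p : plane) : plane := (p.1, p.2 + a * p.1)%R.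
Definition rotation (c s : R) (p : plane) : plane :=
  (c * p.1 - s * p.2, s * p.1 + c * p.2)%R.

Lemma measurable_shear1 a : measurable_fun setT (shear1 a).
Proof.
apply: measurable_fun_pair => //.
by apply: measurable_funD => //; exact: measurable_funM.
Qed.

Lemma measurable_shear2 a : measurable_fun setT (shear2 a).
Proof.
apply: measurable_fun_pair => //.
by apply: measurable_funD => //; exact: measurable_funM.
Qed.

Lemma shear2_preserving a : measure_preserving (@plane_measure R) (shear2 a).
Proof.
split; first exact: measurable_shear2.
move=> A mA; rewrite /plane_measure /product_measure1.
apply: eq_integral => x _ /=.
rewrite -(lebesgue_translation (a * x) (measurable_xsection x mA)).
congr (leb _); apply/seteqP; split => y /=;
  by rewrite /xsection /= !inE /shear2.
Qed.

(** Allows slicing along the other coordinate: [shear1] translates horizontal sections as [shear2]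
    translates vertical ones. *)
Lemma plane_measure2E (A : set plane) : measurable A ->
  plane_measure A = (leb \x^ leb)%E A.
Proof.
move=> mA; apply: (@product_measure_unique _ _ _ _ R leb leb (leb \x^ leb)%E) => //.
by move=> *; exact: product_measure2E.
Qed.

Lemma shear1_preserving a : measure_preserving (@plane_measure R) (shear1 a).
Proof.
have ms := measurable_shear1 a; split; first by [].
move=> A mA; transitivity ((leb \x^ leb)%E (shear1 a @^-1` A)).
  by apply: plane_measure2E; rewrite -[X in measurable X]setTI; exact: ms.
transitivity ((leb \x^ leb)%E A); last exact/esym/plane_measure2E.
rewrite /product_measure2; apply: eq_integral => y _ /=.
rewrite -(lebesgue_translation (a * y) (measurable_ysection y mA)).
congr (leb _); apply/seteqP; split => x /=;
  by rewrite /ysection /= !inE /shear1.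
Qed.

(* If [s != 0], the rotation is a product of three shears. *)
Lemma rotation_preserving c s : c ^+ 2 + s ^+ 2 = 1 ->
  measure_preserving (@plane_measure R) (rotation c s).
Proof.
have shears c' s' : c' ^+ 2 + s' ^+ 2 = 1 -> s' != 0 ->
    measure_preserving (@plane_measure R) (rotation c' s').
  (* For the angle [theta], [a] is minus the tangent of [theta / 2]. *)
  move=> cs s0; pose a := (c' - 1) / s'.
  have sa : s' * a = c' - 1 by rewrite /a mulrCA mulfV ?mulr1.
  have ac : a * (1 + c') = - s'.
    by apply: (mulfI s0); rewrite mulrA sa mulrN -expr2; lra.
  suff -> : rotation c' s' = shear1 a \o (shear2 s' \o shear1 a).
    apply: measure_preserving_comp; first exact: shear1_preserving.
    by apply: measure_preserving_comp; [exact: shear2_preserving|exact: shear1_preserving].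
  apply/funext => -[x y]; rewrite /rotation /shear1 /shear2 /=.
  have -> : y + s' * (x + a * y) = s' * x + c' * y.
    rewrite mulrDr mulrA sa; ring.
  congr pair; rewrite mulrDr [a * (s' * x)]mulrA [a * s']mulrC sa.
  have -> : c' * x - s' * y = c' * x + (a * (1 + c')) * y by rewrite ac mulNr.
  ring.
move=> cs; have [s0|] := eqVneq s 0; last exact: shears.
have : c == 1 \/ c == -1.
  by apply/orP; rewrite -sqrf_eq1; apply/eqP; move: cs; rewrite s0 expr0n addr0.
move=> [/eqP->|/eqP->]; rewrite s0.
  suff -> : rotation 1 0 = id by exact: measure_preserving_id.
  by apply/funext => -[x y]; rewrite /rotation /= !mul1r !mul0r subr0 add0r.
(* The half turn has zero sine, but it is the square of a quarter turn. *)
suff -> : rotation (-1) 0 = rotation 0 1 \o rotation 0 1.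
  by apply: measure_preserving_comp; apply: shears; rewrite ?expr0n ?expr1n ?add0r ?oner_neq0.
by apply/funext => -[x y]; rewrite /rotation /= ; congr pair; ring.
Qed.

Section product.
Context (dT : measure_display) (T : measurableType dT).
Context (m : {sigma_finite_measure set T -> \bar R}).

Lemma product_preserving d1 d2 (T1 : measurableType d1) (T2 : measurableType d2)
    (m1 : {sigma_finite_measure set T1 -> \bar R})
    (m2 : {sigma_finite_measure set T2 -> \bar R})
    (phi : T1 -> T1) (psi : T2 -> T2) :
  measure_preserving m1 phi -> measure_preserving m2 psi ->
  measurable_fun setT (fun x : T1 * T2 => (phi x.1, psi x.2)) /\
  forall A, measurable A ->
    (m1 \x m2)%E ((fun x => (phi x.1, psi x.2)) @^-1` A) = (m1 \x m2)%E A.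
Proof.
move=> [mphi phiE] [mpsi psiE].
have mF : measurable_fun setT (fun x : T1 * T2 => (phi x.1, psi x.2)).
  by apply: measurable_fun_pair; exact: measurableT_comp.
split=> // A mA; apply/esym.
apply: (@product_measure_unique _ _ _ _ R m1 m2
  (measure_function_pushforward__canonical__measure_function_Measure (m1 \x m2)%E mF)) => //.
move=> B1 B2 mB1 mB2; rewrite /= /pushforward.
have -> : (fun x : T1 * T2 => (phi x.1, psi x.2)) @^-1` (B1 `*` B2) =
  (phi @^-1` B1) `*` (psi @^-1` B2) by [].
rewrite product_measure1E ?phiE ?psiE//.
  by rewrite -[X in measurable X]setTI; exact: mphi.
by rewrite -[X in measurable X]setTI; exact: mpsi.
Qed.

(** The maps are indexed by [nat] so that the induction on [n] can pass to the tail with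
    [phi \o S]. *)
Definition tuple_map (n : nat) (phi : nat -> T -> T) (t : n.-tuple T) : n.-tuple T :=
  [tuple phi i (tnth t i) | i < n].

Lemma tuple_map_tcons n (phi : nat -> T -> T) (p : T * n.-tuple T) :
  tuple_map phi (tcons p) = tcons (phi 0 p.1, tuple_map (phi \o S) p.2).
Proof.
apply: eq_from_tnth => i; rewrite tnth_mktuple /tcons /=.
case: (unliftP ord0 i) => [j ->|->].
  by rewrite !tnthS tnth_mktuple.
by rewrite !tnth0.
Qed.

Lemma measurable_tuple_map n (phi : nat -> T -> T) :
  (forall i, measurable_fun setT (phi i)) ->
  measurable_fun setT (@tuple_map n phi).
Proof.
move=> mphi; apply/measurable_fun_tnthP => i /=.
rewrite (_ : _ \o _ = phi i \o (@tnth n T ^~ i)); last first.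
  by apply/funext => t /=; rewrite tnth_mktuple.
by apply: measurableT_comp => //; exact: measurable_tnth.
Qed.

Lemma tuple_map_preserving n (phi : nat -> T -> T) :
  (forall i, measure_preserving m (phi i)) ->
  measure_preserving (prod_power m n) (tuple_map phi).
Proof.
elim: n phi => [|n IH] phi mphi.
  split; first by apply: measurable_tuple_map => i; case: (mphi i).
  move=> A mA; rewrite (_ : tuple_map phi = id)//.
  by apply/funext => t; apply: eq_from_tnth => -[].
have mt : measurable_fun setT (@tuple_map n.+1 phi).
  by apply: measurable_tuple_map => i; case: (mphi i).
split=> // A mA; rewrite /= /prod_step /pushforward.
have [_ pres] := product_preserving (mphi 0%N) (IH (phi \o S) (fun i => mphi i.+1)).
have mA' : measurable (@tcons _ _ n @^-1` A).
  by rewrite -[X in measurable X]setTI; exact: measurable_tcons.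
have tupleE : tuple_map phi \o @tcons _ _ n =
    @tcons _ _ n \o (fun x => (phi 0%N x.1, tuple_map (phi \o S) x.2)).
  by apply/funext => x /=; rewrite tuple_map_tcons.
have -> : @tcons _ _ n @^-1` (tuple_map phi @^-1` A) =
    (fun x => (phi 0%N x.1, tuple_map (phi \o S) x.2)) @^-1` (@tcons _ _ n @^-1` A).
  exact: (congr1 (fun f => f @^-1` A) tupleE).
exact: pres mA'.
Qed.

End product.

End measure_preserving.

(** * Complex-valued functions *)

Section complex_basics.
Context (R : realType).
Local Notation C := (Cx R).
Implicit Types (w v : C).
Local Notation Re := (@complex.Re R).
Local Notation Im := (@complex.Im R).

(** The modulus as a real number: the norm of [C] takes its values in [C], while integrals and
    estimates are real. *)
Definition cmod w : R := Num.sqrt (sqmod w).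

Lemma ReD w v : Re (w + v) = Re w + Re v. Proof. by case: w v => ? ? []. Qed.
Lemma ImD w v : Im (w + v) = Im w + Im v. Proof. by case: w v => ? ? []. Qed.
Lemma ReN w : Re (- w) = - Re w. Proof. by case: w. Qed.
Lemma ImN w : Im (- w) = - Im w. Proof. by case: w. Qed.
Lemma ReM w v : Re (w * v) = Re w * Re v - Im w * Im v.
Proof. by case: w v => ? ? []. Qed.
Lemma ImM w v : Im (w * v) = Re w * Im v + Im w * Re v.
Proof. by case: w v => ? ? []. Qed.
Lemma ReJ w : Re w^* = Re w. Proof. by case: w. Qed.
Lemma ImJ w : Im w^* = - Im w. Proof. by case: w. Qed.

Lemma eq_ReIm w v : Re w = Re v -> Im w = Im v -> w = v.
Proof. by case: w v => ? ? [? ?] /= -> ->. Qed.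

Lemma Re_sum (I : Type) (r : seq I) (P : pred I) (F : I -> C) :
  Re (\sum_(i <- r | P i) F i) = \sum_(i <- r | P i) Re (F i).
Proof. by apply: (big_morph Re ReD). Qed.

Lemma sqmod_ge0 w : 0 <= sqmod w.
Proof. by rewrite addr_ge0 ?sqr_ge0. Qed.

Lemma normCE w : `|w| = (cmod w)%:C%C :> C.
Proof. by rewrite /cmod /sqmod -normc_def. Qed.

Lemma cmod_ge0 w : 0 <= cmod w. Proof. exact: sqrtr_ge0. Qed.

Lemma sqr_cmod w : cmod w ^+ 2 = sqmod w.
Proof. by rewrite sqr_sqrtr ?sqmod_ge0. Qed.

Lemma leCR (x y : R) : (x%:C%C <= y%:C%C :> C) = (x <= y).
Proof. exact: lecR. Qed.

Lemma ltCR (x y : R) : (x%:C%C < y%:C%C :> C) = (x < y).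
Proof. exact: ltcR. Qed.

Lemma CRD (x y : R) : (x + y)%:C%C = x%:C%C + y%:C%C :> C.
Proof. by apply: eq_ReIm => /=; rewrite ?addr0. Qed.

Lemma CRM (x y : R) : (x * y)%:C%C = x%:C%C * y%:C%C :> C.
Proof. by apply: eq_ReIm => /=; rewrite ?(mulr0, mul0r, subr0, addr0). Qed.

Lemma CRX (x : R) n : (x ^+ n)%:C%C = x%:C%C ^+ n :> C.
Proof. by elim: n => [//|n IH]; rewrite !exprS CRM IH. Qed.

Lemma CR_inj (x y : R) : x%:C%C = y%:C%C :> C -> x = y.
Proof. by case. Qed.

Lemma cmodM w v : cmod (w * v) = cmod w * cmod v.
Proof. by apply: CR_inj; rewrite CRM -!normCE normrM. Qed.

Lemma cmodX w n : cmod (w ^+ n) = cmod w ^+ n.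
Proof. by apply: CR_inj; rewrite CRX -!normCE normrX. Qed.

Lemma cmodR (x : R) : cmod (x%:C%C : C) = `|x|.
Proof. by rewrite /cmod /sqmod /= expr0n addr0 sqrtr_sqr. Qed.

Lemma cmod1 : cmod (1 : C) = 1.
Proof. by apply: CR_inj; rewrite -normCE normr1. Qed.

Lemma cmod0 : cmod (0 : C) = 0.
Proof. by apply: CR_inj; rewrite -normCE normr0. Qed.

Lemma cmod_eq0 w : (cmod w == 0) = (w == 0).
Proof.
apply/eqP/eqP => [w0|->]; last exact: cmod0.
by apply/eqP; rewrite -normr_eq0 normCE w0.
Qed.

Lemma sqmod_eq0 w : (sqmod w == 0) = (w == 0).
Proof. by rewrite -sqr_cmod expf_eq0 /= cmod_eq0. Qed.

Lemma sqmod0 : sqmod (0 : C) = 0.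
Proof. by apply/eqP; rewrite sqmod_eq0. Qed.

Lemma cmodJ w : cmod w^* = cmod w.
Proof. by rewrite /cmod /sqmod ReJ ImJ sqrrN. Qed.

Lemma sqmodM w v : sqmod (w * v) = sqmod w * sqmod v.
Proof. by rewrite -!sqr_cmod cmodM exprMn. Qed.

Lemma cmodD w v : cmod (w + v) <= cmod w + cmod v.
Proof. by rewrite -leCR CRD -!normCE ler_normD. Qed.

Lemma cmod_sum (I : Type) (r : seq I) (P : pred I) (F : I -> C) :
  cmod (\sum_(i <- r | P i) F i) <= \sum_(i <- r | P i) cmod (F i).
Proof.
elim/big_ind2: _ => [|a b c e ab ce|//]; first by rewrite cmod0.
exact: le_trans (cmodD _ _) (lerD ab ce).
Qed.

Lemma sqmodD_le w v : sqmod (w + v) <= 2 * (sqmod w + sqmod v).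
Proof.
rewrite /sqmod ReD ImD; have := sqr_ge0 (Re w - Re v); have := sqr_ge0 (Im w - Im v).
nra.
Qed.

Lemma sqmodB w v : sqmod (w - v) = sqmod w - 2 * Re (w * v^*) + sqmod v.
Proof. by rewrite /sqmod ReD ImD ReN ImN ReM ReJ ImJ; ring. Qed.

Lemma Re_le_cmod w : `|Re w| <= cmod w.
Proof. by rewrite -leCR -normCE; exact: normc_ge_Re. Qed.

Lemma Im_le_cmod w : `|Im w| <= cmod w.
Proof.
rewrite /cmod -sqrtr_sqr ler_wsqrtr// /sqmod.
by rewrite ler_wpDl ?sqr_ge0.
Qed.

Lemma mulrC_conj w : w * w^* = (sqmod w)%:C%C.
Proof.
by apply: eq_ReIm; rewrite ?ReM ?ImM ReJ ImJ /= /sqmod; ring.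
Qed.

Lemma cvg_Re (u : nat -> C) (l : C) : u @ \oo --> l ->
  (fun n => Re (u n)) @ \oo --> Re l.
Proof.
move=> /cvgrPdist_lt ul; apply/cvgrPdist_lt => e e0.
have e0' : 0 < e%:C%C :> C by rewrite ltCR.
apply: filterS (ul _ e0') => n; rewrite normCE ltCR; apply: le_lt_trans.
by rewrite -ReN -ReD; exact: Re_le_cmod.
Qed.

Lemma cvg_Im (u : nat -> C) (l : C) : u @ \oo --> l ->
  (fun n => Im (u n)) @ \oo --> Im l.
Proof.
move=> /cvgrPdist_lt ul; apply/cvgrPdist_lt => e e0.
have e0' : 0 < e%:C%C :> C by rewrite ltCR.
apply: filterS (ul _ e0') => n; rewrite normCE ltCR; apply: le_lt_trans.
by rewrite -ImN -ImD; exact: Im_le_cmod.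
Qed.

Lemma cmod_lim_le (u : nat -> C) (l : C) (b : R) : u @ \oo --> l ->
  (\forall n \near \oo, cmod (u n) <= b) -> cmod l <= b.
Proof.
move=> /cvgrPdist_lt ul ub; rewrite leNgt; apply/negP => lt_b.
have e0 : 0 < (cmod l - b)%:C%C :> C by rewrite ltCR subr_gt0.
have [n _ /(_ n (leqnn n))[]] : \forall n \near \oo, cmod (l - u n) < cmod l - b /\ cmod (u n) <= b.
  by near=> n; split; [rewrite -ltCR -normCE; near: n; exact: ul|near: n].
move=> lt1 le2; have := cmodD (l - u n) (u n); rewrite subrK.
by move=> le3; move: lt1 le2 le3; lra.
Unshelve. all: by end_near. Qed.

Section measurable.
Context d (T : measurableType d).
Implicit Types F G : T -> C.

Definition cmeasurable F : Prop :=
  measurable_fun setT (fun t => Re (F t)) /\ measurable_fun setT (fun t => Im (F t)).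

Lemma cmeasurable_cst w : cmeasurable (fun=> w).
Proof. by split; exact: measurable_cst. Qed.

Lemma cmeasurableD F G : cmeasurable F -> cmeasurable G ->
  cmeasurable (fun t => F t + G t).
Proof.
move=> [mF1 mF2] [mG1 mG2]; split.
  by under eq_fun do rewrite ReD; exact: measurable_funD.
by under eq_fun do rewrite ImD; exact: measurable_funD.
Qed.

Lemma cmeasurableM F G : cmeasurable F -> cmeasurable G ->
  cmeasurable (fun t => F t * G t).
Proof.
move=> [mF1 mF2] [mG1 mG2]; split.
  by under eq_fun do rewrite ReM; apply: measurable_funB; exact: measurable_funM.
by under eq_fun do rewrite ImM; apply: measurable_funD; exact: measurable_funM.
Qed.

Lemma cmeasurableJ F : cmeasurable F -> cmeasurable (fun t => (F t)^*).
Proof.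
move=> [mF1 mF2]; split; first by under eq_fun do rewrite ReJ.
by under eq_fun do rewrite ImJ; exact: measurable_funN.
Qed.

Lemma cmeasurableX F n : cmeasurable F -> cmeasurable (fun t => F t ^+ n).
Proof.
move=> mF; elim: n => [|n IH]; first by under eq_fun do rewrite expr0; exact: cmeasurable_cst.
by under eq_fun do rewrite exprS; exact: cmeasurableM.
Qed.

Lemma cmeasurable_sum (I : Type) (r : seq I) (F : I -> T -> C) :
  (forall i, cmeasurable (F i)) -> cmeasurable (fun t => \sum_(i <- r) F i t).
Proof.
move=> mF; elim: r => [|i r IH].
  by under eq_fun do rewrite big_nil; exact: cmeasurable_cst.
by under eq_fun do rewrite big_cons; exact: cmeasurableD.
Qed.

Lemma cmeasurable_prod (I : Type) (r : seq I) (F : I -> T -> C) :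
  (forall i, cmeasurable (F i)) -> cmeasurable (fun t => \prod_(i <- r) F i t).
Proof.
move=> mF; elim: r => [|i r IH].
  by under eq_fun do rewrite big_nil; exact: cmeasurable_cst.
by under eq_fun do rewrite big_cons; exact: cmeasurableM.
Qed.

Lemma cmeasurable_cvg (F : nat -> T -> C) G : (forall n, cmeasurable (F n)) ->
  (forall t, (fun n => F n t) @ \oo --> G t) -> cmeasurable G.
Proof.
move=> mF FG; split.
  apply: (@measurable_fun_cvg _ _ _ setT (fun n t => Re (F n t))).
    by move=> n; case: (mF n).
  by move=> t _; exact: cvg_Re.
apply: (@measurable_fun_cvg _ _ _ setT (fun n t => Im (F n t))).
  by move=> n; case: (mF n).
by move=> t _; exact: cvg_Im.
Qed.

Lemma cmeasurable_sqmod F : cmeasurable F -> measurable_fun setT (fun t => sqmod (F t)).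
Proof.
by move=> [mF1 mF2]; apply: measurable_funD; exact: measurable_funX.
Qed.

End measurable.

End complex_basics.

(** * Orthogonality of monomials on polydiscs *)

Section boxes.
Context (R : realType) (dT : measure_display) (T : measurableType dT).
Context (m : {sigma_finite_measure set T -> \bar R}).

Definition tuple_box (n : nat) (B : set T) : set (n.-tuple T) :=
  [set t | forall i, B (tnth t i)].

Lemma measurable_tuple_box n (B : set T) :
  measurable B -> measurable (@tuple_box n B).
Proof.
move=> mB; rewrite (_ : tuple_box B = \bigcap_(i in [set: 'I_n]) ((@tnth n T ^~ i) @^-1` B)).
  apply: fin_bigcap_measurable => // i _.
  by rewrite -[X in measurable X]setTI; exact: measurable_tnth.
by apply/seteqP; split => [t Bt i _|t Bt i]; [exact: Bt|exact: Bt i I].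
Qed.

Lemma prod_power_box n (B : set T) : measurable B ->
  prod_power m n (tuple_box B) = (m B ^+ n)%E.
Proof.
move=> mB; elim: n => [|n IH]; first by rewrite expe0 /= diracE mem_set// => -[].
rewrite expeS -IH /= /prod_step /pushforward.
rewrite (_ : @tcons _ _ n @^-1` tuple_box B = B `*` tuple_box B).
  by rewrite product_measure1E//; exact: measurable_tuple_box.
apply/seteqP; split => [[x t] Bt|[x t] [Bx Bt] i] /=.
  split; first by have := Bt ord0; rewrite /tcons /= tnth0.
  by move=> i; have := Bt (lift ord0 i); rewrite /tcons /= tnthS.
by case: (unliftP ord0 i) => [j ->|->]; rewrite /tcons /= ?tnthS ?tnth0.
Qed.

End boxes.

Section gaussian.
Context (R : realType) (d : nat).
Local Notation C := (Cx R).
Local Notation Cd := ('I_d -> C).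
Local Notation mR := (measurableTypeR R).
Local Notation plane := (mR * mR)%type.
Local Notation Re := (@complex.Re R).
Local Notation Im := (@complex.Im R).
Local Notation mu := (@lebesgue_Cd R d).
Local Notation zz := (@Cd_of_reals R d).
Local Notation G := (fun t => gauss_density (zz t)).
Implicit Types (m : multinom d) (t : d.-tuple plane) (w : C).

Lemma monomialE m (z : Cd) : monomial m z = \prod_i z i ^+ m i.
Proof. by []. Qed.

Lemma cmod_monomial m (z : Cd) : cmod (monomial m z) = \prod_i cmod (z i) ^+ m i.
Proof.
rewrite monomialE; apply: (big_rec2 (fun x y => cmod x = y)); first exact: cmod1.
by move=> i x y _ <-; rewrite cmodM cmodX.
Qed.

Lemma sqmod_monomial m (z : Cd) : sqmod (monomial m z) = \prod_i sqmod (z i) ^+ m i.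
Proof.
rewrite -sqr_cmod cmod_monomial -prodrXl; apply: eq_bigr => i _.
by rewrite -sqr_cmod -!exprM mulnC.
Qed.

Lemma cmod_monomial_le m (z : Cd) (r : R) : (forall i, cmod (z i) <= r) ->
  cmod (monomial m z) <= r ^+ mdeg m.
Proof.
move=> zr; rewrite cmod_monomial mdegE -prodrXr; apply: ler_prod => i _.
by rewrite exprn_ge0 ?cmod_ge0//= lerXn2r ?nnegrE ?cmod_ge0// (le_trans (cmod_ge0 _) (zr i)).
Qed.

Lemma cmeasurable_coord i : cmeasurable (fun t => zz t i).
Proof.
by split; apply: measurableT_comp (measurable_tnth _) => //.
Qed.

Lemma cmeasurable_monomial m : cmeasurable (fun t => monomial m (zz t)).
Proof.
by apply: cmeasurable_prod => i; apply: cmeasurableX; exact: cmeasurable_coord.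
Qed.

Lemma gauss_density_gt0 (z : Cd) : 0 < gauss_density z.
Proof. by rewrite mulr_gt0 ?expR_gt0// invr_gt0 exprn_gt0 ?pi_gt0. Qed.

Lemma gauss_density_le (z : Cd) : gauss_density z <= ((pi : R) ^+ d)^-1.
Proof.
rewrite /gauss_density ler_piMr ?invr_ge0 ?exprn_ge0 ?pi_ge0//.
by rewrite -expR0 ler_expR oppr_le0 sumr_ge0// => i _; exact: sqmod_ge0.
Qed.

Lemma measurable_gauss_density : measurable_fun setT G.
Proof.
apply: measurable_funM => //; apply: measurableT_comp => //.
apply: measurable_funN; apply: measurable_sum => i.
exact/cmeasurable_sqmod/cmeasurable_coord.
Qed.

Lemma cmeasurable_expands (f : Cd -> C) a : expands f a ->
  cmeasurable (fun t => f (zz t)).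
Proof.
move=> fa; apply: (@cmeasurable_cvg _ _ _
  (fun n t => \sum_(m : bmultinom d n) a m * monomial m (zz t))).
  move=> n; apply: cmeasurable_sum => m; apply: cmeasurableM.
    exact: cmeasurable_cst.
  exact: cmeasurable_monomial.
by move=> t; case: (fa (zz t)).
Qed.

Definition disc (r : R) : set plane := [set p | p.1 ^+ 2 + p.2 ^+ 2 <= r ^+ 2].

Definition polydisc (r : R) : set (d.-tuple plane) := tuple_box (disc r).

Lemma measurable_disc r : measurable (disc r).
Proof.
rewrite (_ : disc r = setT `&` (fun p : plane => p.1 ^+ 2 + p.2 ^+ 2) @^-1` `]-oo, r ^+ 2]).
  have : measurable_fun setT (fun p : plane => p.1 ^+ 2 + p.2 ^+ 2).
    by apply: measurable_funD; apply: measurable_funX.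
  by apply.
by rewrite setTI; apply/seteqP; split => p; rewrite /disc /= in_itv.
Qed.

Lemma measurable_polydisc r : measurable (polydisc r).
Proof. by apply: measurable_tuple_box; exact: measurable_disc. Qed.

Lemma square_measure (a b : R) : a <= b ->
  plane_measure (`[a, b] `*` `[a, b])%classic = ((b - a) ^+ 2)%:E.
Proof.
move=> ab; rewrite /plane_measure product_measure1E//= lebesgue_measure_itv/= lte_fin.
have [lt_ab|le_ba] := ltP a b; first by rewrite -EFinB -EFinM expr2.
by rewrite mule0 (_ : b = a) ?subrr ?expr0n//; apply/eqP; rewrite eq_le ab le_ba.
Qed.

Lemma measure_polydisc_fin r : (mu (polydisc r) < +oo)%E.
Proof.
pose B : set plane := (`[- `|r|, `|r|] `*` `[- `|r|, `|r|])%classic.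
have mB : measurable B by exact: measurableX.
have sub : polydisc r `<=` tuple_box B.
  move=> t Dt i; have := Dt i; rewrite /disc /B /= !in_itv/= -!ler_norml => Dti.
  split; rewrite -(@ler_pXn2r _ 2) ?nnegrE//.
    by rewrite !real_normK ?num_real//; apply: le_trans Dti; rewrite lerDl sqr_ge0.
  by rewrite !real_normK ?num_real//; apply: le_trans Dti; rewrite lerDr sqr_ge0.
apply: (@le_lt_trans _ _ (mu (tuple_box B))).
  by apply: le_measure; rewrite ?inE//; [exact: measurable_polydisc|exact: measurable_tuple_box].
have leNr : - `|r| <= `|r| by rewrite (le_trans _ (normr_ge0 r)) ?oppr_le0.
have BE : plane_measure B = ((`|r| - - `|r|) ^+ 2)%:E by exact: square_measure.
have -> : mu (tuple_box B) = (plane_measure B ^+ d)%E by exact: prod_power_box.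
by rewrite BE -EFin_expe ltry.
Qed.

Section bounded.
Context (r : R).
Local Notation D := (polydisc r).
Implicit Types F : d.-tuple plane -> R.

(** Integrability on the polydisc follows from its finite measure. Measurability is required on the
    whole space so that it survives composition with rotations. *)
Definition bounded_measurable F : Prop :=
  measurable_fun setT F /\ exists K, forall t, D t -> `|F t| <= K.

Lemma bounded_measurable_integrable F : bounded_measurable F ->
  mu.-integrable D (EFin \o F).
Proof.
move=> [mF [K FK]]; apply: measurable_bounded_integrable.
- exact: measurable_polydisc.
- exact: measure_polydisc_fin.
- exact: measurable_funTS.
- by exists K; split; [exact: num_real|move=> x Kx t Dt /=; exact: le_trans (FK t Dt) (ltW Kx)].
Qed.

Lemma bounded_measurableZ c F : bounded_measurable F ->
  bounded_measurable (fun t => c * F t).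
Proof.
move=> [mF [K FK]]; split; first by apply: measurable_funM.
by exists (`|c| * K) => t Dt; rewrite normrM ler_wpM2l ?FK.
Qed.

Lemma bounded_measurableB F1 F2 : bounded_measurable F1 -> bounded_measurable F2 ->
  bounded_measurable (fun t => F1 t - F2 t).
Proof.
move=> [mF1 [K1 FK1]] [mF2 [K2 FK2]]; split; first exact: measurable_funB.
by exists (K1 + K2) => t Dt; rewrite (le_trans (ler_normB _ _))// lerD ?FK1 ?FK2.
Qed.

Lemma bounded_measurable_sum (I : Type) (s : seq I) (F : I -> d.-tuple plane -> R) :
  (forall i, bounded_measurable (F i)) ->
  bounded_measurable (fun t => \sum_(i <- s) F i t).
Proof.
move=> bF; split; first by apply: measurable_sum => i; case: (bF i).
elim: s => [|i s [K IH]]; first by exists 0 => t _; rewrite big_nil normr0.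
have [_ [Ki FK]] := bF i; exists (Ki + K) => t Dt; rewrite big_cons.
by rewrite (le_trans (ler_normD _ _))// lerD ?FK ?IH.
Qed.

Lemma Rintegral_bounded_sum (I : Type) (s : seq I) (F : I -> d.-tuple plane -> R) :
  (forall i, bounded_measurable (F i)) ->
  \int[mu]_(t in D) (\sum_(i <- s) F i t) = \sum_(i <- s) \int[mu]_(t in D) F i t.
Proof.
move=> bF; elim: s => [|i s IH].
  rewrite big_nil; under eq_Rintegral do rewrite big_nil.
  by rewrite Rintegral_cst ?mul0r//; exact: measurable_polydisc.
rewrite big_cons -IH; under eq_Rintegral do rewrite big_cons.
by rewrite RintegralD//; [exact: measurable_polydisc| |];
  apply: bounded_measurable_integrable => //; exact: bounded_measurable_sum.
Qed.

End bounded.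

Definition coord_rotation (i0 : 'I_d) (w : C) (j : nat) : plane -> plane :=
  if j == i0 then rotation (Re w) (Im w) else id.

Lemma coord_rotationE i0 w t i :
  zz (tuple_map (coord_rotation i0 w) t) i = (if i == i0 then w else 1) * zz t i.
Proof.
rewrite /Cd_of_reals tnth_mktuple /coord_rotation.
rewrite -[(i : nat) == (i0 : nat)]/(i == i0); case: (i == i0).
  apply: eq_ReIm; rewrite ?ReM ?ImM /=; first by [].
  by rewrite addrC.
by rewrite mul1r.
Qed.

End gaussian.

(** * Rotation invariance and Fourier coefficients on a polydisc *)

Section bessel.
Context (R : realType) (d : nat).
Local Notation C := (Cx R).
Local Notation Cd := ('I_d -> C).
Local Notation mR := (measurableTypeR R).
Local Notation plane := (mR * mR)%type.
Local Notation Re := (@complex.Re R).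
Local Notation Im := (@complex.Im R).
Local Notation mu := (@lebesgue_Cd R d).
Local Notation zz := (@Cd_of_reals R d).
Local Notation G := (fun t => gauss_density (zz t)).
Implicit Types (m : multinom d) (t : d.-tuple plane) (w : C) (r : R) (i : 'I_d).

Lemma coord_rotation_preserving i0 w : cmod w = 1 ->
  measure_preserving mu (tuple_map (@coord_rotation R d i0 w)).
Proof.
move=> w1; apply: tuple_map_preserving => i; rewrite /coord_rotation.
case: ifP => _; last exact: measure_preserving_id.
by apply: rotation_preserving; rewrite -[LHS]/(sqmod w) -sqr_cmod w1 expr1n.
Qed.

Lemma polydiscE r t : polydisc r t <-> forall i, sqmod (zz t i) <= r ^+ 2.
Proof. by []. Qed.

Lemma polydisc_cmod r t i : 0 <= r -> polydisc r t -> cmod (zz t i) <= r.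
Proof.
move=> r0 /polydiscE/(_ i); rewrite -sqr_cmod ler_pXn2r// nnegrE//.
exact: cmod_ge0.
Qed.

Lemma sqmod_rotation i0 w t i : cmod w = 1 ->
  sqmod (zz (tuple_map (coord_rotation i0 w) t) i) = sqmod (zz t i).
Proof.
move=> w1; rewrite coord_rotationE sqmodM; case: ifP => _.
  by rewrite -sqr_cmod w1 expr1n mul1r.
by rewrite -sqr_cmod cmod1 expr1n mul1r.
Qed.

Lemma polydisc_rotation i0 w r : cmod w = 1 ->
  (tuple_map (coord_rotation i0 w) : d.-tuple plane -> _) @^-1` polydisc r =
  polydisc r.
Proof.
move=> w1; apply/seteqP; split => t /polydiscE Dt; apply/polydiscE => i.
  by rewrite -(sqmod_rotation i0 t i w1); exact: Dt.
by rewrite sqmod_rotation.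
Qed.

Lemma gauss_density_rotation i0 w t : cmod w = 1 ->
  G (tuple_map (coord_rotation i0 w) t) = G t.
Proof.
move=> w1; rewrite /gauss_density; congr (_ * expR (- _)).
by apply: eq_bigr => i _; exact: sqmod_rotation.
Qed.

Lemma Rintegral_rotation i0 w r (F : d.-tuple plane -> R) : cmod w = 1 ->
  bounded_measurable r F ->
  \int[mu]_(t in polydisc r) F (tuple_map (coord_rotation i0 w) t) =
  \int[mu]_(t in polydisc r) F t.
Proof.
move=> w1 bF; have [mphi phiE] := coord_rotation_preserving i0 w1.
set phi := tuple_map (coord_rotation i0 w) in mphi phiE *.
have phiD := polydisc_rotation i0 r w1; rewrite -/phi in phiD.
have mD := @measurable_polydisc R d r.
have bFphi : bounded_measurable r (F \o phi).
  case: bF => mF [K FK]; split; first exact: measurableT_comp.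
  by exists K => t Dt; apply: FK; have : (phi @^-1` polydisc r) t by rewrite phiD.
rewrite /Rintegral; congr fine.
transitivity (\int[pushforward mu phi]_(t in polydisc r) (EFin \o F) t)%E.
  rewrite (integral_pushforward mphi).
  - by rewrite phiD.
  - by case: bF => mF _; exact/measurable_EFinP.
  - by rewrite phiD; exact: bounded_measurable_integrable.
  - exact: mD.
by apply: eq_measure_integral => A mA _; exact: phiE.
Qed.

(** Only real parts are integrated; the free factor [w] absorbs Taylor coefficients and lets real
    integrals account for complex ones. *)
Definition gauss_term w m m' t : R :=
  Re (w * (monomial m (zz t) * (monomial m' (zz t))^* )) * G t.

Lemma bounded_measurable_gauss r (F : d.-tuple plane -> C) K :
  cmeasurable F -> (forall t, polydisc r t -> cmod (F t) <= K) ->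
  bounded_measurable r (fun t => Re (F t) * G t).
Proof.
move=> [mF _] FK; split.
  by apply: measurable_funM => //; exact: measurable_gauss_density.
exists (K * (pi ^+ d)^-1) => t Dt; rewrite normrM ler_pM//.
  exact: le_trans (Re_le_cmod _) (FK t Dt).
by rewrite ger0_norm ?gauss_density_le// ltW// gauss_density_gt0.
Qed.

Lemma bounded_measurable_gauss_term r w m m' : 0 <= r ->
  bounded_measurable r (gauss_term w m m').
Proof.
move=> r0; apply: (@bounded_measurable_gauss _ _ (cmod w * (r ^+ mdeg m * r ^+ mdeg m'))).
  apply: cmeasurableM; first exact: cmeasurable_cst.
  by apply: cmeasurableM; [|apply: cmeasurableJ]; exact: cmeasurable_monomial.
move=> t Dt; rewrite !cmodM cmodJ ler_wpM2l ?cmod_ge0//.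
by rewrite ler_pM ?cmod_ge0//; apply: cmod_monomial_le => i; exact: polydisc_cmod.
Qed.

Lemma exists_unit_root k : (0 < k)%N -> exists w, cmod w = 1 /\ w ^+ k = -1.
Proof.
move=> k0; have wk : (k.-root (-1) : C) ^+ k = -1 by rewrite rootCK.
exists (k.-root (-1)); split=> //; apply: CR_inj; rewrite -normCE.
apply/eqP; rewrite -(@pexpr_eq1 _ _ k)// -normrX wk normrN1; exact/eqP.
Qed.

Lemma monomial_rotation i0 w m t :
  monomial m (zz (tuple_map (coord_rotation i0 w) t)) = w ^+ m i0 * monomial m (zz t).
Proof.
rewrite !monomialE (bigD1 i0)//= [in RHS](bigD1 i0)//= coord_rotationE eqxx exprMn -mulrA.
do 2 congr (_ * _); apply: eq_bigr => i /negPf ni.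
by rewrite coord_rotationE ni mul1r.
Qed.

(* Rotating a coordinate in which the two exponents differ, by an angle chosen so
   that the integrand changes sign. *)
Lemma gauss_term_orthogonal r w m m' : 0 <= r -> m != m' ->
  \int[mu]_(t in polydisc r) gauss_term w m m' t = 0.
Proof.
move=> r0 ne.
have [i0 nei] : exists i, m i != m' i.
  apply: contrapT => /forallNP e; move: ne => /eqP; apply; apply/mnmP => i.
  by apply/eqP; apply: contrapT => /negP; exact: e.
(* On the unit circle conjugation inverts, so it is enough that the power of [u] by the difference
   of the two exponents, taken positive, be -1. *)
have [u [u1 uE]] : exists u : C, cmod u = 1 /\ u ^+ m i0 * (u ^+ m' i0)^* = -1.
  have uJ (v : C) n : cmod v = 1 -> v ^+ n * (v ^+ n)^* = 1.
    by move=> v1; rewrite mulrC_conj -sqr_cmod cmodX v1 !expr1n.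
  move: nei; rewrite neq_ltn => /orP[lt_m|lt_m].
    have [u [u1 uk]] := exists_unit_root (etrans (subn_gt0 _ _) lt_m).
    exists u; split=> //; rewrite -[m' i0](subnK (ltnW lt_m)) exprD uk rmorphM rmorphN1.
    by rewrite mulN1r mulrN uJ.
  have [u [u1 uk]] := exists_unit_root (etrans (subn_gt0 _ _) lt_m).
  exists u; split=> //; rewrite -[m i0](subnK (ltnW lt_m)) exprD uk -mulrA uJ// mulr1//.
have bt := bounded_measurable_gauss_term w m m' r0.
have := Rintegral_rotation i0 u1 bt.
under eq_Rintegral => t _.
  rewrite /gauss_term (gauss_density_rotation _ _ u1) !monomial_rotation rmorphM /=.
  rewrite mulrACA uE mulN1r mulrN ReN mulNr -mulN1r -/(gauss_term w m m' t); over.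
rewrite RintegralZl; [|exact: measurable_polydisc|exact: bounded_measurable_integrable].
by move=> /eqP; rewrite mulN1r eq_sym -subr_eq0 opprK -mulr2n mulrn_eq0 /= => /eqP.
Qed.

Definition gauss_norm r m : R :=
  \int[mu]_(t in polydisc r) (sqmod (monomial m (zz t)) * G t).

Lemma bounded_measurable_sqmod r (F : d.-tuple plane -> C) K :
  cmeasurable F -> (forall t, polydisc r t -> cmod (F t) <= K) ->
  bounded_measurable r (fun t => sqmod (F t) * G t).
Proof.
move=> mF FK; have [||mS [K' SK]] := @bounded_measurable_gauss r (fun t => F t * (F t)^* ) (K * K).
- by apply: cmeasurableM => //; exact: cmeasurableJ.
- by move=> t Dt; rewrite cmodM cmodJ ler_pM ?cmod_ge0// FK.
have E t : Re (F t * (F t)^* ) * G t = sqmod (F t) * G t by rewrite mulrC_conj.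
split; first by under eq_fun do rewrite -E.
by exists K' => t Dt; rewrite -E; exact: SK.
Qed.

Lemma gauss_term_diagonal r w m : 0 <= r ->
  \int[mu]_(t in polydisc r) gauss_term w m m t = Re w * gauss_norm r m.
Proof.
move=> r0; rewrite -RintegralZl; [|exact: measurable_polydisc|].
  apply: eq_Rintegral => t _; rewrite /gauss_term mulrC_conj ReM /=.
  by rewrite mulr0 subr0 mulrA.
apply: bounded_measurable_integrable.
apply: (@bounded_measurable_sqmod _ _ (r ^+ mdeg m)); first exact: cmeasurable_monomial.
by move=> t Dt; apply: cmod_monomial_le => i; exact: polydisc_cmod.
Qed.

Definition partial_sum (a : multinom d -> C) (n : nat) (z : Cd) : C :=
  \sum_(m : bmultinom d n) a m * monomial m z.

(** Absolute convergence at the single point with all coordinates equal to [r] bounds the partial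
    sums on the whole polydisc. *)
Lemma partial_sum_bounded (f : Cd -> C) a r : 0 <= r -> expands f a ->
  exists K, forall t, polydisc r t ->
    cmod (f (zz t)) <= K /\ forall n, cmod (partial_sum a n (zz t)) <= K.
Proof.
move=> r0 fa; have [[M MP] _] := fa (fun=> r%:C%C).
have M_ge0 : 0 <= M.
  apply: le_trans (MP 0%N); exact: sumr_ge0.
have MR : M = (Re M)%:C%C.
  by apply: eq_ReIm => //=; exact: (@ger0_Im R).
exists (Re M) => t Dt.
have bound n : cmod (partial_sum a n (zz t)) <= Re M.
  rewrite -leCR -MR; apply: le_trans (MP n).
  rewrite /partial_sum -normCE; apply: le_trans (ler_norm_sum _ _ _) _.
  apply: ler_sum => m _; rewrite [leLHS]normrM [leRHS]normrM.
  apply: ler_wpM2l; first exact: normr_ge0.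
  rewrite [leLHS]normCE [leRHS]normCE leCR.
  apply: (le_trans (@cmod_monomial_le _ _ m _ r _)); first by move=> i; exact: polydisc_cmod.
  rewrite cmod_monomial mdegE -prodrXr; apply: ler_prod => i _.
  by rewrite cmodR ger0_norm// exprn_ge0//=.
split; last exact: bound.
have [_ cvgf] := fa (zz t); apply: (cmod_lim_le cvgf).
by near=> n; exact: bound.
Unshelve. all: by end_near. Qed.

(** For partial sums with [n > mdeg m], orthogonality leaves only the term of index [m]. Dominated
    convergence, with the uniform bound on the polydisc, passes to [f]. *)
Lemma fourier_coefficient (f : Cd -> C) a r w m : 0 <= r -> expands f a ->
  \int[mu]_(t in polydisc r) (Re (w * (f (zz t) * (monomial m (zz t))^* )) * G t) =
  Re (w * a m) * gauss_norm r m.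
Proof.
move=> r0 fa; have [K KP] := partial_sum_bounded r0 fa.
have mf := cmeasurable_expands fa.
have mD := @measurable_polydisc R d r.
have mJ : cmeasurable (fun t => (monomial m (zz t))^*).
  by apply: cmeasurableJ; exact: cmeasurable_monomial.
pose g n t := Re (w * (partial_sum a n (zz t) * (monomial m (zz t))^* )) * G t.
have mps n : cmeasurable (fun t => partial_sum a n (zz t)).
  apply: cmeasurable_sum => m'; apply: cmeasurableM; first exact: cmeasurable_cst.
  exact: cmeasurable_monomial.
have bound (v : C) t : polydisc r t -> cmod v <= K ->
    cmod (w * (v * (monomial m (zz t))^* )) <= cmod w * (K * r ^+ mdeg m).
  move=> Dt vK; rewrite !cmodM cmodJ ler_wpM2l ?cmod_ge0// ler_pM ?cmod_ge0//.
  by apply: cmod_monomial_le => i; exact: polydisc_cmod.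
have bg n : bounded_measurable r (g n).
  apply: bounded_measurable_gauss => [|t Dt]; last first.
    by apply: bound => //; case: (KP t Dt).
  by apply: cmeasurableM; [exact: cmeasurable_cst|exact: cmeasurableM].
have intg n : (mdeg m < n)%N -> \int[mu]_(t in polydisc r) g n t = Re (w * a m) * gauss_norm r m.
  move=> lt_n.
  transitivity (\int[mu]_(t in polydisc r)
      \sum_(m' : bmultinom d n) gauss_term (w * a m') m' m t).
    apply: eq_Rintegral => t _; rewrite /g /partial_sum mulr_suml mulr_sumr Re_sum mulr_suml.
    by apply: eq_bigr => m' _; rewrite /gauss_term !mulrA.
  rewrite Rintegral_bounded_sum; last by move=> m'; exact: bounded_measurable_gauss_term.
  rewrite (bigD1 (BMultinom lt_n))//= gauss_term_diagonal// big1 ?addr0// => m' ne.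
  by apply: gauss_term_orthogonal => //; apply: contra ne => /eqP e; apply/eqP/val_inj.
pose F t := Re (w * (f (zz t) * (monomial m (zz t))^* )) * G t.
have mF : measurable_fun setT F.
  apply: measurable_funM; last exact: measurable_gauss_density.
  have [] : cmeasurable (fun t => w * (f (zz t) * (monomial m (zz t))^* )) => //.
  by apply: cmeasurableM; [exact: cmeasurable_cst|exact: cmeasurableM].
have gF t : (fun n => g n t) @ \oo --> F t.
  apply: cvgMl; rewrite /=; apply: cvg_Re; apply: cvgMr; apply: cvgMl.
  by case: (fa (zz t)).
pose B : R := cmod w * (K * r ^+ mdeg m) * (pi ^+ d)^-1.
have gB n t : polydisc r t -> `|g n t| <= B.
  move=> Dt; rewrite normrM ler_pM//.
    by apply: le_trans (Re_le_cmod _) _; apply: bound => //; case: (KP t Dt).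
  by rewrite ger0_norm ?gauss_density_le// ltW// gauss_density_gt0.
have [_ _ cvgI] : [/\ mu.-integrable (polydisc r) (EFin \o F),
    [sequence \int[mu]_(t in polydisc r) `|(g n t)%:E - (F t)%:E|]_n @ \oo --> 0 &
    [sequence \int[mu]_(t in polydisc r) (g n t)%:E]_n @ \oo -->
      \int[mu]_(t in polydisc r) (F t)%:E]%E.
  apply: (@dominated_convergence _ _ _ mu (polydisc r) mD _ _ (fun=> B%:E)).
  - by move=> n; apply/measurable_EFinP; apply: measurable_funTS; case: (bg n).
  - by apply/measurable_EFinP; exact: measurable_funTS.
  - by apply: aeW => t Dt; apply: cvg_EFin; [exact: nearW|exact: gF].
  - apply: bounded_measurable_integrable; split; first exact: measurable_cst.
    by exists `|B| => t _.
  - by apply: aeW => t n Dt; rewrite lee_fin gB.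
have : [sequence (\int[mu]_(t in polydisc r) (g n t)%:E)%E]_n @ \oo -->
    (Re (w * a m) * gauss_norm r m)%:E.
  apply: cvg_near_cst; near=> n; rewrite -(intg n); last by near: n; exact: nbhs_infty_gt.
  by rewrite /Rintegral fineK//; apply: integrable_fin_num => //; exact: bounded_measurable_integrable.
by move=> /(cvg_unique _ cvgI) FE; rewrite /Rintegral FE.
Unshelve. all: by end_near. Qed.

End bessel.

(** * The Fock space *)

Section taylor_coefficients.
Context (R : realType) (d : nat).
Local Notation C := (Cx R).
Local Notation Cd := ('I_d -> C).
Local Notation mR := (measurableTypeR R).
Local Notation plane := (mR * mR)%type.
Local Notation Re := (@complex.Re R).
Local Notation Im := (@complex.Im R).
Local Notation mu := (@lebesgue_Cd R d).
Local Notation zz := (@Cd_of_reals R d).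
Local Notation G := (fun t => gauss_density (zz t)).
Implicit Types (m : multinom d) (t : d.-tuple plane) (w : C) (r : R) (i : 'I_d).
Implicit Types (f g : Cd -> C) (a b : multinom d -> C) (z : Cd).

Lemma measurable_fock_integrand f a : expands f a ->
  measurable_fun setT (fun t => (sqmod (f (zz t)) * G t)%:E).
Proof.
move=> fa; apply/measurable_EFinP; apply: measurable_funM.
  exact: cmeasurable_sqmod (cmeasurable_expands fa).
exact: measurable_gauss_density.
Qed.

Lemma fock_integrand_ge0 f t : (0 <= (sqmod (f (zz t)) * G t)%:E)%E.
Proof. by rewrite lee_fin mulr_ge0 ?sqmod_ge0// ltW// gauss_density_gt0. Qed.

(** Expand the nonnegative integral of [sqmod (f - a m * monomial m)] over the polydisc: the cross
    term is twice the square term by [fourier_coefficient]. The polydisc integral of [f] is at most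
    the full one. *)
Lemma bessel f a r m : 0 <= r -> expands f a ->
  ((sqmod (a m) * gauss_norm r m)%:E <= fock_sqnorm f)%E.
Proof.
move=> r0 fa; have mD := @measurable_polydisc R d r.
have mf := cmeasurable_expands fa.
have [K KP] := partial_sum_bounded r0 fa.
have bf : bounded_measurable r (fun t => sqmod (f (zz t)) * G t).
  by apply: (@bounded_measurable_sqmod _ _ _ _ K) => // t /KP[].
have mon_le t : polydisc r t -> cmod (monomial m (zz t)) <= r ^+ mdeg m.
  by move=> Dt; apply: cmod_monomial_le => i; exact: polydisc_cmod.
have bm : bounded_measurable r (fun t => sqmod (monomial m (zz t)) * G t).
  by apply: (@bounded_measurable_sqmod _ _ _ _ (r ^+ mdeg m)) => //; exact: cmeasurable_monomial.
have bfm : bounded_measurable r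
    (fun t => Re ((a m)^* * (f (zz t) * (monomial m (zz t))^* )) * G t).
  apply: (@bounded_measurable_gauss _ _ _ _ (cmod (a m) * (K * r ^+ mdeg m))).
    apply: cmeasurableM; first exact: cmeasurable_cst.
    by apply: cmeasurableM => //; apply: cmeasurableJ; exact: cmeasurable_monomial.
  move=> t Dt; rewrite !cmodM !cmodJ ler_wpM2l ?cmod_ge0// ler_pM ?cmod_ge0 ?mon_le//.
  by case: (KP t Dt).
pose If := \int[mu]_(t in polydisc r) (sqmod (f (zz t)) * G t).
have le_If : (If%:E <= fock_sqnorm f)%E.
  rewrite /If /Rintegral fineK; last first.
    by apply: integrable_fin_num => //; exact: (bounded_measurable_integrable bf).
  apply: ge0_subset_integral => //; first exact: measurable_fock_integrand fa.
  by move=> t _; exact: fock_integrand_ge0.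
apply: le_trans le_If; rewrite lee_fin.
have : 0 <= \int[mu]_(t in polydisc r)
    (sqmod (f (zz t)) * G t
     - 2 * (Re ((a m)^* * (f (zz t) * (monomial m (zz t))^* )) * G t)
     + sqmod (a m) * (sqmod (monomial m (zz t)) * G t)).
  apply: Rintegral_ge0 => t _.
  have -> : sqmod (f (zz t)) * G t
     - 2 * (Re ((a m)^* * (f (zz t) * (monomial m (zz t))^* )) * G t)
     + sqmod (a m) * (sqmod (monomial m (zz t)) * G t) =
     sqmod (f (zz t) - a m * monomial m (zz t)) * G t.
    have e : f (zz t) * (a m * monomial m (zz t))^* =
        (a m)^* * (f (zz t) * (monomial m (zz t))^* ) by rewrite rmorphM mulrCA.
    by rewrite sqmodB e sqmodM; ring.
  by rewrite mulr_ge0 ?sqmod_ge0// ltW// gauss_density_gt0.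
have If1 := bounded_measurable_integrable bf.
have If2 := bounded_measurable_integrable bfm.
have If3 := bounded_measurable_integrable bm.
have bfm' := bounded_measurableZ 2 bfm.
have bm' := bounded_measurableZ (sqmod (a m)) bm.
have If12 := bounded_measurable_integrable (bounded_measurableB bf bfm').
have If2' := bounded_measurable_integrable bfm'.
have If3' := bounded_measurable_integrable bm'.
rewrite RintegralD// RintegralB// !RintegralZl// (fourier_coefficient _ _ r0 fa).
rewrite [_^* * _]mulrC mulrC_conj /= -/(gauss_norm r m) -/If.
set x := sqmod (a m) * gauss_norm r m; lra.
Qed.

(** Integrate only over the product of the unit squares [[s, s + 1]^2]. There each coordinate has
    modulus at least [s], the density is bounded below independently of [m], and the measure is 1.
    The radius [2 * (s + 1)] is large enough to contain the box. *)
Lemma gauss_norm_ge (s : R) : 0 <= s -> exists2 K : R, 0 < K &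
  forall m, s ^+ (2 * mdeg m) * K <= gauss_norm (2 * (s + 1)) m.
Proof.
move=> s0; pose r := 2 * (s + 1); pose B : set plane := (`[s, s + 1] `*` `[s, s + 1])%classic.
pose K : R := (pi ^+ d)^-1 * expR (- \sum_(i < d) (2 * (s + 1) ^+ 2)).
have K0 : 0 < K by rewrite mulr_gt0 ?expR_gt0// invr_gt0 exprn_gt0 ?pi_gt0.
have r0 : 0 <= r by rewrite mulr_ge0// addr_ge0.
exists K => // m; have mD := @measurable_polydisc R d r.
have mB : measurable B by exact: measurableX.
have mtB : measurable (@tuple_box _ _ d B) by exact: measurable_tuple_box.
have Bs (p : plane) : B p -> s ^+ 2 <= p.1 ^+ 2 + p.2 ^+ 2 /\
    p.1 ^+ 2 + p.2 ^+ 2 <= 2 * (s + 1) ^+ 2.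
  rewrite /B /= !in_itv/= => -[/andP[h1 h2] /andP[h3 h4]]; split; nra.
have sub : @tuple_box _ _ d B `<=` polydisc r.
  by move=> t Bt i; have [_] := Bs _ (Bt i); rewrite /disc /= /r => h; nra.
have mu1 : mu (@tuple_box _ _ d B) = 1%E.
  have BE : plane_measure B = ((s + 1 - s) ^+ 2)%:E by apply: square_measure; rewrite lerDl.
  have -> : mu (tuple_box B) = (plane_measure B ^+ d)%E by exact: prod_power_box.
  by rewrite BE addrAC subrr add0r expr1n -EFin_expe expr1n.
have bF : bounded_measurable r (fun t => sqmod (monomial m (zz t)) * G t).
  apply: (@bounded_measurable_sqmod _ _ _ _ (r ^+ mdeg m)); first exact: cmeasurable_monomial.
  by move=> t Dt; apply: cmod_monomial_le => i; exact: polydisc_cmod.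
rewrite -/r -lee_fin /gauss_norm /Rintegral fineK; last first.
  by apply: integrable_fin_num => //; exact: (bounded_measurable_integrable bF).
have mF : measurable_fun setT (fun t => (sqmod (monomial m (zz t)) * G t)%:E).
  by apply/measurable_EFinP; case: bF.
apply: (@le_trans _ _ (\int[mu]_(t in tuple_box B) (sqmod (monomial m (zz t)) * G t)%:E)%E); last first.
  apply: ge0_subset_integral => //; first exact: measurable_funTS.
  by move=> t _; rewrite lee_fin mulr_ge0 ?sqmod_ge0// ltW// gauss_density_gt0.
rewrite -[leLHS]mule1 -mu1 -integral_cst//; apply: ge0_le_integral => //.
- by move=> t _; rewrite lee_fin mulr_ge0// ?exprn_ge0// ltW.
- exact: measurable_funTS.
move=> t Bt; rewrite lee_fin ler_pM ?exprn_ge0 ?(ltW K0)//.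
  rewrite sqmod_monomial mulnC mdegE big_distrl /= -prodrXr; apply: ler_prod => i _.
  rewrite exprn_ge0//= mulnC exprM lerXn2r ?nnegrE ?sqr_ge0 ?sqmod_ge0//.
  by have [] := Bs _ (Bt i).
rewrite /K /gauss_density ler_wpM2l ?invr_ge0 ?exprn_ge0 ?pi_ge0// ler_expR lerN2.
by apply: ler_sum => i _; have [] := Bs _ (Bt i).
Qed.

(** Bessel's inequality divided by the lower bound on the weight. The freedom in [s] later outweighs
    both the size of a point and the norms of the operators. *)
Lemma coefficient_bound (s : R) : 0 < s -> exists2 K : R, 0 < K &
  forall f a m, expands f a -> (fock_sqnorm f < +oo)%E ->
    cmod (a m) <= K * Num.sqrt (fine (fock_sqnorm f)) * s^-1 ^+ mdeg m.
Proof.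
move=> s0; have [K K0 KP] := gauss_norm_ge (ltW s0).
exists (Num.sqrt K)^-1 => [|f a m fa fin_f]; first by rewrite invr_gt0 sqrtr_gt0.
have f0 : (0 <= fock_sqnorm f)%E by apply: integral_ge0 => t _; exact: fock_integrand_ge0.
have fE : fock_sqnorm f = (fine (fock_sqnorm f))%:E by rewrite fineK// ge0_fin_numE.
set N := fine _ in fE *.
have : sqmod (a m) * (s ^+ (2 * mdeg m) * K) <= N.
  rewrite -lee_fin -fE; apply: le_trans (bessel m _ fa); last first.
    by apply: (_ : 0 <= 2 * (s + 1)); rewrite mulr_ge0// addr_ge0// ltW.
  by rewrite lee_fin ler_wpM2l ?sqmod_ge0.
have sm0 : 0 < s ^+ mdeg m by rewrite exprn_gt0.
rewrite exprVn ler_pdivlMr// ler_pdivlMl ?sqrtr_gt0// => le_N.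
have lhs0 : 0 <= Num.sqrt K * (cmod (a m) * s ^+ mdeg m).
  by rewrite mulr_ge0 ?sqrtr_ge0// mulr_ge0 ?cmod_ge0// ltW.
rewrite -(@ger0_norm _ (_ * (_ * _)))// -sqrtr_sqr ler_wsqrtr//.
by rewrite !exprMn sqr_sqrtr ?(ltW K0)// sqr_cmod -exprM mulnC; lra.
Qed.

End taylor_coefficients.

(** * Sums over exponents of bounded degree *)

Section multinomial_sums.
Context (d : nat).
Implicit Types m : multinom d.

Lemma sum_bmultinom_widen (V : nmodType) (F : multinom d -> V) n n' : (n <= n')%N ->
  \sum_(m : bmultinom d n' | (mdeg m < n)%N) F m = \sum_(m : bmultinom d n) F m.
Proof.
move=> le_n; pose h (m : bmultinom d n) : bmultinom d n' :=
  BMultinom (leq_trans (bmdeg m) le_n).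
rewrite (reindex_omap h (fun k : bmultinom d n' => insub (bmnm k))) /=; last first.
  by move=> m lt_m; rewrite insubT /=; congr Some; exact: val_inj.
apply: eq_bigl => m; rewrite bmdeg /= insubT ?bmdeg// => p; apply/eqP; congr Some.
exact: val_inj.
Qed.

Lemma sum_bmultinomB (V : zmodType) (F : multinom d -> V) n n' : (n <= n')%N ->
  \sum_(m : bmultinom d n') F m - \sum_(m : bmultinom d n) F m =
  \sum_(m : bmultinom d n' | (n <= mdeg m)%N) F m.
Proof.
move=> le_n; rewrite (bigID (fun m : bmultinom d n' => (mdeg m < n)%N))/=.
rewrite sum_bmultinom_widen// addrC addrK; apply: eq_bigl => m.
by rewrite -leqNgt.
Qed.

(** Exponents of degree less than [n] embed into a cube, over which the sum is a product of [d]
    geometric sums, each at most 2. The bound does not depend on [n]. *)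
Lemma geometric_bmultinom_sum (R : realFieldType) n :
  \sum_(m : bmultinom d n) (2^-1 : R) ^+ mdeg m <= 2 ^+ d.
Proof.
have geo k : \sum_(i < k) (2^-1 : R) ^+ i <= 2.
  have -> : \sum_(i < k) (2^-1 : R) ^+ i = 2 - 2 * 2^-1 ^+ k.
    elim: k => [|k IH]; first by rewrite big_ord0 expr0 mulr1 subrr.
    by rewrite big_ord_recr /= IH exprS; field.
  by rewrite lerBlDr lerDl mulr_ge0// exprn_ge0.
apply: (@le_trans _ _ (\prod_(i < d) \sum_(k < n) (2^-1 : R) ^+ k)); last first.
  rewrite -[X in _ <= 2 ^+ X]card_ord -prodr_const; apply: ler_prod => i _.
  by rewrite geo sumr_ge0// => k _; rewrite exprn_ge0.
rewrite bigA_distr_bigA /=.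
have lt_mn (m : bmultinom d n) i : (m i < n)%N.
  by apply: leq_ltn_trans (bmdeg m); rewrite mdegE (bigD1 i)//= leq_addr.
pose h (m : bmultinom d n) : {ffun 'I_d -> 'I_n} := [ffun i => Ordinal (lt_mn m i)].
have injh : injective h.
  move=> m1 m2 /ffunP e; apply/val_inj/mnmP => i.
  by have := congr1 val (e i); rewrite !ffunE.
rewrite (bigID (fun f => f \in codom h))/= -[leLHS]addr0 lerD//; last first.
  by apply: sumr_ge0 => f _; apply: prodr_ge0 => i _; rewrite exprn_ge0.
rewrite -(big_uniq _ (_ : uniq (codom h))) /=; last exact/injectiveP.
rewrite big_image /= le_eqVlt; apply/orP; left; apply/eqP.
by apply: eq_bigr => m _; rewrite mdegE -prodrXr; apply: eq_bigr => i _; rewrite ffunE.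
Qed.

End multinomial_sums.

(** * Uniqueness of expansions and continuity of point evaluations *)

Section fock_functions.
Context (R : realType) (d : nat).
Local Notation C := (Cx R).
Local Notation Cd := ('I_d -> C).
Implicit Types (m : multinom d) (w : C) (r : R) (i : 'I_d).
Implicit Types (f g : Cd -> C) (a b : multinom d -> C) (z : Cd) (p : mpoly d C).

Lemma expandsD f g a b : expands f a -> expands g b ->
  expands (fun z => f z + g z) (fun m => a m + b m).
Proof.
move=> fa gb z; have [[M MP] cf] := fa z; have [[N NP] cg] := gb z; split.
  exists (M + N) => n; apply: le_trans (lerD (MP n) (NP n)).
  by rewrite -big_split; apply: ler_sum => m _; rewrite mulrDl ler_normD.
have -> : (fun n => \sum_(m : bmultinom d n) (a m + b m) * monomial m z) =
    (fun n => \sum_(m : bmultinom d n) a m * monomial m z) \+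
    (fun n => \sum_(m : bmultinom d n) b m * monomial m z).
  by apply/funext => n /=; rewrite -big_split; apply: eq_bigr => m _; rewrite mulrDl.
exact: cvgD cf cg.
Qed.

Lemma expandsZ f a w : expands f a -> expands (fun z => w * f z) (fun m => w * a m).
Proof.
move=> fa z; have [[M MP] cf] := fa z; split.
  exists (`|w| * M) => n; apply: le_trans (ler_wpM2l (normr_ge0 w) (MP n)).
  by rewrite mulr_sumr; apply: ler_sum => m _; rewrite -mulrA [leLHS]normrM.
have -> : (fun n => \sum_(m : bmultinom d n) w * a m * monomial m z) =
    (fun n => w * \sum_(m : bmultinom d n) a m * monomial m z).
  by apply/funext => n; rewrite mulr_sumr; apply: eq_bigr => m _; rewrite mulrA.
exact: cvgMr cf.
Qed.

Lemma fock_sqnorm0 : fock_sqnorm ((fun=> 0) : Cd -> C) = 0%E.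
Proof.
rewrite /fock_sqnorm; under eq_integral do rewrite sqmod0 mul0r.
exact: integral0.
Qed.

(** The zero function has norm zero, so the coefficient bound kills every coefficient; uniqueness of
    Taylor coefficients follows by linearity. *)
Lemma expands0_inj a : expands (fun=> 0) a -> a = (fun=> 0).
Proof.
move=> a0; apply/funext => m; apply/eqP; rewrite -cmod_eq0 eq_le cmod_ge0 andbT.
have [K _ KP] := @coefficient_bound R d 1 ltr01.
have := KP _ _ m a0; rewrite fock_sqnorm0 ltry sqrtr0 mulr0 mul0r.
by apply.
Qed.

Lemma expands_inj f a b : expands f a -> expands f b -> a = b.
Proof.
move=> fa fb; have : expands (fun=> 0) (fun m => a m + (-1) * b m).
  have <- : (fun z => f z + (-1) * f z) = (fun=> 0).
    by apply/funext => z; rewrite mulN1r subrr.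
  exact: (expandsD fa (expandsZ (-1) fb)).
move=> /expands0_inj ab; apply/funext => m; apply/eqP; rewrite -subr_eq0 -mulN1r.
by rewrite (congr1 (fun c => c m) ab).
Qed.

Lemma expands_taylor f : entire f -> expands f (taylor f).
Proof. by move=> [a fa]; rewrite /taylor; exact: (xgetI _ fa). Qed.

Lemma taylorE f a : expands f a -> taylor f = a.
Proof. by move=> fa; apply: expands_inj (fa); apply: expands_taylor; exists a. Qed.

Lemma fock_expands f : fock f -> expands f (taylor f).
Proof. by move=> [/expands_taylor]. Qed.

Definition fnorm f : R := Num.sqrt (fine (fock_sqnorm f)).

Lemma fnorm_ge0 f : 0 <= fnorm f. Proof. exact: sqrtr_ge0. Qed.

Lemma fock_sqnorm_ge0 f : (0 <= fock_sqnorm f)%E.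
Proof. by apply: integral_ge0 => t _; exact: fock_integrand_ge0. Qed.

Lemma fock_sqnormE f : (fock_sqnorm f < +oo)%E -> fock_sqnorm f = (fnorm f ^+ 2)%:E.
Proof.
move=> fin_f; rewrite sqr_sqrtr ?fine_ge0 ?fock_sqnorm_ge0//.
by rewrite fineK// ge0_fin_numE// fock_sqnorm_ge0.
Qed.

Lemma fock_coefficient_decay (s : R) : 0 < s -> exists2 K : R, 0 < K &
  forall f m, fock f -> cmod (taylor f m) <= K * fnorm f * s^-1 ^+ mdeg m.
Proof.
move=> s0; have [K K0 KP] := @coefficient_bound R d s s0; exists K => // f m Ff.
by apply: KP; [exact: fock_expands|case: Ff].
Qed.

Lemma fnorm_eq0 f : fock f -> fnorm f = 0 -> f = (fun=> 0).
Proof.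
move=> Ff f0; have [K _ KP] := fock_coefficient_decay ltr01.
have a0 m : taylor f m = 0.
  apply/eqP; rewrite -cmod_eq0 eq_le cmod_ge0 andbT.
  by have := KP f m Ff; rewrite f0 mulr0 mul0r.
apply/funext => z; have [_ cf] := fock_expands Ff z.
apply: (cvg_unique _ cf); first exact: norm_hausdorff.
apply: cvg_near_cst; apply: nearW => n.
by apply: big1 => m _; rewrite a0 mul0r.
Qed.

(** With [rho] bounding all coordinates of [z], coefficient decay at rate [2 * rho] leaves a series
    dominated by powers of 1/2. *)
Lemma fock_eval_bound z : exists2 K : R, 0 < K &
  forall f, fock f -> cmod (f z) <= K * fnorm f.
Proof.
pose rho : R := 1 + \sum_i cmod (z i).
have rho_ge1 : 1 <= rho by rewrite lerDl sumr_ge0// => i _; exact: cmod_ge0.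
have rho0 : 0 < rho by apply: lt_le_trans rho_ge1.
have z_rho i : cmod (z i) <= rho.
  rewrite /rho (bigD1 i)//= addrCA lerDl addr_ge0// sumr_ge0// => j _; exact: cmod_ge0.
have rho2 : 0 < 2 * rho by rewrite mulr_gt0.
have [K K0 KP] := fock_coefficient_decay rho2.
exists (K * 2 ^+ d); first by rewrite mulr_gt0// exprn_gt0.
move=> f Ff; have [_ cf] := fock_expands Ff z; apply: (cmod_lim_le cf).
apply: nearW => n; apply: le_trans (cmod_sum _ _ _) _.
apply: (@le_trans _ _ (\sum_(m : bmultinom d n) K * fnorm f * (2^-1) ^+ mdeg m)).
  apply: ler_sum => m _; rewrite cmodM.
  apply: le_trans (ler_pM (cmod_ge0 _) (cmod_ge0 _) (KP f m Ff) (cmod_monomial_le m z_rho)) _.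
  have <- : (2 * rho)^-1 ^+ mdeg m * rho ^+ mdeg m = 2^-1 ^+ mdeg m.
    by rewrite -exprMn invfM -mulrA mulVf ?mulr1// gt_eqF.
  by rewrite mulrA.
rewrite -mulr_sumr [leRHS]mulrAC.
by rewrite ler_wpM2l ?geometric_bmultinom_sum// mulr_ge0 ?fnorm_ge0// ltW.
Qed.

Lemma expands_poly p : expands (fun z => meval z p) (fun m => mcoeff m p).
Proof.
move=> z; split.
  exists (\sum_(m : bmultinom d (mmeasure mdeg p)) `|mcoeff m p * monomial m z|) => n.
  have [le_n|/ltnW le_n] := leqP n (mmeasure mdeg p).
    rewrite -(sum_bmultinom_widen (fun m => `|mcoeff m p * monomial m z|) le_n).
    by rewrite [leRHS](bigID (fun m : bmultinom d _ => (mdeg m < n)%N))/= lerDl sumr_ge0.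
  rewrite -(sum_bmultinom_widen (fun m => `|mcoeff m p * monomial m z|) le_n).
  rewrite [leLHS](bigID (fun m : bmultinom d n => (mdeg m < mmeasure mdeg p)%N))/=.
  rewrite [X in _ + X]big1 ?addr0// => m; rewrite -leqNgt => /msize_mdeg_ge.
  by rewrite -mcoeff_eq0 => /eqP ->; rewrite mul0r normr0.
apply: cvg_near_cst; near=> n.
rewrite {2}(mpolywE (k := n) (p := p)); last by near: n; exact: nbhs_infty_ge.
by rewrite raddf_sum; apply: eq_bigr => m _; rewrite /= mevalZ mevalX.
Unshelve. all: by end_near. Qed.

End fock_functions.

(** * Integrals of product functions, by Tonelli *)

Section product_integrals.
Context (R : realType) (dT : measure_display) (T : measurableType dT).
Context (m : {sigma_finite_measure set T -> \bar R}).
Local Open Scope ereal_scope.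

Lemma measurable_tuple_prod n (h : T -> R) : measurable_fun setT h ->
  measurable_fun setT (fun t : n.-tuple T => \prod_(i < n) h (tnth t i))%R.
Proof.
move=> mh; elim: (index_enum 'I_n) => [|i s IH].
  by under eq_fun do rewrite big_nil; exact: measurable_cst.
under eq_fun do rewrite big_cons; apply: measurable_funM => //.
by apply: measurableT_comp => //; exact: measurable_tnth.
Qed.

Lemma prod_power_integral_fin n (h : T -> R) : measurable_fun setT h ->
  (forall x, (0 <= h x)%R) -> \int[m]_x (h x)%:E < +oo ->
  \int[prod_power m n]_t (\prod_(i < n) h (tnth t i))%:E < +oo.
Proof.
move=> mh h0 finh; elim: n => [|n IH].
  rewrite (eq_integral (fun=> 1)) => [|t _]; last by rewrite big_ord0.
  by rewrite integral_cst// mul1e /= diracE ltry.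
have mp k : measurable_fun setT
    (fun t : k.-tuple T => (\prod_(i < k) h (tnth t i))%:E).
  by apply/measurable_EFinP; exact: measurable_tuple_prod.
have p0 k (t : k.-tuple T) : 0 <= (\prod_(i < k) h (tnth t i))%:E.
  by rewrite lee_fin; apply: prodr_ge0.
have mH : measurable_fun setT (fun x : T * n.-tuple T =>
    (h x.1)%:E * (\prod_(i < n) h (tnth x.2 i))%:E).
  under eq_fun do rewrite -EFinM.
  apply/measurable_EFinP; apply: measurable_funM; first exact: measurableT_comp.
  exact: (measurableT_comp (measurable_tuple_prod mh) measurable_snd).
have H0 (x : T * n.-tuple T) : 0 <= (h x.1)%:E * (\prod_(i < n) h (tnth x.2 i))%:E.
  by apply: mule_ge0; [rewrite lee_fin|exact: p0].
have -> : \int[prod_power m n.+1]_t (\prod_(i < n.+1) h (tnth t i))%:E =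
    \int[m]_x \int[prod_power m n]_t ((h x)%:E * (\prod_(i < n) h (tnth t i))%:E).
  rewrite -[RHS](fubini_tonelli1 _ mH H0).
  transitivity (\int[pushforward (m \x prod_power m n) (@tcons _ _ n)]_t
    (\prod_(i < n.+1) h (tnth t i))%:E) => //.
  rewrite (ge0_integral_pushforward (@measurable_tcons _ _ n))//; last exact: mp.
  rewrite preimage_setT; apply: eq_integral => -[x t] _ /=.
  rewrite big_ord_recl /= EFinM; congr (_ * _%:E).
  by apply: eq_bigr => i _; rewrite /tcons /= tnthS.
set I := \int[prod_power m n]_t _ in IH.
have I0 : 0 <= I by apply: integral_ge0 => t _.
rewrite (eq_integral (fun x => (h x)%:E * I)); last first.
  move=> x _; rewrite ge0_integralZl// ?lee_fin//; exact: mp.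
rewrite -(fineK (_ : I \is a fin_num)) ?ge0_fin_numE// ge0_integralZr ?lee_fin ?fine_ge0//.
  rewrite fineK ?ge0_fin_numE//.
  have Ih0 : 0 <= \int[m]_x (h x)%:E by apply: integral_ge0 => x _; rewrite lee_fin.
  by apply: lte_mul_pinfty => //; rewrite ge0_fin_numE.
- exact/measurable_EFinP.
- by move=> x _; rewrite lee_fin.
Qed.

End product_integrals.

(** * Linear structure of the Fock space, and polynomials in it *)

Section fock_space.
Context (R : realType) (d : nat).
Local Notation C := (Cx R).
Local Notation Cd := ('I_d -> C).
Local Notation mR := (measurableTypeR R).
Local Notation plane := (mR * mR)%type.
Local Notation Re := (@complex.Re R).
Local Notation Im := (@complex.Im R).
Local Notation mu := (@lebesgue_Cd R d).
Local Notation zz := (@Cd_of_reals R d).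
Local Notation G := (fun t => gauss_density (zz t)).
Implicit Types (m : multinom d) (w : C) (r : R) (i : 'I_d) (t : d.-tuple plane).
Implicit Types (f g : Cd -> C) (a b : multinom d -> C) (z : Cd) (p : mpoly d C).

(** Half of the Gaussian exponent in one coordinate; the other half is spent on absorbing powers of
    the modulus. *)
Definition half_gauss (x : plane) : R := expR (- (x.1 ^+ 2 + x.2 ^+ 2) / 2).

(** It factors into two copies of the one-dimensional integral, which is finite because the standard
    normal density is integrable and differs only by its positive peak value. *)
Lemma integral_half_gauss : (\int[@plane_measure R]_x (half_gauss x)%:E < +oo)%E.
Proof.
pose g (x : mR) : R := expR (- x ^+ 2 / 2).
have mg : measurable_fun setT g.
  by apply: measurableT_comp => //; apply: measurable_funM => //; apply: measurable_funN; exact: measurable_funX.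
have fin_g : (\int[@lebesgue_measure R]_x (g x)%:E < +oo)%E.
  have /integrableP[_] := @integrable_normal_pdf R 0 1.
  have n1 : (1 : R) != 0 by [].
  have peak0 := @normal_peak_gt0 R 1 n1.
  under eq_integral => x _.
    rewrite /= ger0_norm ?normal_pdf_ge0// normal_pdfE// EFinM.
    over.
  rewrite ge0_integralZl//; last 3 first.
  - by apply/measurable_EFinP; exact: measurable_normal_fun.
  - by move=> x _; rewrite lee_fin normal_fun_ge0.
  - by rewrite lee_fin ltW.
  move=> fin_n.
  have -> : (\int[@lebesgue_measure R]_x (g x)%:E =
      \int[@lebesgue_measure R]_x (normal_fun 0 1 x)%:E)%E.
    by apply: eq_integral => x _; rewrite /g /normal_fun subr0 expr1n.
  rewrite ltey; apply/eqP => infn; move: fin_n; rewrite infn gt0_muley ?lte_fin//.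
have g0 x : 0 <= g x by exact: expR_ge0.
have mH : measurable_fun setT (fun x : plane => (half_gauss x)%:E).
  apply/measurable_EFinP; apply: measurableT_comp => //; apply: measurable_funM => //.
  by apply: measurable_funN; apply: measurable_funD; apply: measurable_funX.
have -> : (\int[@plane_measure R]_x (half_gauss x)%:E =
    \int[@lebesgue_measure R]_x \int[@lebesgue_measure R]_y (half_gauss (x, y))%:E)%E.
  by apply: (fubini_tonelli1 _ mH) => x; rewrite lee_fin expR_ge0.
set I := (\int[@lebesgue_measure R]_x (g x)%:E)%E in fin_g.
have I0 : (0 <= I)%E by apply: integral_ge0 => x _; rewrite lee_fin.
have -> : (\int[@lebesgue_measure R]_x \int[@lebesgue_measure R]_y (half_gauss (x, y))%:E =
    \int[@lebesgue_measure R]_x ((g x)%:E * I))%E.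
  apply: eq_integral => x _; rewrite -ge0_integralZl//; last 3 first.
  - exact/measurable_EFinP.
  - by move=> y _; rewrite lee_fin.
  - by rewrite lee_fin.
  apply: eq_integral => y _; rewrite -EFinM /g -expRD /half_gauss /=.
  by congr (expR _)%:E; rewrite opprD mulrDl.
rewrite -(fineK (_ : I \is a fin_num)) ?ge0_fin_numE// ge0_integralZr ?fine_ge0//; last 3 first.
- exact/measurable_EFinP.
- by move=> y _; rewrite lee_fin.
- by rewrite lee_fin fine_ge0.
rewrite fineK ?ge0_fin_numE//.
by rewrite lte_mul_pinfty// ge0_fin_numE.
Qed.

Lemma fockP f : fock f <-> entire f /\
  mu.-integrable setT (EFin \o (fun t => sqmod (f (zz t)) * G t)).
Proof.
split=> [[ef fin_f]|[ef /integrableP[_ fin_f]]]; split=> //.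
  have [a fa] := ef; apply/integrableP; split; first exact: measurable_fock_integrand fa.
  move: fin_f; rewrite /fock_sqnorm; congr (_ < _)%E.
  by apply: eq_integral => t _ /=; rewrite ger0_norm// -lee_fin fock_integrand_ge0.
move: fin_f; rewrite /fock_sqnorm; congr (_ < _)%E.
by apply: eq_integral => t _ /=; rewrite ger0_norm// -lee_fin fock_integrand_ge0.
Qed.

Lemma fockD f g : fock f -> fock g -> fock (fun z => f z + g z).
Proof.
move=> /fockP[[a fa] If] /fockP[[b gb] Ig]; have fgab := expandsD fa gb.
apply/fockP; split; first by exists (fun m => a m + b m).
have Ifg : mu.-integrable setT (EFin \o (fun t =>
    2 * (sqmod (f (zz t)) * G t + sqmod (g (zz t)) * G t))).
  by apply: (integrableZl measurableT 2 (integrableD measurableT If Ig)).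
apply: le_integrable Ifg => //; first exact: measurable_fock_integrand fgab.
move=> t _ /=; have G0 := ltW (gauss_density_gt0 (zz t)).
have S0 (v : C) : 0 <= sqmod v * gauss_density (zz t) by rewrite mulr_ge0 ?sqmod_ge0.
rewrite (ger0_norm (S0 _)) [X in (_ <= X%:E)%E]ger0_norm ?mulr_ge0 ?addr_ge0 ?S0// lee_fin.
by rewrite -mulrDl mulrA ler_wpM2r// sqmodD_le.
Qed.

Lemma fockZ w f : fock f -> fock (fun z => w * f z).
Proof.
move=> /fockP[[a fa] If]; have fa' := expandsZ w fa.
apply/fockP; split; first by exists (fun m => w * a m).
have If' := integrableZl measurableT (sqmod w) If.
apply: le_integrable If' => //; first exact: measurable_fock_integrand fa'.
by move=> t _ /=; rewrite lee_fin sqmodM -mulrA.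
Qed.

Lemma fock0 : fock ((fun=> 0) : Cd -> C).
Proof.
split; last by rewrite fock_sqnorm0 ltry.
exists (fun=> 0) => z; split.
  by exists 0 => n; rewrite big1// => m _; rewrite mul0r normr0.
by apply: cvg_near_cst; apply: nearW => n; rewrite big1// => m _; rewrite mul0r.
Qed.

Lemma fock_sum (I : Type) (s : seq I) (F : I -> Cd -> C) :
  (forall j, fock (F j)) -> fock (fun z => \sum_(j <- s) F j z).
Proof.
move=> FF; elim: s => [|j s IH].
  by under eq_fun do rewrite big_nil; exact: fock0.
by under eq_fun do rewrite big_cons; exact: fockD.
Qed.

(** Raise [y <= expR y] to the power [k] at [y = x / (2 * k)]. *)
Lemma powX_le_expR k (x : R) : 0 <= x -> x ^+ k <= (2 * k%:R) ^+ k * expR (x / 2).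
Proof.
case: k => [|k] x0; first by rewrite !expr0 mul1r -[leLHS]expR0 ler_expR divr_ge0.
set c : R := 2 * k.+1%:R; have c0 : 0 < c by rewrite mulr_gt0// ltr0n.
have le1 : x / c <= expR (x / c) by apply: le_trans (expR_ge1Dx _); rewrite lerDr.
have -> : x ^+ k.+1 = c ^+ k.+1 * (x / c) ^+ k.+1.
  by rewrite -exprMn mulrC divfK// gt_eqF.
apply: ler_wpM2l; first by rewrite exprn_ge0// ltW.
have -> : expR (x / 2) = expR (x / c) ^+ k.+1.
  by rewrite -expRM_natr; congr expR; rewrite /c invfM mulrA divfK// pnatr_eq0.
by rewrite lerXn2r// ?nnegrE ?divr_ge0 ?expR_ge0// ltW.
Qed.

Lemma fock_monomial m : fock (monomial m : Cd -> C).
Proof.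
have em : expands (monomial m : Cd -> C) (fun m' => mcoeff m' (mpolyX C m)).
  rewrite (_ : monomial m = (fun z => meval z (mpolyX C m))); first exact: expands_poly.
  by apply/funext => z; rewrite mevalX.
apply/fockP; split; first by exists (fun m' => mcoeff m' (mpolyX C m)).
pose K : R := (pi ^+ d)^-1 * \prod_(i < d) (2 * (m i)%:R) ^+ m i.
pose H t : R := \prod_(i < d) half_gauss (tnth t i).
have mhalf : measurable_fun setT half_gauss.
  apply: measurableT_comp => //; apply: measurable_funM => //.
  by apply: measurable_funN; apply: measurable_funD; apply: measurable_funX.
have half0 x : 0 <= half_gauss x by exact: expR_ge0.
have IH : mu.-integrable setT (EFin \o H).
  apply/integrableP; split; first by apply/measurable_EFinP; exact: measurable_tuple_prod.
  have := @prod_power_integral_fin R _ _ (@plane_measure R) d half_gauss mhalf half0 integral_half_gauss.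
  congr (_ < _)%E; apply: eq_integral => t _ /=; rewrite ger0_norm//.
  by apply: prodr_ge0 => i _.
have IKH := integrableZl measurableT K IH.
apply: le_integrable IKH => //; first exact: measurable_fock_integrand em.
move=> t _ /=; have G0 := ltW (gauss_density_gt0 (zz t)).
have H0 : 0 <= H t by apply: prodr_ge0.
have K0 : 0 <= K.
  rewrite mulr_ge0 ?invr_ge0 ?exprn_ge0 ?pi_ge0//; apply: prodr_ge0 => i _.
  by rewrite exprn_ge0// mulr_ge0.
have L0 : 0 <= sqmod (monomial m (zz t)) * gauss_density (zz t).
  by rewrite mulr_ge0 ?sqmod_ge0.
rewrite (ger0_norm L0) (ger0_norm (mulr_ge0 K0 H0)) lee_fin.
rewrite /K /H /gauss_density mulrCA -mulrA ler_wpM2l ?invr_ge0 ?exprn_ge0 ?pi_ge0//.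
rewrite sqmod_monomial -sumrN expR_sum -!big_split /=; apply: ler_prod => i _.
rewrite mulr_ge0 ?exprn_ge0 ?sqmod_ge0 ?expR_ge0//=.
rewrite /half_gauss -[_ + _]/(sqmod (zz t i)); set x := sqmod (zz t i).
have x0 : 0 <= x := sqmod_ge0 _.
apply: le_trans (ler_wpM2r (expR_ge0 _) (powX_le_expR (m i) x0)) _.
by rewrite -mulrA -expRD (_ : x / 2 - x = - x / 2)//; lra.
Qed.

Lemma fock_poly p : fock (fun z => meval z p).
Proof.
rewrite (_ : (fun z => meval z p) =
    (fun z => \sum_(m <- msupp p) mcoeff m p * monomial m z)).
  by apply: fock_sum => m; apply: fockZ; exact: fock_monomial.
by apply/funext => z; rewrite mevalE.
Qed.

Lemma fock_closure_poly (J : set (mpoly d C)) p : J p -> fock_closure J (fun z => meval z p).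
Proof.
move=> Jp; split; first exact: fock_poly.
move=> e e0; exists p => //; rewrite (_ : (fun z => _) = (fun=> 0)).
  by rewrite fock_sqnorm0 lte_fin exprn_gt0.
by apply/funext => z; rewrite subrr.
Qed.

(** Point evaluations are bounded, so a common zero of the polynomials in [J] stays a zero of their
    limits; conversely [J] lies in its closure. *)
Lemma zero_set_fock_closure (J : set (mpoly d C)) :
  zero_set (fock_closure J) = vanishing J.
Proof.
apply/seteqP; split => [z Zz p /fock_closure_poly/Zz//|z Jz f [Ff clf]].
have [K K0 KP] := fock_eval_bound z.
apply/eqP; rewrite -cmod_eq0 eq_le cmod_ge0 andbT leNgt; apply/negP => fz.
have e0 : 0 < cmod (f z) / K by rewrite divr_gt0.
have [p Jp lt_e] := clf _ e0.
have Fp : fock (fun z => f z - meval z p).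
  have := fockD Ff (fockZ (-1) (fock_poly p)).
  by congr fock; apply/funext => z'; rewrite mulN1r.
have := KP _ Fp; rewrite (Jz _ Jp) subr0; apply/negP; rewrite -ltNge mulrC -ltr_pdivlMr//.
move: lt_e; have [_ finp] := Fp; rewrite (fock_sqnormE finp) lte_fin.
by rewrite ltr_pXn2r// nnegrE ?fnorm_ge0// ltW.
Qed.

End fock_space.

(** * The inner product on finite combinations *)

Section fock_inner_product.
Context (R : realType) (d : nat).
Local Notation C := (Cx R).
Local Notation Cd := ('I_d -> C).
Local Notation mR := (measurableTypeR R).
Local Notation plane := (mR * mR)%type.
Local Notation Re := (@complex.Re R).
Local Notation Im := (@complex.Im R).
Local Notation mu := (@lebesgue_Cd R d).
Local Notation zz := (@Cd_of_reals R d).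
Implicit Types (w : C) (t : d.-tuple plane) (f g : Cd -> C) (z : Cd).

Definition re_integrand f g t : R := Re (f (zz t) * (g (zz t))^* ) * gauss_density (zz t).
Definition im_integrand f g t : R := Im (f (zz t) * (g (zz t))^* ) * gauss_density (zz t).

Lemma fock_dotE f g : fock_dot f g =
  ((\int[mu]_t re_integrand f g t)%R +i* (\int[mu]_t im_integrand f g t)%R)%C.
Proof. by []. Qed.

Lemma fock_dot_integrable f g : fock f -> fock g ->
  mu.-integrable setT (EFin \o re_integrand f g) /\
  mu.-integrable setT (EFin \o im_integrand f g).
Proof.
move=> /fockP[[a fa] If] /fockP[[b gb] Ig].
have mf := cmeasurable_expands fa; have mg := cmeasurable_expands gb.
have [mre mim] := cmeasurableM mf (cmeasurableJ mg).
have mG := @measurable_gauss_density R d.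
have Ifg := integrableD measurableT If Ig.
have le_fg t (x : R) : `|x| <= cmod (f (zz t) * (g (zz t))^* ) ->
    (`|(x * gauss_density (zz t))%:E| <=
     `|(sqmod (f (zz t)) * gauss_density (zz t))%:E +
       (sqmod (g (zz t)) * gauss_density (zz t))%:E|)%E.
  move=> le_x; have G0 := ltW (gauss_density_gt0 (zz t)).
  rewrite -EFinD /= lee_fin -mulrDl !normrM ler_wpM2r//.
  rewrite (ger0_norm (addr_ge0 (sqmod_ge0 _) (sqmod_ge0 _))).
  apply: le_trans le_x _; rewrite cmodM cmodJ -!sqr_cmod.
  have := cmod_ge0 (f (zz t)); have := cmod_ge0 (g (zz t)); nra.
split.
  apply: le_integrable Ifg => //; first by apply/measurable_EFinP; exact: measurable_funM.
  by move=> t _; apply: le_fg; exact: Re_le_cmod.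
apply: le_integrable Ifg => //; first by apply/measurable_EFinP; exact: measurable_funM.
by move=> t _; apply: le_fg; exact: Im_le_cmod.
Qed.

Lemma fock_dotDl f g h : fock f -> fock g -> fock h ->
  fock_dot (fun z => f z + g z) h = fock_dot f h + fock_dot g h.
Proof.
move=> Ff Fg Fh; rewrite !fock_dotE.
have [I1 I2] := fock_dot_integrable Ff Fh; have [I3 I4] := fock_dot_integrable Fg Fh.
apply: eq_ReIm; rewrite ?ReD ?ImD /=.
  rewrite -RintegralD//; apply: eq_Rintegral => t _.
  by rewrite /re_integrand mulrDl ReD mulrDl.
rewrite -RintegralD//; apply: eq_Rintegral => t _.
by rewrite /im_integrand mulrDl ImD mulrDl.
Qed.

Lemma fock_dotZl w f h : fock f -> fock h ->
  fock_dot (fun z => w * f z) h = w * fock_dot f h.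
Proof.
move=> Ff Fh; rewrite !fock_dotE; have [I1 I2] := fock_dot_integrable Ff Fh.
have IZ (x : R) F : mu.-integrable setT (EFin \o F) ->
    mu.-integrable setT (EFin \o (fun t => x * F t)).
  by move=> IF; exact: (integrableZl measurableT x IF).
apply: eq_ReIm; rewrite ?ReM ?ImM /=.
  rewrite -!RintegralZl// -RintegralB//; [|exact: IZ|exact: IZ].
  by apply: eq_Rintegral => t _; rewrite /re_integrand /im_integrand -mulrA ReM; ring.
rewrite -!RintegralZl// -RintegralD//; [|exact: IZ|exact: IZ].
by apply: eq_Rintegral => t _; rewrite /re_integrand /im_integrand -mulrA ImM; ring.
Qed.

Lemma fock_dotC f g : fock f -> fock g -> fock_dot g f = (fock_dot f g)^*.
Proof.
move=> Ff Fg; rewrite !fock_dotE; have [_ I2] := fock_dot_integrable Ff Fg.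
apply: eq_ReIm; rewrite ?ReJ ?ImJ /=.
  apply: eq_Rintegral => t _; rewrite /re_integrand; congr (_ * _).
  by rewrite !ReM !ReJ !ImJ; ring.
rewrite -mulN1r -RintegralZl//; apply: eq_Rintegral => t _; rewrite /im_integrand mulrA.
by congr (_ * _); rewrite !ImM !ReJ !ImJ; ring.
Qed.

Lemma fock_dot_self f : fock f -> fock_dot f f = (fnorm f ^+ 2)%:C%C.
Proof.
move=> [_ fin_f]; rewrite fock_dotE; apply: eq_ReIm => /=.
  rewrite /Rintegral (_ : fnorm f ^+ 2 = fine (fock_sqnorm f)); last by rewrite fock_sqnormE.
  by congr fine; apply: eq_integral => t _; rewrite /re_integrand mulrC_conj.
under eq_Rintegral => t _ do rewrite /im_integrand mulrC_conj /= mul0r.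
by rewrite Rintegral_cst ?mul0r.
Qed.

Section finite_sums.
Context (n : nat) (e : 'I_n -> Cd -> C).
Hypothesis Fe : forall i, fock (e i).
Implicit Types c : 'I_n -> C.

Definition lincomb c : Cd -> C := fun z => \sum_(i < n) c i * e i z.

Lemma fock_lincomb c : fock (lincomb c).
Proof. by apply: fock_sum => i; exact: fockZ. Qed.

Lemma fock_dot_suml (I : Type) (s : seq I) (F : I -> Cd -> C) g :
  (forall i, fock (F i)) -> fock g ->
  fock_dot (fun z => \sum_(i <- s) F i z) g = \sum_(i <- s) fock_dot (F i) g.
Proof.
move=> FF Fg; elim: s => [|i s IH].
  under eq_fun do rewrite big_nil; rewrite big_nil.
  have e0 : (fun z : Cd => 0 * (fun=> 0 : C) z) = (fun=> 0).
    by apply/funext => z; rewrite mul0r.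
  by have := fock_dotZl 0 (@fock0 R d) Fg; rewrite e0 => ->; rewrite mul0r.
under eq_fun do rewrite big_cons; rewrite big_cons -IH fock_dotDl//; exact: fock_sum.
Qed.

Lemma fock_dot_lincombl c g : fock g ->
  fock_dot (lincomb c) g = \sum_i c i * fock_dot (e i) g.
Proof.
move=> Fg; rewrite /lincomb (fock_dot_suml _ (fun i => fockZ (c i) (Fe i)))//.
by apply: eq_bigr => i _; rewrite fock_dotZl.
Qed.

Lemma fock_dot_lincombr c g : fock g ->
  fock_dot g (lincomb c) = \sum_i (c i)^* * fock_dot g (e i).
Proof.
move=> Fg; rewrite (fock_dotC (fock_lincomb c) Fg) fock_dot_lincombl// rmorph_sum.
by apply: eq_bigr => i _; rewrite rmorphM /= (fock_dotC (Fe i) Fg).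
Qed.

End finite_sums.

End fock_inner_product.

(** * Functional calculus and eigenfunctions *)

Section functional_calculus.
Context (R : realType) (d : nat).
Local Notation C := (Cx R).
Local Notation Cd := ('I_d -> C).
Context (H : completeNormedModType C) (T : 'I_d -> {linear H -> H}).
Hypothesis boundedT : forall i, exists M : C, forall x, `|T i x| <= M * `|x|.
Implicit Types (w : C) (m : multinom d) (f g : Cd -> C) (x y : H).

Definition hnorm x : R := complex.Re `|x|.

Lemma hnormE x : `|x| = (hnorm x)%:C%C.
Proof.
by apply: eq_ReIm => //=; apply: (@ger0_Im R); exact: normr_ge0.
Qed.

Lemma hnorm_ge0 x : 0 <= hnorm x.
Proof. by rewrite -leCR -hnormE; exact: normr_ge0. Qed.

Lemma hnormD x y : hnorm (x + y) <= hnorm x + hnorm y.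
Proof. by rewrite -leCR CRD -!hnormE; exact: ler_normD. Qed.

Lemma hnormZ w x : hnorm (w *: x) = cmod w * hnorm x.
Proof. by apply: CR_inj; rewrite CRM -!hnormE normrZ normCE. Qed.

Lemma hnorm0 : hnorm 0 = 0.
Proof. by apply: CR_inj; rewrite -hnormE normr0. Qed.

Lemma hnorm_sum (I : Type) (s : seq I) (P : pred I) (F : I -> H) :
  hnorm (\sum_(i <- s | P i) F i) <= \sum_(i <- s | P i) hnorm (F i).
Proof.
elim/big_ind2: _ => [|a b c e ab ce|//]; first by rewrite hnorm0.
exact: le_trans (hnormD _ _) (lerD ab ce).
Qed.

Lemma hnorm_lim_le (u : nat -> H) (l v : H) (b : R) : u @ \oo --> l ->
  (\forall n \near \oo, hnorm (u n - v) <= b) -> hnorm (l - v) <= b.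
Proof.
move=> /cvgrPdist_lt ul ub; rewrite leNgt; apply/negP => lt_b.
have e0 : 0 < (hnorm (l - v) - b)%:C%C :> C by rewrite ltCR subr_gt0.
have [n _ /(_ n (leqnn n))[lt1 le2]] : \forall n \near \oo,
    hnorm (l - u n) < hnorm (l - v) - b /\ hnorm (u n - v) <= b.
  near=> n; split; last by near: n.
  by rewrite -ltCR -hnormE; near: n; exact: ul.
have := hnormD (l - u n) (u n - v); rewrite addrA subrK.
by move: lt1 le2; lra.
Unshelve. all: by end_near. Qed.

Lemma uniform_bound : exists2 M : R, 1 <= M & forall i x, hnorm (T i x) <= M * hnorm x.
Proof.
have [M MP] := choice boundedT.
(* Each [M i] is a complex number, which need not be real when [H] is trivial; its modulus is still
   a bound. The summand 1 makes the common bound positive. *)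
exists (1 + \sum_i cmod (M i)).
  by rewrite lerDl sumr_ge0// => i _; exact: cmod_ge0.
move=> i x; apply: (@le_trans _ _ (cmod (M i) * hnorm x)); last first.
  rewrite ler_wpM2r ?hnorm_ge0// (bigD1 i)//= addrCA lerDl addr_ge0// sumr_ge0// => j _.
  exact: cmod_ge0.
have := MP i x; rewrite [leLHS]hnormE => le_M.
have M0 : 0 <= M i * `|x| by apply: le_trans le_M; rewrite -hnormE.
by move: le_M; rewrite -(ger0_norm M0) normrM normr_id normCE hnormE -CRM leCR.
Qed.

Section bound.
Context (M : R).
Hypothesis M_ge1 : 1 <= M.
Hypothesis TM : forall i x, hnorm (T i x) <= M * hnorm x.

Let M_ge0 : 0 <= M. Proof. exact: le_trans M_ge1. Qed.

Lemma hnorm_op_pow m x : hnorm (op_pow T m x) <= M ^+ mdeg m * hnorm x.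
Proof.
rewrite /op_pow mdegE; elim: (index_enum 'I_d) => [|i s IH].
  by rewrite !big_nil mul1r.
rewrite !big_cons /= exprD -mulrA; set y := _ x in IH *.
apply: (@le_trans _ _ (M ^+ m i * hnorm y)); last by rewrite ler_wpM2l ?exprn_ge0.
elim: (m i) => [|k IHk] /=; first by rewrite mul1r.
by apply: le_trans (TM _ _) _; rewrite exprS -mulrA ler_wpM2l.
Qed.

Definition op_partial f x (n : nat) : H :=
  \sum_(m : bmultinom d n) taylor f m *: op_pow T m x.

(** Decay at rate [4 * M] against operator norms at most [M ^+ mdeg m] leaves [4^(- mdeg m)]. One
    factor [2^(- mdeg m)] is at most [2^(-n)] on the tail, the other is summed by
    [geometric_bmultinom_sum]. *)
Lemma op_partial_tail : exists2 B : R, 0 < B &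
  forall f x n n', fock f -> (n <= n')%N ->
    hnorm (op_partial f x n' - op_partial f x n) <= B * fnorm f * hnorm x * 2^-1 ^+ n.
Proof.
have M0 : 0 < M by apply: lt_le_trans M_ge1.
have M4 : 0 < 4 * M by rewrite mulr_gt0.
have [K K0 KP] := @fock_coefficient_decay R d _ M4.
exists (K * 2 ^+ d); first by rewrite mulr_gt0// exprn_gt0.
move=> f x n n' Ff le_n; rewrite /op_partial.
rewrite (sum_bmultinomB (fun m => taylor f m *: op_pow T m x) le_n).
apply: le_trans (hnorm_sum _ _ _) _.
have c0 : 0 <= K * fnorm f * hnorm x.
  by rewrite !mulr_ge0 ?fnorm_ge0 ?hnorm_ge0// ltW.
apply: (@le_trans _ _ (\sum_(m : bmultinom d n' | (n <= mdeg m)%N)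
    K * fnorm f * hnorm x * 2^-1 ^+ n * 2^-1 ^+ mdeg m)).
  apply: ler_sum => m le_nm; rewrite hnormZ.
  apply: le_trans (ler_pM (cmod_ge0 _) (hnorm_ge0 _) (KP f m Ff) (hnorm_op_pow m x)) _.
  have -> : K * fnorm f * (4 * M)^-1 ^+ mdeg m * (M ^+ mdeg m * hnorm x) =
      K * fnorm f * hnorm x * (2^-1 ^+ mdeg m * 2^-1 ^+ mdeg m).
    have <- : (4 * M)^-1 ^+ mdeg m * M ^+ mdeg m = 2^-1 ^+ mdeg m * 2^-1 ^+ mdeg m.
      rewrite -!exprMn; congr (_ ^+ _); rewrite invfM -mulrA mulVf ?mulr1 ?gt_eqF//.
      by field.
    ring.
  rewrite -!mulrA !ler_wpM2l ?fnorm_ge0 ?hnorm_ge0 ?(ltW K0)//.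
  rewrite ler_wpM2r ?exprn_ge0// ler_wiXn2l//; lra.
rewrite -mulr_sumr.
apply: (@le_trans _ _ (K * fnorm f * hnorm x * 2^-1 ^+ n * 2 ^+ d)); last first.
  by rewrite le_eqVlt; apply/orP; left; apply/eqP; ring.
rewrite ler_wpM2l//; first by rewrite mulr_ge0// exprn_ge0.
apply: le_trans (geometric_bmultinom_sum d R n').
rewrite [leRHS](bigID (fun m : bmultinom d n' => (n <= mdeg m)%N))/= lerDl.
by apply: sumr_ge0 => m _; rewrite exprn_ge0.
Qed.

End bound.

Lemma half_power_small (A e : R) : 0 < e -> exists n : nat, A * 2^-1 ^+ n < e.
Proof.
move=> e0; have [A0|A0] := lerP A 0.
  by exists 0%N; rewrite expr0 mulr1; exact: le_lt_trans e0.
have : (fun n => (2^-1 : R) ^+ n) @ \oo --> 0.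
  by apply: cvg_expr; rewrite ger0_norm; lra.
move=> /cvgrPdist_lt /(_ (e / A)); rewrite divr_gt0// => /(_ isT)[n _ /(_ n (leqnn n))].
rewrite /= sub0r normrN ger0_norm ?exprn_ge0// => lt_n; exists n.
by rewrite mulrC -ltr_pdivlMr.
Qed.

Lemma op_entire_cvg f x : fock f -> op_partial f x @ \oo --> op_entire T f x.
Proof.
move=> Ff; have [M M1 TM] := uniform_bound.
have [B B0 BP] := op_partial_tail M1 TM.
suff : cvg (op_partial f x @ \oo) by [].
apply/cauchy_cvgP/cauchy_exP => e e0.
have eE : e = (complex.Re e)%:C%C by apply: eq_ReIm => //=; apply: (@ger0_Im R); exact: ltW.
have e0' : 0 < complex.Re e by rewrite -ltCR -eE.
have [n lt_n] := half_power_small (B * fnorm f * hnorm x) e0'.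
exists (op_partial f x n).
suff : \forall n' \near \oo, ball (op_partial f x n) e (op_partial f x n') by [].
near=> n'; rewrite -ball_normE /ball_ /= distrC hnormE eE ltCR.
by apply: le_lt_trans lt_n; apply: BP => //; near: n'; exact: nbhs_infty_ge.
Unshelve. all: by end_near. Qed.

Lemma op_entire_tail : exists2 B : R, 0 < B &
  forall f x n, fock f -> hnorm (op_entire T f x - op_partial f x n) <=
    B * fnorm f * hnorm x * 2^-1 ^+ n.
Proof.
have [M M1 TM] := uniform_bound; have [B B0 BP] := op_partial_tail M1 TM.
exists B => // f x n Ff; apply: (hnorm_lim_le (@op_entire_cvg _ x Ff)).
by near=> n'; apply: BP => //; near: n'; exact: nbhs_infty_ge.
Unshelve. all: by end_near. Qed.

Lemma op_entireD f g x : fock f -> fock g ->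
  op_entire T (fun z => f z + g z) x = op_entire T f x + op_entire T g x.
Proof.
move=> Ff Fg; apply: (@cvg_unique _ (@norm_hausdorff _ H) _ _ _ _
  (@op_entire_cvg _ x (fockD Ff Fg))).
have -> : op_partial (fun z => f z + g z) x = op_partial f x \+ op_partial g x.
  apply/funext => n; rewrite /op_partial /= -big_split; apply: eq_bigr => m _.
  by rewrite (taylorE (expandsD (fock_expands Ff) (fock_expands Fg))) scalerDl.
exact: cvgD (@op_entire_cvg _ x Ff) (@op_entire_cvg _ x Fg).
Qed.

Lemma op_entireZ w f x : fock f ->
  op_entire T (fun z => w * f z) x = w *: op_entire T f x.
Proof.
move=> Ff; apply: (@cvg_unique _ (@norm_hausdorff _ H) _ _ _ _
  (@op_entire_cvg _ x (fockZ w Ff))).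
have -> : op_partial (fun z => w * f z) x = (fun n => w *: op_partial f x n).
  apply/funext => n; rewrite /op_partial scaler_sumr; apply: eq_bigr => m _.
  by rewrite (taylorE (expandsZ w (fock_expands Ff))) scalerA.
exact: cvgZl_tmp (@op_entire_cvg _ x Ff).
Qed.

Lemma op_entire0 x : op_entire T (fun=> 0) x = 0.
Proof.
have -> : (fun=> 0) = (fun z : Cd => 0 * (fun=> 0 : C) z).
  by apply/funext => z; rewrite mul0r.
by rewrite op_entireZ ?scale0r//; exact: fock0.
Qed.

Lemma op_entire_sum (I : Type) (s : seq I) (F : I -> Cd -> C) x :
  (forall i, fock (F i)) ->
  op_entire T (fun z => \sum_(i <- s) F i z) x = \sum_(i <- s) op_entire T (F i) x.
Proof.
move=> FF; elim: s => [|i s IH].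
  by under eq_fun do rewrite big_nil; rewrite big_nil op_entire0.
under eq_fun do rewrite big_cons; rewrite big_cons -IH op_entireD//; exact: fock_sum.
Qed.

Definition truncation f n : mpoly d C :=
  \sum_(m : bmultinom d n) taylor f m *: mpolyX C m.

Lemma mcoeff_truncation f n m :
  mcoeff m (truncation f n) = if (mdeg m < n)%N then taylor f m else 0.
Proof.
case: ifP => [lt_n|/negbT nlt_n]; first exact: mcoeff_mpoly.
rewrite raddf_sum big1// => m' _ /=; rewrite mcoeffZ mcoeffX.
case: eqP => [e|]; last by rewrite mulr0.
by move: nlt_n; rewrite -e bmdeg.
Qed.

Lemma op_entire_truncation f x n : fock f ->
  op_entire T (fun z => meval z (truncation f n)) x = op_partial f x n.
Proof.
move=> Ff; apply: (@cvg_unique _ (@norm_hausdorff _ H) _ _ _ _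
  (@op_entire_cvg _ x (fock_poly (truncation f n)))).
apply: cvg_near_cst; near=> n'; have le_n : (n <= n')%N by near: n'; exact: nbhs_infty_ge.
rewrite /op_partial (taylorE (expands_poly _)).
rewrite -[RHS](sum_bmultinom_widen (fun m => taylor f m *: op_pow T m x) le_n) [RHS]big_mkcond /=.
apply: eq_bigr => m _; rewrite mcoeff_truncation; case: ifP => // _; rewrite scale0r.
Unshelve. all: by end_near. Qed.

End functional_calculus.

(** * Independent eigenfunctions and the lower bound on their combinations *)

Section eigenfunctions.
Context (R : realType) (d : nat).
Local Notation C := (Cx R).
Local Notation Cd := ('I_d -> C).
Context (H : completeNormedModType C) (dot : {dot H for Num.conj}).
Hypothesis dot_norm : forall x : H, dot x x = `|x| ^+ 2.
Context (T : 'I_d -> {linear H -> H}) (h : H).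
Hypothesis boundedT : forall i, exists M : C, forall x, `|T i x| <= M * `|x|.
Local Notation iota f := (iota_op T h f).
Local Notation L := (L_op dot T h).

Lemma dotC (x y : H) : dot x y = (dot y x)^*.
Proof. by have := hermC dot x y; rewrite expr0 mul1r. Qed.

(** [iota_adj] returns a representing function if there is one and zero otherwise. In the first case
    the identity is the defining property of the adjoint; in the second, [e] is zero because its
    eigenvalue is not, and both sides vanish. *)
Lemma eigen_form (e : Cd -> C) (lam : R) : fock e -> lam != 0 ->
  L e = (fun z => lam%:C%C * e z) ->
  forall g, fock g -> dot (iota g) (iota e) = lam%:C%C * fock_dot g e.
Proof.
move=> Fe lam0 Le g Fg; move: Le; rewrite /L_op /iota_adj.
case: xgetP => [g0 _ [Fg0 g0P] g0E|_ e0].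
  rewrite g0P// g0E (fock_dotC (fockZ _ Fe) Fg) fock_dotZl// rmorphM /= -fock_dotC//.
  by congr (_ * _); apply: eq_ReIm; rewrite ?ReJ ?ImJ //= oppr0.
have {}e0 : e = (fun=> 0).
  apply/funext => z; have /esym/eqP := congr1 (fun u => u z) e0.
  rewrite mulf_eq0 => /orP[/eqP lamC|/eqP//].
  by move: lam0; rewrite (CR_inj lamC) eqxx.
rewrite e0 /iota_op (op_entire0 boundedT) linear0r.
rewrite (fock_dotC (@fock0 R d) Fg).
have E0 : (fun=> 0) = (fun z : Cd => 0 * (fun=> 0 : C) z) by apply/funext => z; rewrite mul0r.
by rewrite {1}E0 fock_dotZl ?mul0r ?rmorph0 ?mulr0//; exact: fock0.
Qed.

Section family.
Context (n : nat) (e : 'I_n -> Cd -> C) (lam : 'I_n -> R).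
Hypothesis Fe : forall i, fock (e i).
Hypothesis lam_gt0 : forall i, 0 < lam i.
Hypothesis Le : forall i, L (e i) = (fun z => (lam i)%:C%C * e i z).

Let form i g : fock g -> dot (iota g) (iota (e i)) = (lam i)%:C%C * fock_dot g (e i).
Proof. by move=> Fg; apply: eigen_form => //; rewrite gt_eqF. Qed.

Lemma eigenfunctions_orthogonal i j : lam i != lam j -> fock_dot (e i) (e j) = 0.
Proof.
move=> ne; have := form j (Fe i); rewrite dotC form// rmorphM /= -fock_dotC//.
have -> : ((lam i)%:C%C : C)^* = (lam i)%:C%C.
  by apply: eq_ReIm; rewrite ?ReJ ?ImJ //= oppr0.
move=> /eqP; rewrite -subr_eq0 -mulrBl mulf_eq0 => /orP[|/eqP//].
by rewrite subr_eq0 => /eqP/CR_inj/eqP; rewrite (negPf ne).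
Qed.

Lemma iota_lincomb (c : 'I_n -> C) : iota (lincomb e c) = \sum_i c i *: iota (e i).
Proof.
rewrite /iota_op /lincomb (op_entire_sum boundedT); last by move=> i; exact: fockZ.
by apply: eq_bigr => i _; rewrite (op_entireZ boundedT).
Qed.

Lemma fock_dot_lincomb2 (a b : 'I_n -> C) :
  fock_dot (lincomb e a) (lincomb e b) =
  \sum_i \sum_j (b i)^* * (a j * fock_dot (e j) (e i)).
Proof.
rewrite fock_dot_lincombr//; last exact: fock_lincomb.
by apply: eq_bigr => i _; rewrite fock_dot_lincombl// mulr_sumr.
Qed.

Lemma fnorm_lincomb (c : 'I_n -> C) :
  ((fnorm (lincomb e c) ^+ 2)%:C)%C =
  \sum_i \sum_j (c i)^* * (c j * fock_dot (e j) (e i)).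
Proof. by rewrite -fock_dot_lincomb2 fock_dot_self//; exact: fock_lincomb. Qed.

(* The difference of the two sides is the squared norm of
   [\sum_i sqrt (lam i - l) * c i * e i]. *)
Lemma eigen_lower_bound (l : R) (c : 'I_n -> C) : (forall i, l <= lam i) ->
  l * fnorm (lincomb e c) ^+ 2 <= hnorm (iota (lincomb e c)) ^+ 2.
Proof.
move=> le_l; pose s i : R := Num.sqrt (lam i - l).
have dotE : ((hnorm (iota (lincomb e c)) ^+ 2)%:C)%C =
    \sum_i \sum_j (lam i)%:C%C * ((c i)^* * (c j * fock_dot (e j) (e i))).
  rewrite CRX -hnormE -dot_norm {2}iota_lincomb linear_sumr.
  apply: eq_bigr => i _; rewrite linearZr_LR /= form; last exact: fock_lincomb.
  rewrite fock_dot_lincombl// !mulr_sumr.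
  by apply: eq_bigr => j _; rewrite mulrCA.
have sE : ((fnorm (lincomb e (fun i => (s i)%:C%C * c i)) ^+ 2)%:C)%C =
    \sum_i \sum_j (lam i - l)%:C%C * ((c i)^* * (c j * fock_dot (e j) (e i))).
  rewrite fnorm_lincomb; apply: eq_bigr => i _; apply: eq_bigr => j _.
  (* Inside one eigenspace the two square roots multiply to [lam i - l]; across eigenvalues the
     inner product vanishes, whatever the weights. *)
  have [eq_lam|ne] := eqVneq (lam j) (lam i); last first.
    by rewrite eigenfunctions_orthogonal ?mulr0.
  have sJ : ((s i)%:C%C : C)^* = (s i)%:C%C.
    by apply: eq_ReIm; rewrite ?ReJ ?ImJ //= oppr0.
  have ss : (lam i - l)%:C%C = (s i)%:C%C * (s j)%:C%C :> C.
    by rewrite -CRM /s eq_lam -expr2 sqr_sqrtr// subr_ge0.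
  by rewrite rmorphM /= sJ ss; ring.
have sumE : hnorm (iota (lincomb e c)) ^+ 2 =
    l * fnorm (lincomb e c) ^+ 2 + fnorm (lincomb e (fun i => (s i)%:C%C * c i)) ^+ 2.
  apply: CR_inj; rewrite CRD CRM dotE sE fnorm_lincomb mulr_sumr -big_split.
  apply: eq_bigr => i _; rewrite mulr_sumr -big_split; apply: eq_bigr => j _ /=.
  by rewrite -mulrDl -CRD addrC subrK.
by rewrite sumE lerDl sqr_ge0.
Qed.

(** Reduces freeness to a single eigenvalue. The part [c'] of a vanishing combination [c] that
    belongs to one eigenvalue has squared norm equal to its inner product with the whole
    combination, hence zero. *)
Lemma eigenfunctions_free :
  (forall l (c : 'I_n -> C), (forall i, lam i != l -> c i = 0) ->
    lincomb e c = (fun=> 0) -> forall i, c i = 0) ->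
  forall c : 'I_n -> C, lincomb e c = (fun=> 0) -> forall i, c i = 0.
Proof.
move=> free_l c c0 i0; pose c' i := if lam i == lam i0 then c i else 0.
have -> : c i0 = c' i0 by rewrite /c' eqxx.
apply: (free_l (lam i0)) => [i /negPf ne|]; first by rewrite /c' ne.
apply: fnorm_eq0; first exact: fock_lincomb.
apply/eqP; rewrite -sqrf_eq0; apply/eqP/CR_inj; rewrite fnorm_lincomb.
transitivity (fock_dot (lincomb e c) (lincomb e c')).
  rewrite fock_dot_lincomb2; apply: eq_bigr => i _; apply: eq_bigr => j _.
  rewrite /c'; have [eq_i|ne_i] := eqVneq (lam i) (lam i0); last by rewrite rmorph0 !mul0r.
  have [eq_j|ne_j] := eqVneq (lam j) (lam i0); first by [].
  by rewrite eigenfunctions_orthogonal ?mulr0 ?mul0r// eq_i.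
rewrite c0; have E0 : (fun=> 0) = (fun z : Cd => 0 * (fun=> 0 : C) z).
  by apply/funext => z; rewrite mul0r.
by rewrite E0 fock_dotZl ?mul0r//; [exact: fock0|exact: fock_lincomb].
Qed.

End family.

Context (lambda : nat -> R).
Hypothesis hlambda : eigenvalue_sequence (@fock R d) L lambda.

(** The indices [j] with [lambda j = mu] are in bijection with a basis of the eigenspace; [E]
    follows this bijection and is a default elsewhere. Freeness comes from the uniqueness of
    coordinates in [has_dim]. *)
Lemma eigenspace_family (mu : C) : mu != 0 -> exists E : nat -> Cd -> C,
  (forall j, (lambda j)%:C%C = mu -> fock (E j) /\ L (E j) = (fun z => mu * E j z)) /\
  forall k (c : 'I_k -> C), (forall i : 'I_k, (lambda i)%:C%C != mu -> c i = 0) ->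
    lincomb (fun i : 'I_k => E i) c = (fun=> 0) -> forall i, c i = 0.
Proof.
move=> mu0; have [_ _ /(_ mu mu0)[n [[b [bV bU]] /card_set_bijP[phi [phi_fun phi_inj _]]]]] := hlambda.
pose E j : Cd -> C := oapp b (fun=> 0) (insub (phi j)).
have EE j : (lambda j)%:C%C = mu -> exists2 l : 'I_n, E j = b l & phi j = l.
  move=> jmu; have lt_n : (phi j < n)%N := phi_fun j jmu.
  by exists (Ordinal lt_n); rewrite // /E (insubT (fun i => (i < n)%N) lt_n).
exists E; split=> [j /EE[l -> _]|k c cmu cE i].
  have := bV (delta_mx 0 l).
  have -> : (fun x => \sum_(i < n) delta_mx (0 : 'I_1) l 0 i * b i x) = b l.
    apply/funext => x; rewrite (bigD1 l)//= mxE !eqxx mul1r big1 ?addr0// => i /negPf ne.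
    by rewrite mxE eqxx ne mul0r.
  by case.
have [imu|/cmu//] := eqVneq ((lambda i)%:C%C : C) mu.
have [l _ phil] := EE i imu.
(* The coefficients [c] moved to the basis vectors. As [phi] is injective on the indices of [mu],
   each sum has at most one term. *)
pose r : 'rV[C]_n := \row_l' \sum_(i' < k | ((lambda i')%:C%C == mu) && (phi i' == l')) c i'.
have rE : (fun x => \sum_(i < n) r 0 i * b i x) = (fun=> 0).
  rewrite -cE; apply/funext => x; rewrite /lincomb.
  under eq_bigr do rewrite mxE mulr_suml.
  rewrite (exchange_big_dep (fun i' : 'I_k => (lambda i')%:C%C == mu))/=; last first.
    by move=> ? ? _ /andP[].
  rewrite [RHS](bigID (fun i' : 'I_k => (lambda i')%:C%C == mu))/= [X in _ = _ + X]big1 ?addr0.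
    apply: eq_bigr => i' /eqP i'mu; have [l' -> phil'] := EE i' i'mu.
    rewrite i'mu eqxx /= (big_pred1 l')// => l''; rewrite phil' eq_sym.
    by apply/eqP/eqP => [/val_inj|->].
  by move=> i' /cmu ->; rewrite mul0r.
have V0 : eigenspace_on (@fock R d) L mu (fun=> 0).
  by rewrite -rE; exact: bV.
have [r0 [_ r0U]] := bU _ V0.
have r00 : r = 0.
  rewrite -(r0U r)//; apply: r0U; apply/funext => x; rewrite big1// => l' _.
  by rewrite mxE mul0r.
have := congr1 (fun r : 'rV[C]_n => r 0 l) r00; rewrite !mxE (big_pred1 i)// => i'.
apply/andP/eqP => [[/eqP i'mu /eqP phil']|->]; last by rewrite imu phil.
by apply/val_inj; apply: phi_inj; rewrite ?inE// phil' phil.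
Qed.

(** Indices start at 0, and all of [0, ..., k] have eigenvalue at least [lambda k > 0], which gives
    [k.+1] functions. *)
Lemma eigenfunctions_exist k : 0 < lambda k -> exists e : 'I_k.+1 -> Cd -> C,
  [/\ forall i, fock (e i), forall i, L (e i) = (fun z => (lambda i)%:C%C * e i z) &
    forall c : 'I_k.+1 -> C, lincomb e c = (fun=> 0) -> forall i, c i = 0].
Proof.
move=> lk0; have [_ noninc _] := hlambda.
have lam0 (i : 'I_k.+1) : 0 < lambda i.
  by apply: lt_le_trans lk0 _; apply: noninc; rewrite -ltnS.
have lamC0 (i : 'I_k.+1) : (lambda i)%:C%C != 0 :> C.
  by apply/eqP => /CR_inj/eqP; rewrite gt_eqF.
have /choice[E EP] : forall mu : C, exists E : nat -> Cd -> C, mu != 0 ->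
  (forall j, (lambda j)%:C%C = mu -> fock (E j) /\ L (E j) = (fun z => mu * E j z)) /\
  forall k (c : 'I_k -> C), (forall i : 'I_k, (lambda i)%:C%C != mu -> c i = 0) ->
    lincomb (fun i : 'I_k => E i) c = (fun=> 0) -> forall i, c i = 0.
  move=> mu; have [->|mu0] := eqVneq mu 0; first by exists (fun _ _ => 0).
  by have [E EP] := eigenspace_family mu0; exists E.
pose e (i : 'I_k.+1) : Cd -> C := E (lambda i)%:C%C i.
have Fe i : fock (e i) by have [/(_ i erefl)[]] := EP _ (lamC0 i).
have Le i : L (e i) = (fun z => (lambda i)%:C%C * e i z).
  by have [/(_ i erefl)[]] := EP _ (lamC0 i).
exists e; split=> //.
apply: (@eigenfunctions_free _ e (fun i => lambda i)) => // l c cl ce.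
have [/existsP[i0 /eqP i0l]|/existsPn nl] := boolP [exists i : 'I_k.+1, lambda i == l]; last first.
  by move=> i; exact/cl/nl.
have [_ freeE] := EP _ (lamC0 i0).
apply: (freeE k.+1 c) => [i ne|].
  by apply: cl; apply: contra ne => /eqP ->; rewrite i0l.
rewrite -ce; apply/funext => z; apply: eq_bigr => i _.
have [il|/cl ->] := eqVneq (lambda i) l; last by rewrite !mul0r.
by rewrite /e il i0l.
Qed.

End eigenfunctions.

(** * Decay of the eigenvalues *)

Section decay.
Context (R : realType) (d : nat).
Local Notation C := (Cx R).
Local Notation Cd := ('I_d -> C).
Context (H : completeNormedModType C) (dot : {dot H for Num.conj}).
Hypothesis dot_norm : forall x : H, dot x x = `|x| ^+ 2.
Context (T : 'I_d -> {linear H -> H}) (h : H).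
Hypothesis boundedT : forall i, exists M : C, forall x, `|T i x| <= M * `|x|.
Context (lambda : nat -> R).
Hypothesis hlambda : eigenvalue_sequence (@fock R d) (L_op dot T h) lambda.

Lemma taylor_sum (I : Type) (s : seq I) (F : I -> Cd -> C) : (forall i, fock (F i)) ->
  taylor (fun z => \sum_(i <- s) F i z) = (fun m => \sum_(i <- s) taylor (F i) m).
Proof.
move=> FF; apply: taylorE; elim: s => [|i s IH].
  have -> : (fun z => \sum_(i <- [::]) F i z) = (fun=> 0).
    by apply/funext => z; rewrite big_nil.
  have -> : (fun m => \sum_(i <- [::]) taylor (F i) m) = (fun=> 0).
    by apply/funext => m; rewrite big_nil.
  have := fock_expands (@fock0 R d); set a := taylor _ => a0.
  by rewrite -[in X in expands _ X](expands0_inj a0).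
have -> : (fun z => \sum_(j <- i :: s) F j z) = (fun z => F i z + \sum_(j <- s) F j z).
  by apply/funext => z; rewrite big_cons.
have -> : (fun m => \sum_(j <- i :: s) taylor (F j) m) =
    (fun m => taylor (F i) m + \sum_(j <- s) taylor (F j) m).
  by apply/funext => m; rewrite big_cons.
exact: expandsD (fock_expands (FF i)) IH.
Qed.

Lemma truncation_lincomb n k (e : 'I_k -> Cd -> C) (c : 'I_k -> C) :
  (forall i, fock (e i)) ->
  truncation (lincomb e c) n = \sum_i c i *: truncation (e i) n.
Proof.
move=> Fe; apply/mpolyP => m; rewrite mcoeff_truncation raddf_sum /=.
have -> : \sum_i mcoeff m (c i *: truncation (e i) n) =
    \sum_i c i * (if (mdeg m < n)%N then taylor (e i) m else 0).
  by apply: eq_bigr => i _; rewrite mcoeffZ mcoeff_truncation.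
case: (mdeg m < n)%N; last by apply/esym; apply: big1 => i _; rewrite mulr0.
rewrite /lincomb taylor_sum; last by move=> i; exact: fockZ.
by apply: eq_bigr => i _; rewrite (taylorE (expandsZ (c i) (fock_expands (Fe i)))).
Qed.

Lemma msize_truncation (f : Cd -> C) n : (mmeasure mdeg (truncation f n) <= n)%N.
Proof.
have [->|p0] := eqVneq (truncation f n) 0; first by rewrite msize0.
rewrite -mlead_deg//; have := mlead_supp p0; rewrite mcoeff_msupp mcoeff_truncation.
by case: ifP => //; rewrite eqxx.
Qed.

(* If polynomials of degree less than [n] are spanned by [k] elements modulo
   [J], some nonzero combination [f] of [k.+1] eigenfunctions has its Taylor
   polynomial of degree less than [n] in [J], so that [iota_op f] is a tail of
   its power series. *)
Lemma eigenvalue_decay (J : set (mpoly d C)) : homogeneous_ideal J ->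
  annihilator T = fock_closure J -> exists2 B : R, 0 < B &
  forall n k (I : finType) (b : I -> mpoly d C),
    (forall p, (mmeasure mdeg p <= n)%N -> exists c : I -> C, J (p - \sum_i c i *: b i)) ->
    (#|I| <= k)%N -> lambda k <= B * 2^-1 ^+ n * 2^-1 ^+ n.
Proof.
move=> homJ IJ; have idJ := homogeneous_ideal_ideal homJ.
have [B0 B0_gt0 tail] := op_entire_tail boundedT.
(* The summand 1 keeps [B] positive even when [h] is zero. *)
pose B := (B0 * hnorm h) ^+ 2 + 1.
have B_gt0 : 0 < B by rewrite ltr_wpDl ?sqr_ge0.
exists B => // n k I b span_b cardI.
have q0 : 0 <= (2^-1 : R) ^+ n by rewrite exprn_ge0.
have [lk_le0|lk0] := lerP (lambda k) 0.
  by apply: le_trans lk_le0 _; rewrite !mulr_ge0// ltW.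
have [e [Fe Le free_e]] := eigenfunctions_exist boundedT hlambda lk0.
have /choice[c cP] : forall j, exists c : I -> C,
    J (truncation (e j) n - \sum_i c i *: b i).
  by move=> j; apply: span_b; exact: msize_truncation.
pose A : 'M[C]_(k.+1, #|I|) := \matrix_(j, i) c j (enum_val i).
have [u u0 uA] : exists2 u : 'rV[C]_k.+1, u != 0 & u *m A = 0.
  by apply: nonzero_kernel_vector; rewrite ltnS.
pose f := lincomb e (fun j => u 0 j).
have Ff : fock f by exact: fock_lincomb.
have Jf : J (truncation f n).
  have -> : truncation f n = \sum_j u 0 j *: (truncation (e j) n - \sum_i c j i *: b i).
    transitivity (\sum_j u 0 j *: truncation (e j) n - \sum_j \sum_i u 0 j *: (c j i *: b i)).
      rewrite exchange_big -[LHS]subr0; congr (_ - _); first exact: truncation_lincomb.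
      apply/esym; apply: big1 => i _.
      have /matrixP/(_ 0 (enum_rank i)) := uA; rewrite !mxE => ui.
      under eq_bigr do rewrite scalerA.
      rewrite -scaler_suml (_ : \sum_j _ = 0) ?scale0r// -[RHS]ui.
      by apply: eq_bigr => j _; rewrite mxE enum_rankK.
    rewrite -sumrB; apply: eq_bigr => j _.
    by rewrite scalerBr; congr (_ - _); rewrite -scaler_sumr.
  by apply: ideal_sum => // j _; apply: idealZ.
(* The truncation of [f] is in [J], hence in the annihilator, and its value at [h] is the partial
   sum. *)
have partial0 : op_partial T f h n = 0.
  rewrite -(op_entire_truncation boundedT)//.
  have : annihilator T (fun z => meval z (truncation f n)).
    by rewrite IJ; exact: fock_closure_poly.
  by move=> [_]; apply.
have tail_f := tail f h n Ff; rewrite partial0 subr0 in tail_f.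
have f_gt0 : 0 < fnorm f.
  rewrite lt_neqAle fnorm_ge0 andbT eq_sym; apply: contra u0 => /eqP/(fnorm_eq0 Ff) f0.
  by apply/eqP/rowP => j; rewrite (free_e _ f0 j) mxE.
have lam_gt0 (i : 'I_k.+1) : lambda k <= lambda i.
  by have [_ noninc _] := hlambda; apply: noninc; rewrite -ltnS.
have low := @eigen_lower_bound _ _ _ _ dot_norm _ _ boundedT _ e (fun i => lambda i) Fe
  (fun i => lt_le_trans lk0 (lam_gt0 i)) Le (lambda k) (fun j => u 0 j) lam_gt0.
rewrite -/f in low.
have : lambda k * fnorm f ^+ 2 <= (B0 * fnorm f * hnorm h * 2^-1 ^+ n) ^+ 2.
  apply: le_trans low _; rewrite lerXn2r// ?nnegrE ?hnorm_ge0//.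
  by rewrite !mulr_ge0 ?fnorm_ge0 ?hnorm_ge0// ltW.
have -> : (B0 * fnorm f * hnorm h * 2^-1 ^+ n) ^+ 2 =
    (B0 * hnorm h) ^+ 2 * 2^-1 ^+ n * 2^-1 ^+ n * fnorm f ^+ 2 by ring.
rewrite ler_pM2r ?exprn_gt0// => le_l; apply: le_trans le_l _.
by rewrite !ler_wpM2r// /B lerDl.
Qed.

End decay.

(** * Asymptotics *)

Section asymptotics.
Context (R : realType).
Implicit Types (lambda : nat -> R).

Lemma limn_esup_le_eventually (u : nat -> \bar R) (a : \bar R) (N : nat) :
  (forall k, (N <= k)%N -> (u k <= a)%E) -> (limn_esup u <= a)%E.
Proof.
move=> ua; apply: (@le_trans _ _ (ereal_sup (u @` [set k | (N <= k)%N]))).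
  by apply: ereal_inf_lbound; exists [set k | (N <= k)%N] => //; exists N.
by apply: ge_ereal_sup => _ [k Nk <-]; exact: ua.
Qed.

(** Letting [n] grow forces [lambda k = 0] for [k >= K]; such terms count as minus infinity. *)
Lemma limsup_exponent_finite lambda (B : R) (K : nat) (a : \bar R) :
  (forall k, 0 <= lambda k) ->
  (forall n k, (K <= k)%N -> lambda k <= B * 2^-1 ^+ n * 2^-1 ^+ n) ->
  (limsup_exponent lambda <= a)%E.
Proof.
move=> lam_ge0 lamP; apply: (@le_trans _ _ -oo%E); last exact: leNye.
apply: (@limn_esup_le_eventually _ _ K) => k Kk.
rewrite (_ : lambda k == 0)//; rewrite eq_le lam_ge0 andbT leNgt; apply/negP => lk0.
have [n lt_n] := half_power_small B lk0.
have q0 : 0 <= (2^-1 : R) ^+ n by rewrite exprn_ge0.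
have := lamP n k Kk; rewrite leNgt => /negP; apply.
have [Bq0|/ltW Bq0] := lerP 0 (B * 2^-1 ^+ n); last first.
  by apply: le_lt_trans lk0; rewrite mulr_le0_ge0.
apply: le_lt_trans lt_n; rewrite ler_piMr// exprn_ile1//; lra.
Qed.

(** Take the largest [n] with [K' * n ^ D <= k]. Then [ln k] is at most [D * ln n] plus a constant,
    while [lambda k <= 2^(-n)] makes [ln (ln (lambda k)^-1)] at least [ln n] plus a constant. *)
Lemma limsup_exponent_le lambda (B : R) (K D : nat) : 0 < B ->
  (forall k, 0 <= lambda k) -> (0 < D)%N ->
  (forall n k, (K * n ^ D <= k)%N -> lambda k <= B * 2^-1 ^+ n * 2^-1 ^+ n) ->
  (limsup_exponent lambda <= (D%:R)%:E)%E.
Proof.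
move=> B0 lam_ge0 D0 lamP; pose K' := K.+1.
have ln2 : 0 < ln (2 : R) by rewrite ln_gt0// ltr1n.
have [n0 lt_n0] := half_power_small B (ltr01 : 0 < 1 :> R).
apply/lee_addgt0Pr => e e0.
pose c := ln (ln (2 : R)).
(* Solved from [ln K' + D * (ln n + ln 2) <= (D + e) * (ln n + c)] for [ln n]. The further [|c| + 1]
   below makes the denominator, at least [ln n + c], positive. *)
pose a := (ln K'%:R + D%:R * ln 2 - (D%:R + e) * c) / e.
have [N ltN] : exists N : nat, expR (`|a| + `|c| + 1) < N%:R :> R.
  by exists (Num.truncn (expR (`|a| + `|c| + 1))).+1; rewrite truncnS_gt.
(* From [n0] on, one of the two factors [2^(-n)] absorbs the constant [B]. *)
pose N' := maxn N n0.+1.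
apply: (@limn_esup_le_eventually _ _ (K' * N' ^ D)) => k le_k.
case: eqVneq => [_|lk_neq0]; first exact: leNye.
have lk0 : 0 < lambda k by rewrite lt_neqAle eq_sym lk_neq0 lam_ge0.
have exP : exists n, (K' * n ^ D <= k)%N by exists N'.
have ubP n : (K' * n ^ D <= k)%N -> (n <= k)%N.
  move=> le_n; apply: leq_trans le_n; rewrite -[leqLHS]mul1n leq_mul//.
  by case: n => // n; rewrite -{1}(expn1 n.+1) leq_pexp2l.
case: (ex_maxnP exP ubP) => n le_n max_n.
have leNn : (N' <= n)%N by apply: max_n.
have lt_k : (k.+1 <= K' * n.+1 ^ D)%N.
  by rewrite ltnNge; apply/negP => /max_n; rewrite ltnn.
have n_gt0 : (0 < n)%N by apply: leq_trans leNn; rewrite leq_max orbT.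
have nR0 : 0 < n%:R :> R by rewrite ltr0n.
have ln_n : `|a| + `|c| + 1 < ln (n%:R : R).
  rewrite -ltr_expR lnK ?posrE//; apply: lt_le_trans ltN _.
  by rewrite ler_nat; apply: leq_trans leNn; exact: leq_maxl.
have lam_le : lambda k <= 2^-1 ^+ n.
  have q0 : 0 <= (2^-1 : R) ^+ n by rewrite exprn_ge0.
  apply: le_trans (lamP n k _) _.
    by apply: leq_trans le_n; rewrite leq_mul2r leqnSn orbT.
  rewrite ler_piMl//; apply: le_trans (ltW lt_n0).
  rewrite ler_wpM2l ?(ltW B0)// ler_wiXn2l//; first lra.
  by apply: leq_trans leNn; rewrite leq_max leqnSn orbT.
have le1 : n%:R * ln 2 <= ln (lambda k)^-1.
  rewrite mulr_natl -lnXn// ler_ln ?posrE ?exprn_gt0 ?invr_gt0//.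
  by rewrite -[leLHS]invrK lef_pV2 ?posrE ?invr_gt0 ?exprn_gt0// -exprVn.
have le2 : ln n%:R + c <= ln (ln (lambda k)^-1).
  rewrite /c -lnM ?posrE// ler_ln ?posrE ?mulr_gt0//.
  by apply: lt_le_trans le1; rewrite mulr_gt0.
have le3 : ln k.+1%:R <= ln K'%:R + D%:R * (ln n%:R + ln 2) :> R.
  rewrite -lnM ?posrE// mulr_natl -lnXn ?mulr_gt0// -lnM ?posrE ?ltr0n ?exprn_gt0 ?mulr_gt0//.
  rewrite ler_ln ?posrE ?ltr0n ?mulr_gt0 ?ltr0n ?exprn_gt0 ?mulr_gt0//.
  have -> : K'%:R * (n%:R * 2) ^+ D = (K' * (n * 2) ^ D)%:R :> R by rewrite natrM natrX natrM.
  rewrite ler_nat; apply: leq_trans lt_k _.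
  by rewrite leq_mul2l leq_exp2r// muln2 -addnn -addn1 leq_add2l n_gt0 orbT.
have c_le : - `|c| <= c by rewrite lerNl -normrN ler_norm.
have a_le := ler_norm a; have c_ge0 := normr_ge0 c; have a_ge0 := normr_ge0 a.
have den0 : 0 < ln (ln (lambda k)^-1) by apply: lt_le_trans le2; lra.
rewrite -EFinD lee_fin ler_pdivrMr//; apply: le_trans le3 _.
apply: (@le_trans _ _ ((D%:R + e) * (ln n%:R + c))); last first.
  by rewrite ler_wpM2l// addr_ge0// ltW.
have : a * e <= ln n%:R * e by rewrite ler_pM2r//; lra.
rewrite /a divfK ?gt_eqF//; lra.
Qed.

End asymptotics.

(** As [Z] is closed, its relatively closed subsets are closed in the whole space, so irreducibility
    in either sense agrees for the members of the chain. *)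
Lemma has_chain_zariski_dim (R : realType) (d n : nat) (Z : set ('I_d -> Cx R)) :
  zariski_closed setT Z -> has_chain Z n -> (n%:R%:E <= zariski_dim Z)%E.
Proof.
move=> clZ [V [irrV ltV]]; apply: ereal_sup_ubound; exists n => //; exists V; split=> // i le_i.
have [[clV V0 irr] VZ] := irrV i le_i; split=> //.
  by have [S VS] := clV; exists S; rewrite -[LHS](setIidr VZ) {1}VS setTI.
have closedZ A : zariski_closed Z A -> zariski_closed setT A.
  by move=> [S ->]; apply: zariski_closedI => //; exists S; rewrite setTI.
by move=> A B /closedZ cA /closedZ cB; exact: irr.
Qed.

Theorem theorem1p3 (R : realType) (d : nat)
  (H : completeNormedModType (Cx R)) (dot : {dot H for Num.conj})
  (dot_norm : forall x : H, dot x x = `|x| ^+ 2)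
  (T : 'I_d -> {linear H -> H}) (h : H)
  (hT : cyclic_commuting_tuple T h)
  (hI : graded (annihilator T))
  (lambda : nat -> R)
  (hlambda : eigenvalue_sequence (@fock R d) (L_op dot T h) lambda) :
  (limsup_exponent lambda <= zariski_dim (zero_set (annihilator T)))%E.
Proof.
have [boundedT _ _] := hT; have [J homJ IJ] := hI; have [lam_ge0 _ _] := hlambda.
have [B B0 decay] := eigenvalue_decay dot_norm boundedT hlambda homJ IJ.
(* If [J] is everything, its zero set is empty and has dimension minus infinity. The empty family
   then spans the quotient, so every [lambda k] vanishes and the limsup is minus infinity too. *)
have [J1|J1] := pselect (J 1).
  apply: (@limsup_exponent_finite _ _ B 0) => // n k _.
  apply: (@decay _ _ 'I_0 (fun=> 0)); last by rewrite card_ord.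
  move=> p _; exists (fun=> 0); rewrite big_ord0 subr0 -[p]mulr1.
  by have [_ _ + _] := homJ; apply.
have [D [[K growth] chain]] := growth_and_chain homJ J1.
have dimD : (D%:R%:E <= zariski_dim (zero_set (annihilator T)))%E.
  rewrite IJ zero_set_fock_closure//; apply: has_chain_zariski_dim chain.
  exact: zariski_closed_vanishing.
have bound n k : (K * n ^ D <= k)%N -> lambda k <= B * 2^-1 ^+ n * 2^-1 ^+ n.
  move=> le_k; have [I [b [cardI _ span_b]]] := growth n.
  exact: decay span_b (leq_trans cardI le_k).
(* For [D = 0] the threshold [K * n ^ D] is constant in [n], and only finitely many eigenvalues are
   nonzero. *)
have [D0|D_gt0] := posnP D; last first.
  exact: le_trans (limsup_exponent_le B0 lam_ge0 D_gt0 bound) dimD.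
apply: (@limsup_exponent_finite _ _ B K) => // n k Kk; apply: bound.
by rewrite D0 expn0 muln1.
Qed.
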